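(* Let $\mathbf f=(f_1,\dots,f_k)$ and $\mathbf g=(g_1,\dots,g_{k'})$ be tuples of positive regular free holomorphic functions with $n$ and $\ell$ indeterminates, respectively, let $\mathbf m=(m_1,\dots,m_k)\in\mathbb N^k$ and $\mathbf d=(d_1,\dots,d_{k'})\in\mathbb N^{k'}$, and assume that $\mathbf D^{\mathbf m}_{\mathbf f}(\mathcal H)$ and $\mathbf D^{\mathbf d}_{\mathbf g}(\mathcal H)$ are closed in the operator norm topology for every Hilbert space $\mathcal H$. If $\widehat\Psi:\mathcal A(\mathbf D^{\mathbf m}_{\mathbf f})\to\mathcal A(\mathbf D^{\mathbf d}_{\mathbf g})$ is a unital completely contractive isomorphism, then the map $\varphi:\mathbf D^{\mathbf d}_{\mathbf g}(\mathbb C)\to\mathbf D^{\mathbf m}_{\mathbf f}(\mathbb C)$ defined by $$\varphi(\lambda):=\left[\lim_{r\to1}\mathbf B_{\mathbf g,r\lambda}[\widehat\Psi(\mathbf W^{(\mathbf f)}_{i,j})]:\ i\in\{1,\dots,k\},\ j\in\{1,\dots,n_i\}\right],\qquad\lambda\in\mathbf D^{\mathbf d}_{\mathbf g}(\mathbb C),$$ where $\mathbf W^{(\mathbf f)}=\{\mathbf W^{(\mathbf f)}_{i,j}\}$ is the universal model of the abstract polydomain $\mathbf D^{\mathbf m}_{\mathbf f}$ and $\mathbf B_{\mathbf g,r\lambda}$ is the Berezin transform at $r\lambda\in\mathbf D^{\mathbf d}_{\mathbf g,>}(\mathbb C)$, is a homeomorphism which is a biholomorphic function from $\mathrm{Int}(\mathbf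 D^{\mathbf d}_{\mathbf g}(\mathbb C))$ onto $\mathrm{Int}(\mathbf D^{\mathbf m}_{\mathbf f}(\mathbb C))$, and $n=\ell$.
   Context: $\mathbb N=\{1,2,\dots\}$. Notation is given for $\mathbf f=(f_1,\dots,f_k)$, where $f_i$ is in $n_i$ noncommuting indeterminates $Z_{i,1},\dots,Z_{i,n_i}$ and $n=n_1+\cdots+n_k$; for $\mathbf g=(g_1,\dots,g_{k'})$, $g_i$ in $\ell_i$ indeterminates, $\ell=\ell_1+\cdots+\ell_{k'}$, everything is defined in the same way with $(k,n_i,m_i,f_i)$ replaced by $(k',\ell_i,d_i,g_i)$. $\mathbb F^+_{n_i}$ is the free unital semigroup on generators $\gamma^i_1,\dots,\gamma^i_{n_i}$ with identity $\gamma^i_0$; $|\alpha|$ is word length. For a tuple $X_i=(X_{i,1},\dots,X_{i,n_i})$ (operators or scalars) and $\alpha=\gamma^i_{j_1}\cdots\gamma^i_{j_p}$ put $X_{i,\alpha}=X_{i,j_1}\cdots X_{i,j_p}$, $X_{i,\gamma^i_0}=I$. $f_i=\sum_{\alpha\in\mathbb F^+_{n_i}}a_{i,\alpha}Z_{i,\alpha}$ is positive regular free holomorphic: $a_{i,\alpha}\ge0$, $a_{i,\gamma^i_0}=0$, $a_{i,\gamma^i_j}>0$ for $1\le j\le n_i$, and $\limsup_{p\to\infty}(\sum_{|\alpha|=p}|a_{i,\alpha}|^2)^{1/2p}<\infty$. Put $\Phi_{f_i,X_i}(Y)=\sum_{|\alpha|\ge1}a_{i,\alpha}X_{i,\alpha}YX_{i,\alpha}^*$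 (weak operator convergence), $\Delta^{\mathbf p}_{\mathbf f,\mathbf X}=(id-\Phi_{f_1,X_1})^{p_1}\circ\cdots\circ(id-\Phi_{f_k,X_k})^{p_k}$ for $\mathbf p\in\mathbb Z_+^k$. $\mathbf D^{\mathbf m}_{\mathbf f}(\mathcal H)$ is the set of all $\mathbf X\in B(\mathcal H)^{n_1}\times\cdots\times B(\mathcal H)^{n_k}$ such that the entries of $X_s$ commute with those of $X_t$ for $s\ne t$ and $\Delta^{\mathbf p}_{\mathbf f,\mathbf X}(I)\ge0$ for all $\mathbf 0\le\mathbf p\le\mathbf m$ (componentwise). In particular $\mathbf D^{\mathbf m}_{\mathbf f}(\mathbb C)\subset\mathbb C^n$ is the set of $z=(z_1,\dots,z_k)$ with $\sum_{|\alpha|\ge1}a_{i,\alpha}|z_{i,\alpha}|^2\le1$ for each $i$; $\mathbf D^{\mathbf m}_{\mathbf f,>}(\mathbb C)$ is the subset where all these inequalities are strict; $\mathrm{Int}$ denotes interior in $\mathbb C^n$. $F^2(H_{n_i})=\mathbb C1\oplus\bigoplus_{p\ge1}H_{n_i}^{\otimes p}$ is the full Fock space over an $n_i$-dimensional Hilbert space, with orthonormal basis $\{e^i_\alpha\}_{\alpha\in\mathbb F^+_{n_i}}$, $e^i_{\gamma^i_0}=1$. Set $b^{(m_i)}_{i,\gamma^i_0}=1$ and $b^{(m_i)}_{i,\alpha}=\sum_{p=1}^{|\alpha|}\sum_{\omega_1\cdots\omega_p=\alpha,\,|\omega_s|\ge1}a_{i,\omega_1}\cdots a_{i,\omega_p}\binom{p+m_i-1}{m_i-1}$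 for $|\alpha|\ge1$; $W_{i,j}e^i_\alpha=\sqrt{b^{(m_i)}_{i,\alpha}/b^{(m_i)}_{i,\gamma^i_j\alpha}}\;e^i_{\gamma^i_j\alpha}$; the universal model $\mathbf W^{(\mathbf f)}$ consists of $\mathbf W^{(\mathbf f)}_{i,j}=I\otimes\cdots\otimes W_{i,j}\otimes\cdots\otimes I$ ($i$-th factor) on $\otimes_{i=1}^kF^2(H_{n_i})$. $\mathcal A(\mathbf D^{\mathbf m}_{\mathbf f})$ is the norm-closed algebra generated by all $\mathbf W^{(\mathbf f)}_{i,j}$ and the identity. For $\mu\in\mathbf D^{\mathbf m}_{\mathbf f,>}(\mathbb C)$ the Berezin transform is $\mathbf B_{\mathbf f,\mu}[x]=\langle x\Gamma_\mu,\Gamma_\mu\rangle$, $x\in B(\otimes_iF^2(H_{n_i}))$, where $\Gamma_\mu=\prod_{i=1}^k(1-\sum_{|\alpha|\ge1}a_{i,\alpha}|\mu_{i,\alpha}|^2)^{m_i/2}\sum_{\beta_1,\dots,\beta_k}\overline{\mu}_{1,\beta_1}\cdots\overline{\mu}_{k,\beta_k}\sqrt{b^{(m_1)}_{1,\beta_1}}\cdots\sqrt{b^{(m_k)}_{k,\beta_k}}\,e^1_{\beta_1}\otimes\cdots\otimes e^k_{\beta_k}$; $\mathbf B_{\mathbf g,\mu}$ is defined analogously. A biholomorphic function is a holomorphic bijection with holomorphic inverse. *)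

(* Defs.v *)
From HB Require Import structures.
From mathcomp Require Import all_boot all_order all_algebra finmap.
From mathcomp Require Import all_classical all_reals all_analysis.
From mathcomp Require Import complex ring lra.
From mathcomp.analysis Require showcase.summability.

Set Implicit Arguments.
Unset Strict Implicit.
Unset Printing Implicit Defensive.

Import Order.TTheory GRing.Theory Num.Theory numFieldNormedType.Exports.

Local Open Scope complex_scope.
Local Open Scope ring_scope.
Local Open Scope classical_set_scope.

#[local] Existing Instance summability.totally_filter.

(* The generic normed-module structure on a numClosedFieldType is not inferred
   for the concrete type R[i]; it is copied here. *)
HB.instance Definition _ (R : realType) := NormedModule.copy R[i] (R[i])^o.

(* Norms over R[i] take their values in R[i]; rnorm is the real number. *)
Definition rnorm (R : realType) (V : normedModType R[i]) (x : V) : R :=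
  complex.Re `|x|.

HB.mixin Record isHilbert (R : realType) H
    of CompleteNormedModule R[i] H := {
  ip : H -> H -> R[i];
  ipDl : forall x y z, ip (x + y) z = ip x z + ip y z;
  ipZl : forall a x y, ip (a *: x) y = a * ip x y;
  ipC : forall x y, ip x y = (ip y x)^*;
  ipE : forall x, ip x x = `|x| ^+ 2
}.

#[short(type="hilbertType")]
HB.structure Definition Hilbert (R : realType) :=
  { H of CompleteNormedModule R[i] H & isHilbert R H }.

Section rnorm_theory.
Variable R : realType.

Lemma rnormE (V : normedModType R[i]) (x : V) : (rnorm x)%:C = `|x|.
Proof. by rewrite /rnorm RRe_real // ger0_real. Qed.

Lemma rnorm_ge0 (V : normedModType R[i]) (x : V) : 0 <= rnorm x.
Proof. by rewrite -ler0c rnormE. Qed.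

Lemma rnorm0 (V : normedModType R[i]) : rnorm (0 : V) = 0.
Proof. by rewrite /rnorm normr0. Qed.

Lemma rnorm0_eq0 (V : normedModType R[i]) (x : V) : rnorm x = 0 -> x = 0.
Proof. by move=> x0; apply/normr0_eq0; rewrite -rnormE x0. Qed.

Lemma rnormD (V : normedModType R[i]) (x y : V) :
  rnorm (x + y) <= rnorm x + rnorm y.
Proof. by rewrite -lecR rmorphD /= !rnormE ler_normD. Qed.

Lemma rnormZ (V : normedModType R[i]) a (x : V) :
  rnorm (a *: x) = rnorm a * rnorm x.
Proof. by apply: complexI; rewrite rmorphM /= !rnormE normrZ. Qed.

Lemma rnormN (V : normedModType R[i]) (x : V) : rnorm (- x) = rnorm x.
Proof. by rewrite /rnorm normrN. Qed.

Lemma rnorm_real (r : R) : rnorm r%:C = `|r|.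
Proof. by apply: complexI; rewrite rnormE normc_def /= expr0n addr0 sqrtr_sqr. Qed.

Lemma rnorm_sqr (z : R[i]) :
  rnorm z ^+ 2 = complex.Re z ^+ 2 + complex.Im z ^+ 2.
Proof. by apply: complexI; rewrite add_Re2_Im2 -rnormE rmorphXn. Qed.

Lemma gt0_complex (e : R[i]) : 0 < e -> exists2 r : R, 0 < r & e = r%:C.
Proof.
move=> e0; exists (complex.Re e); last by rewrite RRe_real // gtr0_real.
by move: e0; rewrite ltcE => /andP[].
Qed.

End rnorm_theory.

Section ell2.
Variables (R : realType) (I : choiceType).

Definition sqsummable : {pred I -> R[i]} :=
  mem [set x : I -> R[i] |
    (\esum_(i in [set: I]) (rnorm (x i) ^+ 2)%:E < +oo)%E].

Record ell2 := Ell2 { ell2_fun :> I -> R[i]; _ : ell2_fun \in sqsummable }.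

HB.instance Definition _ := [isSub for ell2_fun].
HB.instance Definition _ := [Choice of ell2 by <:].

Implicit Types (J : {fset I}).

Let psum (x : I -> R[i]) J : R :=
  summability.partial_sum (fun i => rnorm (x i) ^+ 2) J.
Let nrm2 (x : I -> R[i]) : R := fine (\esum_(i in [set: I]) (rnorm (x i) ^+ 2)%:E)%E.

Let psumE (x : I -> R[i]) J : psum x J = \sum_(i <- J) rnorm (x i) ^+ 2.
Proof. by rewrite /psum /summability.partial_sum big_seq_fsetE. Qed.

Let sq_ge0 (x : I -> R[i]) i : (0 <= (rnorm (x i) ^+ 2)%:E)%E.
Proof. by rewrite lee_fin sqr_ge0. Qed.

Let psum_le_esum (x : I -> R[i]) J :
  ((psum x J)%:E <= \esum_(i in [set: I]) (rnorm (x i) ^+ 2)%:E)%E.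
Proof.
apply: esum_ge; exists [set` J]; first by split => //; exact: finite_fset.
by rewrite psumE -sumEFin fsbig_finite ?finite_fset //= set_fsetK.
Qed.

Let esum_le (x : I -> R[i]) M : (forall J, psum x J <= M) ->
  (\esum_(i in [set: I]) (rnorm (x i) ^+ 2)%:E <= M%:E)%E.
Proof.
move=> xM; apply: ge_ereal_sup => _ [F [finF _] <-].
rewrite fsbig_finite //= sumEFin lee_fin.
by apply: le_trans (xM (fset_set F)); rewrite psumE.
Qed.

Let sqsummableP (x : I -> R[i]) : reflect (exists M, forall J, psum x J <= M)
  (x \in sqsummable).
Proof.
apply: (iffP idP) => [|[M xM]].
  rewrite inE /= => xoo; exists (nrm2 x) => J.
  rewrite -lee_fin fineK ?psum_le_esum //.
  by rewrite ge0_fin_numE // esum_ge0.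
by rewrite inE /=; apply: le_lt_trans (esum_le xM) (ltry _).
Qed.

Let nrm2E (x : I -> R[i]) : x \in sqsummable ->
  (nrm2 x)%:E = (\esum_(i in [set: I]) (rnorm (x i) ^+ 2)%:E)%E.
Proof. by rewrite inE /= => xoo; rewrite fineK // ge0_fin_numE // esum_ge0. Qed.

Let psum_le (x : I -> R[i]) J : x \in sqsummable -> psum x J <= nrm2 x.
Proof. by move=> xl2; rewrite -lee_fin nrm2E // psum_le_esum. Qed.

Let nrm2_le (x : I -> R[i]) M : (forall J, psum x J <= M) -> nrm2 x <= M.
Proof.
move=> xM; have xl2 : x \in sqsummable by apply/sqsummableP; exists M.
by rewrite -lee_fin nrm2E // esum_le.
Qed.

Let psum_ge0 (x : I -> R[i]) J : 0 <= psum x J.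
Proof. by rewrite psumE sumr_ge0 // => i _; rewrite sqr_ge0. Qed.

Let nrm2_ge0 (x : I -> R[i]) : 0 <= nrm2 x.
Proof. by rewrite fine_ge0 // esum_ge0. Qed.

Let psum_mono (x : I -> R[i]) J J' : (J `<=` J')%fset -> psum x J <= psum x J'.
Proof.
move=> JJ'; rewrite -lee_fin.
have h K : ((psum x K)%:E = \esum_(i in [set` K]) (rnorm (x i) ^+ 2)%:E)%E.
  rewrite esum_fset ?finite_fset //.
  by rewrite psumE -sumEFin fsbig_finite ?finite_fset //= set_fsetK.
rewrite !h; apply: (@le_trans _ _ (\esum_(i in [set` J]) (rnorm (x i) ^+ 2)%:E)%E) => //.
rewrite esum_mkcond [leRHS]esum_mkcond; apply: le_esum => i _.
case: ifPn => [|_]; last by case: ifPn.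
by rewrite inE => /= iJ; rewrite mem_set //=; apply: (fsubsetP JJ').
Qed.

Let psum_cvg (x : I -> R[i]) : x \in sqsummable -> psum x @ summability.totally --> nrm2 x.
Proof.
move=> xl2; apply/cvgrPdist_le => e e0.
have [J xJ] : exists J, nrm2 x - e < psum x J.
  apply: contrapT => /forallNP xe; suff: nrm2 x <= nrm2 x - e by lra.
  by apply: nrm2_le => J; have /negP := xe J; rewrite -leNgt.
exists J => // J' /= JJ'; rewrite ger0_norm ?subr_ge0 ?psum_le //.
by have := psum_mono x JJ'; lra.
Qed.

Let psumD (x y : I -> R[i]) (t : R) J : 0 < t ->
  psum (x + y) J <= (1 + t) * psum x J + (1 + t^-1) * psum y J.
Proof.
move=> t0; rewrite !psumE !big_distrr -big_split /=; apply: ler_sum => i _.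
have xy : rnorm (x i + y i) ^+ 2 <= (rnorm (x i) + rnorm (y i)) ^+ 2.
  by rewrite ler_sqr ?nnegrE ?addr_ge0 ?rnorm_ge0 // rnormD.
apply: le_trans xy _.
have : 0 <= (t * rnorm (x i) - rnorm (y i)) ^+ 2 / t.
  by rewrite divr_ge0 ?sqr_ge0 // ltW.
set a := rnorm _; set b := rnorm _.
suff -> : (t * a - b) ^+ 2 / t =
  ((1 + t) * a ^+ 2 + (1 + t^-1) * b ^+ 2) - (a + b) ^+ 2 by rewrite subr_ge0.
by field; rewrite gt_eqF.
Qed.

Let psumZ a (x : I -> R[i]) J : psum (a *: x) J = rnorm a ^+ 2 * psum x J.
Proof.
rewrite !psumE big_distrr /=; apply: eq_bigr => i _.
by rewrite [(_ *: _) i]/= rnormZ exprMn.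
Qed.

Lemma sqsummable_submod_closed : submod_closed sqsummable.
Proof.
split.
  apply/sqsummableP; exists 0 => J; rewrite psumE big1 // => i _.
  by rewrite rnorm0 expr0n.
move=> a x y xl2 yl2; apply/sqsummableP.
exists ((1 + 1) * (rnorm a ^+ 2 * nrm2 x) + (1 + 1^-1) * nrm2 y) => J.
apply: le_trans (psumD _ _ _ ltr01) _; rewrite psumZ.
apply: lerD; apply: ler_wpM2l; rewrite ?psum_le //; try lra.
by apply: ler_wpM2l; rewrite ?sqr_ge0 ?psum_le.
Qed.

HB.instance Definition _ :=
  GRing.isSubmodClosed.Build _ _ sqsummable sqsummable_submod_closed.
HB.instance Definition _ := [SubChoice_isSubLmodule of ell2 by <:].

Let rn (x : ell2) : R := Num.sqrt (nrm2 x).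

Let rn_ge0 (x : ell2) : 0 <= rn x. Proof. exact: sqrtr_ge0. Qed.

Let rn_le (x : ell2) M : 0 <= M ->
  (rn x <= M) <-> (forall J, psum x J <= M ^+ 2).
Proof.
move=> M0; rewrite /rn -[X in _ <= X]ger0_norm // -sqrtr_sqr ler_sqrt ?sqr_ge0 //.
split=> [xM J|]; last exact: nrm2_le.
exact: le_trans (psum_le _ (valP x)) xM.
Qed.

Let rn_psum (x : ell2) J : psum x J <= rn x ^+ 2.
Proof. exact: (proj1 (rn_le x (rn_ge0 x)) (lexx _)). Qed.

Let rn0 (x : ell2) : rn x = 0 -> x = 0.
Proof.
move=> x0; apply/val_inj/funext => i; apply: rnorm0_eq0.
have := rn_psum x [fset i]%fset; rewrite psumE big_seq_fset1 x0 expr0n /= => xi.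
apply/eqP; rewrite -sqrf_eq0 eq_le xi; exact: sqr_ge0.
Qed.

Let rnD (x y : ell2) : rn (x + y) <= rn x + rn y.
Proof.
have [/rn0 ->|x0] := eqVneq (rn x) 0; first by rewrite add0r lerDr rn_ge0.
have [/rn0 ->|y0] := eqVneq (rn y) 0; first by rewrite addr0 lerDl rn_ge0.
have {}x0 : 0 < rn x by rewrite lt_def x0 rn_ge0.
have {}y0 : 0 < rn y by rewrite lt_def y0 rn_ge0.
apply/rn_le => [|J]; first by rewrite addr_ge0 ?rn_ge0.
rewrite [X in psum X _](_ : _ = (x : I -> _) + y) //.
apply: le_trans (psumD _ _ _ (divr_gt0 y0 x0)) _.
have -> : (rn x + rn y) ^+ 2 = (1 + rn y / rn x) * rn x ^+ 2 +
    (1 + (rn y / rn x)^-1) * rn y ^+ 2.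
  by field; rewrite !gt_eqF.
have t0 : 0 < rn y / rn x by rewrite divr_gt0.
apply: lerD; apply: ler_wpM2l; rewrite ?rn_psum //.
  by rewrite addr_ge0 ?ltW.
by rewrite addr_ge0 ?invr_ge0 ?ltW.
Qed.

Let rnZ a (x : ell2) : rn (a *: x) = rnorm a * rn x.
Proof.
have h b (y : ell2) : rn (b *: y) <= rnorm b * rn y.
  apply/rn_le => [|J]; first by rewrite mulr_ge0 ?rn_ge0 ?rnorm_ge0.
  rewrite [X in psum X _](_ : _ = b *: (y : I -> _)) // psumZ exprMn.
  by rewrite ler_wpM2l ?sqr_ge0 ?rn_psum.
have [->|a0] := eqVneq a 0.
  apply/eqP; rewrite eq_le h rnorm0 mul0r; exact: rn_ge0.
apply/eqP; rewrite eq_le h /=.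
have := h a^-1 (a *: x); rewrite scalerA mulVf // scale1r => xa.
have aa : rnorm a * rnorm a^-1 = 1.
  by rewrite -rnormZ [a *: _]mulfV // rnorm_real normr1.
by apply: le_trans (ler_wpM2l (rnorm_ge0 a) xa) _; rewrite mulrA aa mul1r.
Qed.

Let nm (x : ell2) : R[i] := (rn x)%:C.

Let nmD (x y : ell2) : nm (x + y) <= nm x + nm y.
Proof. by rewrite -rmorphD lecR rnD. Qed.

Let nmZ a (x : ell2) : nm (a *: x) = `|a| * nm x.
Proof. by rewrite /nm rnZ rmorphM /= rnormE. Qed.

Let nm0 (x : ell2) : nm x = 0 -> x = 0.
Proof. by move=> /complexI /rn0. Qed.

HB.instance Definition _ := Lmodule_isNormed.Build R[i] ell2 nmD nmZ nm0.

Let rnormEl2 (x : ell2) : rnorm x = rn x.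
Proof. by apply: complexI; rewrite rnormE. Qed.

Let coord_le (x : ell2) i : rnorm (x i) <= rnorm x.
Proof.
have := rn_psum x [fset i]%fset; rewrite psumE big_seq_fset1 -rnormEl2.
by rewrite ler_sqr // nnegrE rnorm_ge0.
Qed.

Let cvg_coord (F : set_system ell2) : ProperFilter F -> cauchy F ->
  exists l : I -> R[i], forall i (e : R), 0 < e ->
    \forall x \near F, rnorm ((x : ell2) i - l i) < e.
Proof.
move=> FF Fc.
have Fb (e : R) : 0 < e -> exists2 A, F A &
    forall x y, A x -> A y -> rnorm (x - y) < e.
  move=> e0; have e0C : 0 < e%:C :> R[i] by rewrite ltcR.
  have [[A B] /= [FA FB] AB] := Fc _ (entourage_ball _ (PosNum e0C)).
  exists (A `&` B) => [|x y [Ax _] [_ By]]; first exact: filterI.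
  by have := AB (x, y) (conj Ax By); rewrite -ball_normE /= -rnormE ltcR.
have part (p : R[i] -> R) : (forall z, `|p z| <= rnorm z) ->
    (forall z w, p (z - w) = p z - p w) -> forall i, exists l : R,
    forall e, 0 < e -> \forall x \near F, `|p ((x : ell2) i) - l| < e.
  move=> ple pB i; pose G := (fun x : ell2 => p (x i)) @ F.
  have /cauchy_cvgP/cvg_ex[l Gl] : cauchy G.
    apply/cauchy_ballP => e e0; have [A FA Ae] := Fb _ e0.
    exists ((fun x : ell2 => p (x i)) @` A, (fun x : ell2 => p (x i)) @` A) => /=.
      by split; apply: (@filterS _ F _ A _ _ FA) => x Ax /=; exists x.
    move=> [_ _] /= [[x Ax <-] [y Ay <-]]; rewrite -ball_normE /= -pB.
    apply: le_lt_trans (ple _) _; apply: le_lt_trans (Ae _ _ Ax Ay).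
    exact: (coord_le (x - y) i).
  exists l => e e0; have /cvgrPdist_lt/(_ e e0) := Gl.
  by apply: filterS => x; rewrite distrC.
have Rele (z : R[i]) : `|complex.Re z| <= rnorm z.
  rewrite -ler_sqr ?nnegrE ?rnorm_ge0 // rnorm_sqr real_normK ?num_real //.
  by rewrite lerDl sqr_ge0.
have Imle (z : R[i]) : `|complex.Im z| <= rnorm z.
  rewrite -ler_sqr ?nnegrE ?rnorm_ge0 // rnorm_sqr real_normK ?num_real //.
  by rewrite lerDr sqr_ge0.
have ReB (z w : R[i]) : complex.Re (z - w) = complex.Re z - complex.Re w.
  by case: z w => [? ?] [? ?].
have ImB (z w : R[i]) : complex.Im (z - w) = complex.Im z - complex.Im w.
  by case: z w => [? ?] [? ?].
have [a Ha] := choice (part _ Rele ReB).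
have [b Hb] := choice (part _ Imle ImB).
exists (fun i => a i +i* b i) => i e e0.
have e20 : 0 < e / 2 by rewrite divr_gt0.
near=> x.
have xa : `|complex.Re (x i) - a i| < e / 2 by near: x; exact: Ha.
have xb : `|complex.Im (x i) - b i| < e / 2 by near: x; exact: Hb.
rewrite -ltr_sqr ?nnegrE ?rnorm_ge0 ?ltW // rnorm_sqr.
move: xa xb; case: (x i) => u v /= xa xb.
rewrite -(real_normK (num_real (u - a i))) -(real_normK (num_real (v - b i))).
have := normr_ge0 (u - a i); have := normr_ge0 (v - b i).
by move: xa xb; set p := `|_|; set q := `|_|; nra.
Unshelve. all: by end_near. Qed.

Lemma ell2_complete (F : set_system ell2) :
  ProperFilter F -> cauchy F -> cvg F.
Proof.
move=> FF Fc; have [l Fl] := cvg_coord FF Fc.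
have Fb (e : R) : 0 < e -> exists2 A, F A &
    forall x y, A x -> A y -> rnorm (x - y) < e.
  move=> e0; have e0C : 0 < e%:C :> R[i] by rewrite ltcR.
  have [[A B] /= [FA FB] AB] := Fc _ (entourage_ball _ (PosNum e0C)).
  exists (A `&` B) => [|x y [Ax _] [_ By]]; first exact: filterI.
  by have := AB (x, y) (conj Ax By); rewrite -ball_normE /= -rnormE ltcR.
have key (e : R) : 0 < e -> \forall x \near F, forall J,
    psum (((x : ell2) : I -> R[i]) - l) J <= e ^+ 2.
  move=> e0; have [A FA Ae] := Fb _ e0.
  apply: (filterS _ (FA)) => x Ax J; rewrite psumE.
  apply/ler_addgt0Pr => d d0.
  have [t t0 Ht] : exists2 t : R, 0 < t & (1 + t) * e ^+ 2 <= e ^+ 2 + d / 2.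
    exists (d / 2 / e ^+ 2); first by rewrite !divr_gt0 // exprn_gt0.
    by rewrite mulrDl mul1r mulfVK // gt_eqF // exprn_gt0.
  have [s s0 Hs] : exists2 s : R, 0 < s &
      (1 + t^-1) * ((size J)%:R * s ^+ 2) <= d / 2.
    pose c := (1 + t^-1) * (size J)%:R.
    have c0 : 0 <= c by rewrite mulr_ge0 ?addr_ge0 ?invr_ge0 // ltW.
    have c10 : 0 < c + 1 by rewrite ltr_wpDl.
    exists (Num.sqrt (d / 2 / (c + 1))).
      by rewrite sqrtr_gt0 !divr_gt0.
    rewrite sqr_sqrtr; last by rewrite ltW // !divr_gt0.
    rewrite mulrA -/c mulrCA ler_piMr ?ler_pdivrMr ?mul1r //; first by rewrite ltW // divr_gt0.
    by rewrite lerDl.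
  near F => y.
  have Ay : A y by near: y.
  have yl i : i \in J -> rnorm (y i - l i) < s.
    move: i; near: y.
    have FJ : F (\bigcap_(i in [set` J]) [set y : ell2 | rnorm (y i - l i) < s]).
      by apply: filter_bigI => i _; exact: Fl.
    by apply: filterS FJ => y yJ i iJ; exact: yJ.
  have -> : \sum_(i <- J) rnorm (((x : I -> R[i]) - l) i) ^+ 2 =
     psum (((x - y : ell2) : I -> R[i]) + ((y : I -> R[i]) - l)) J.
    rewrite psumE; apply: eq_bigr => i _; congr (rnorm _ ^+ 2).
    by rewrite !fctE /= addrA subrK.
  apply: le_trans (psumD _ _ _ t0) _.
  have xy : psum (x - y : ell2) J <= e ^+ 2.
    by apply: (proj1 (rn_le _ (ltW e0))); rewrite -rnormEl2 ltW // Ae.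
  have yJ : psum ((y : I -> R[i]) - l) J <= (size J)%:R * s ^+ 2.
    rewrite psumE; apply: (@le_trans _ _ (\sum_(i <- J) s ^+ 2)).
      rewrite big_seq [leRHS]big_seq; apply: ler_sum => i iJ.
      by rewrite ler_sqr ?nnegrE ?rnorm_ge0 ?ltW //; exact: yl.
    by rewrite big_const_seq count_predT iter_addr_0 mulr_natl.
  have : (1 + t) * psum (x - y : ell2) J <= (1 + t) * e ^+ 2.
    by apply: ler_wpM2l xy; rewrite addr_ge0 // ltW.
  have : (1 + t^-1) * psum ((y : I -> R[i]) - l) J <=
      (1 + t^-1) * ((size J)%:R * s ^+ 2).
    by apply: ler_wpM2l yJ; rewrite addr_ge0 ?invr_ge0 // ltW.
  by move: Ht Hs; lra.
have lP : l \in sqsummable.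
  near F => x.
  have xl : (x : I -> R[i]) - l \in sqsummable.
    apply/sqsummableP; exists (1 ^+ 2); near: x; exact: key.
  have -> : l = (x : I -> R[i]) - ((x : I -> R[i]) - l) by rewrite opprB addrC subrK.
  by rewrite rpredB //; exact: valP.
apply/cvg_ex; exists (Ell2 lP); apply/cvgrPdist_le => e /gt0_complex[r r0 ->].
near=> x; rewrite -rnormE lecR -rnormN opprB rnormEl2; apply/rn_le; first exact: ltW.
by near: x; exact: key.
Unshelve. all: by end_near. Qed.

HB.instance Definition _ := Uniform_isComplete.Build ell2 ell2_complete.

Let cvgC (u v : {fset I} -> R) (a b : R) :
  u @ summability.totally --> a -> v @ summability.totally --> b ->
  (u J +i* v J : R[i]) @[J --> summability.totally] --> (a +i* b : R[i]).
Proof.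
move=> ua vb; apply/cvgrPdist_lt => e /gt0_complex[r r0 ->].
have r20 : 0 < r / 2 by rewrite divr_gt0.
near=> J; rewrite -rnormE ltcR.
have aJ : `|a - u J| < r / 2.
  by near: J; move/cvgrPdist_lt: ua => /(_ _ r20).
have bJ : `|b - v J| < r / 2.
  by near: J; move/cvgrPdist_lt: vb => /(_ _ r20).
rewrite -ltr_sqr ?nnegrE ?rnorm_ge0 ?ltW // rnorm_sqr /=.
rewrite -(real_normK (num_real (a - u J))) -(real_normK (num_real (b - v J))).
have := normr_ge0 (a - u J); have := normr_ge0 (b - v J).
by move: aJ bJ; set p := `|_|; set q := `|_|; nra.
Unshelve. all: by end_near. Qed.

Let pip (x y : I -> R[i]) : {fset I} -> R[i] :=
  summability.partial_sum (fun i => x i * (y i)^*).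

Definition ell2_ip (x y : ell2) : R[i] :=
  summability.sum (fun i => x i * (y i)^*).

Let pipE x y J : pip x y J = \sum_(i <- J) x i * (y i)^*.
Proof. by rewrite /pip /summability.partial_sum big_seq_fsetE. Qed.

Let is_cvg_pip (x y : ell2) : cvg (pip x y @ summability.totally).
Proof.
pose q (z w : R[i]) := rnorm (z + w) ^+ 2 - rnorm (z - w) ^+ 2.
have -> : pip x y = fun J =>
    ((psum (x + y : ell2) J - psum (x - y : ell2) J) / 4%:R) +i*
    ((psum (x + 'i *: y : ell2) J - psum (x - 'i *: y : ell2) J) / 4%:R).
  apply/funext => J; rewrite pipE !psumE -!sumrB !mulr_suml.
  rewrite (eq_bigr (fun i => (q (x i) (y i) / 4%:R) +i* (q (x i) ('i * y i) / 4%:R))).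
    elim: (enum_fset J) => [|i r IHr]; first by rewrite !big_nil.
    by rewrite !big_cons IHr.
  move=> i _; rewrite /q !rnorm_sqr.
  case: (x i) (y i) => a b [c d] /=.
  by apply/eqP; rewrite eq_complex /=; apply/andP; split; apply/eqP; field.
have cq (u v : ell2) : (psum u J - psum v J) / 4%:R @[J --> summability.totally]
    --> (nrm2 u - nrm2 v) / 4%:R.
  by apply: cvgM; [apply: cvgB; apply: psum_cvg; exact: valP|exact: cvg_cst].
by apply: cvgP; apply: (cvgC (cq _ _) (cq _ _)).
Qed.

Let ipDl_ (x y z : ell2) : ell2_ip (x + y) z = ell2_ip x z + ell2_ip y z.
Proof.
rewrite [LHS]/ell2_ip /summability.sum; apply: cvg_lim => //.
have -> : summability.partial_sum (fun i => (x + y : ell2) i * (z i)^*) =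
    (fun J => pip x z J + pip y z J).
  apply/funext => J; rewrite -[LHS]/(pip _ _ J) !pipE -big_split.
  by apply: eq_bigr => i _; rewrite /= mulrDl.
by apply: cvgD; exact: is_cvg_pip.
Qed.

Let ipZl_ a (x y : ell2) : ell2_ip (a *: x) y = a * ell2_ip x y.
Proof.
rewrite [LHS]/ell2_ip /summability.sum; apply: cvg_lim => //; have -> : summability.partial_sum
   (fun i => (a *: x : ell2) i * (y i)^*) = (fun J => a * pip x y J).
  apply/funext => J; rewrite -[LHS]/(pip _ _ J) !pipE big_distrr.
  by apply: eq_bigr => i _; rewrite /= mulrA.
by apply: cvgM; [exact: cvg_cst|exact: is_cvg_pip].
Qed.

Let ipC_ (x y : ell2) : ell2_ip x y = (ell2_ip y x)^*.
Proof.
rewrite [LHS]/ell2_ip /summability.sum; apply: cvg_lim => //; have -> : summability.partial_sum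
   (fun i => x i * (y i)^*) = (fun J => (pip y x J)^*).
  apply/funext => J; rewrite -[LHS]/(pip _ _ J) !pipE rmorph_sum.
  by apply: eq_bigr => i _; rewrite /= rmorphM /= conjCK mulrC.
apply/cvgrPdist_lt => e e0; have /cvgrPdist_lt/(_ e e0) := @is_cvg_pip y x.
by apply: filterS => J; rewrite -rmorphB norm_conjC.
Qed.

Let ipE_ (x : ell2) : ell2_ip x x = `|x| ^+ 2.
Proof.
rewrite [LHS]/ell2_ip /summability.sum; apply: cvg_lim => //; rewrite -rnormE rnormEl2 -rmorphXn sqr_sqrtr //.
have -> : summability.partial_sum (fun i => x i * (x i)^*) =
    (fun J => (psum x J) +i* 0).
  apply/funext => J; rewrite -[LHS]/(pip _ _ J) pipE psumE.
  rewrite (eq_bigr (fun i => (rnorm (x i) ^+ 2)%:C)); first by rewrite -rmorph_sum.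
  by move=> i _; rewrite rmorphXn /= rnormE sqr_normc.
by apply: cvgC; [apply: psum_cvg; exact: valP|exact: cvg_cst].
Qed.

HB.instance Definition _ :=
  isHilbert.Build R ell2 ipDl_ ipZl_ ipC_ ipE_.

Lemma ell2_normE (x : ell2) : `|x| = (Num.sqrt (fine
  (\esum_(i in [set: I]) (rnorm (x i) ^+ 2)%:E)))%:C.
Proof. by []. Qed.

Definition ell2_basis_fun (i j : I) : R[i] := (i == j)%:R.

Lemma sqsummable_basis i : ell2_basis_fun i \in sqsummable.
Proof.
apply/sqsummableP; exists 1 => J; rewrite psumE.
have [iJ|iJ] := boolP (i \in J); last first.
  rewrite big_seq big1 // => j jJ; rewrite /ell2_basis_fun.
  by case: eqVneq jJ iJ => [-> ->//|_ _ _]; rewrite rnorm0 expr0n.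
rewrite (big_fsetD1 i) //= /ell2_basis_fun eqxx rnorm_real normr1 expr1n.
rewrite big_seq big1 ?addr0 // => j; rewrite !inE => /andP[ji _].
by rewrite eq_sym (negbTE ji) rnorm0 expr0n.
Qed.

Definition ell2_basis (i : I) : ell2 := Ell2 (sqsummable_basis i).

End ell2.

Section bop.
Variables (R : realType) (H : hilbertType R).

Definition bounded_linear : {pred H -> H} :=
  mem [set T : H -> H | linear T /\ continuous T].

Record bop := Bop { bop_fun :> H -> H; _ : bop_fun \in bounded_linear }.

HB.instance Definition _ := [isSub for bop_fun].
HB.instance Definition _ := [Choice of bop by <:].

Lemma bounded_linear_submod_closed : submod_closed bounded_linear.
Proof.
split.
  rewrite inE; split=> [a x y|x]; first by rewrite /= scaler0 addr0.
  exact: cvg_cst.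
move=> a S T; rewrite !inE => -[Sl Sc] [Tl Tc]; split.
  move=> b x y; rewrite !fctE Sl Tl !scalerDr !scalerA mulrC.
  by rewrite addrACA.
by move=> x; apply: cvgD; [apply: cvgZr; exact: Sc|exact: Tc].
Qed.

HB.instance Definition _ := GRing.isSubmodClosed.Build _ _ bounded_linear
  bounded_linear_submod_closed.
HB.instance Definition _ := [SubChoice_isSubLmodule of bop by <:].

Implicit Types S T : bop.

Let bopP T : linear T /\ continuous T.
Proof. by have := valP T; rewrite inE. Qed.

HB.instance Definition _ T :=
  GRing.isLinear.Build R[i] H H *:%R (bop_fun T) (bopP T).1.

Lemma bounded_linear_id : idfun \in bounded_linear.
Proof. by rewrite inE; split => // x; exact: cvg_id. Qed.

Lemma bounded_linear_comp S T : S \o T \in bounded_linear.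
Proof.
rewrite inE; split => [a x y|x]; first by rewrite /= !linearP.
by apply: continuous_comp; [exact: (bopP T).2|exact: (bopP S).2].
Qed.

Definition bop_one := Bop bounded_linear_id.
Definition bop_mul S T := Bop (bounded_linear_comp S T).

Let mulA : associative bop_mul. Proof. by move=> ? ? ?; exact/val_inj. Qed.
Let mul1 : left_id bop_one bop_mul. Proof. by move=> ?; exact/val_inj. Qed.
Let mulr1_ : right_id bop_one bop_mul. Proof. by move=> ?; exact/val_inj. Qed.
Let mulDl : left_distributive bop_mul +%R.
Proof. by move=> ? ? ?; exact/val_inj. Qed.
Let mulDr : right_distributive bop_mul +%R.
Proof.
by move=> S T U; apply/val_inj/funext => x; rewrite /= !fctE linearD.
Qed.

HB.instance Definition _ :=
  GRing.Zmodule_isPzRing.Build bop mulA mul1 mulr1_ mulDl mulDr.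

Lemma bopD S T x : (S + T) x = S x + T x. Proof. by []. Qed.
Lemma bopZ a T x : (a *: T) x = a *: T x. Proof. by []. Qed.
Lemma bopM S T x : (S * T) x = S (T x). Proof. by []. Qed.
Lemma bop1 x : (1 : bop) x = x. Proof. by []. Qed.

Definition opnorm T : R :=
  sup [set rnorm (T x) | x in [set x : H | rnorm x <= 1]].

Lemma bop_bounded T :
  exists2 M : R, 0 <= M & forall x, rnorm (T x) <= M * rnorm x.
Proof.
have /cvgrPdist_lt/(_ 1 ltr01) := (bopP T).2 0.
rewrite linear0 => /nbhs_ballP[_ /gt0_complex[d d0 ->]] dT.
exists (2 / d) => [|x]; first by rewrite divr_ge0 // ltW.
have [->|x0] := eqVneq x 0; first by rewrite linear0 !rnorm0 mulr0.
have rx0 : 0 < rnorm x.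
  rewrite lt_def rnorm_ge0 andbT; apply: contra_neq x0; exact: rnorm0_eq0.
have c0 : 0 < d / 2 / rnorm x by rewrite !divr_gt0.
have /= := dT ((d / 2 / rnorm x)%:C *: x).
rewrite sub0r normrN linearZ -rnormE (_ : 1 = 1%:C) // ltcR rnormZ rnorm_real gtr0_norm //.
move=> h; have {h} : d / 2 / rnorm x * rnorm (T x) < 1.
  apply: h; rewrite -ball_normE /= sub0r normrN -rnormE ltcR rnormZ rnorm_real.
  by rewrite gtr0_norm // mulfVK ?gt_eqF //; lra.
rewrite -ltr_pdivlMl // => /ltW /le_trans; apply.
by rewrite mulr1 !invf_div mulrC.
Qed.

Let opnorm_has_sup T :
  has_sup [set rnorm (T x) | x in [set x : H | rnorm x <= 1]].
Proof.
split; first by exists 0, 0; rewrite /= ?linear0 rnorm0.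
have [M M0 TM] := bop_bounded T; exists M => _ [x /= x1 <-].
by apply: le_trans (TM x) _; rewrite ler_piMr.
Qed.

Let opnorm_ge0 T : 0 <= opnorm T.
Proof.
apply: (@le_trans _ _ (rnorm (T 0))); first exact: rnorm_ge0.
apply: sup_upper_bound; first exact: opnorm_has_sup.
by exists 0; rewrite //= rnorm0.
Qed.

Lemma opnormP T x : rnorm (T x) <= opnorm T * rnorm x.
Proof.
have [->|x0] := eqVneq x 0; first by rewrite linear0 !rnorm0 mulr0.
have rx0 : 0 < rnorm x.
  rewrite lt_def rnorm_ge0 andbT; apply: contra_neq x0; exact: rnorm0_eq0.
rewrite -ler_pdivrMr //.
have -> : rnorm (T x) / rnorm x = rnorm (T ((rnorm x)^-1%:C *: x)).
  by rewrite linearZ rnormZ rnorm_real ger0_norm ?invr_ge0 ?ltW // mulrC.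
apply: sup_upper_bound; first exact: opnorm_has_sup.
exists ((rnorm x)^-1%:C *: x) => //=.
by rewrite rnormZ rnorm_real ger0_norm ?invr_ge0 ?(ltW rx0) // mulVf ?gt_eqF //.
Qed.

Let opnorm_le T M : 0 <= M -> (forall x, rnorm (T x) <= M * rnorm x) ->
  opnorm T <= M.
Proof.
move=> M0 TM; apply: ge_sup; first exact: (opnorm_has_sup T).1.
by move=> _ [x /= x1 <-]; apply: le_trans (TM x) _; rewrite ler_piMr.
Qed.

Let nm T : R[i] := (opnorm T)%:C.

Let nmD S T : nm (S + T) <= nm S + nm T.
Proof.
rewrite -rmorphD lecR; apply: opnorm_le => [|x]; first by rewrite addr_ge0.
by apply: le_trans (rnormD _ _) _; rewrite mulrDl lerD // opnormP.
Qed.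

Let nmZ a T : nm (a *: T) = `|a| * nm T.
Proof.
have h b S : opnorm (b *: S) <= rnorm b * opnorm S.
  apply: opnorm_le => [|x]; first by rewrite mulr_ge0 // rnorm_ge0.
  by rewrite bopZ rnormZ -mulrA ler_wpM2l ?rnorm_ge0 // opnormP.
rewrite /nm -rnormE -rmorphM /=; congr _%:C; apply/eqP; rewrite eq_le h /=.
have [->|a0] := eqVneq a 0; first by rewrite rnorm0 mul0r.
have := h a^-1 (a *: T); rewrite scalerA mulVf // scale1r => xa.
have aa : rnorm a * rnorm a^-1 = 1.
  by rewrite -rnormZ [a *: _]mulfV // rnorm_real normr1.
by apply: le_trans (ler_wpM2l (rnorm_ge0 a) xa) _; rewrite mulrA aa mul1r.
Qed.

Let nm0 T : nm T = 0 -> T = 0.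
Proof.
move=> /complexI T0; apply/val_inj/funext => x; apply: rnorm0_eq0.
by apply/eqP; rewrite eq_le rnorm_ge0 andbT; have := opnormP T x; rewrite T0 mul0r.
Qed.

HB.instance Definition _ := Lmodule_isNormed.Build R[i] bop nmD nmZ nm0.

Lemma bop_normE T : `|T| = (opnorm T)%:C. Proof. by []. Qed.

Definition mxopnorm N (A : 'M[bop]_N) : R :=
  sup [set Num.sqrt (\sum_i rnorm (\sum_j A i j (x j)) ^+ 2) | x in
       [set x : 'I_N -> H | \sum_j rnorm (x j) ^+ 2 <= 1]].

Definition positive_op T : Prop := forall x, 0 <= ip (T x) x.

(* The adjoint exists and is unique, by Riesz representation. *)
Definition adj T : bop :=
  xget 0 [set S : bop | forall x y, ip (T x) y = ip x (S y)].

End bop.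

(* Positive regular free holomorphic functions in n indeterminates, given by
   their coefficients; words in the free semigroup are sequences of letters. *)
Record prfh (R : realType) (n : nat) := Prfh {
  coef :> seq 'I_n -> R;
  coef_ge0 : forall al, 0 <= coef al;
  coef_nil : coef [::] = 0;
  coef_letter : forall j, 0 < coef [:: j];
  coef_radius : (limn_esup (fun p : nat =>
    ((\sum_(al : p.-tuple 'I_n) `|coef al| ^+ 2) `^ (2 * p)%:R^-1)%:E) < +oo)%E
}.

(* b^(m)_al; the factors of a factorization of al are words of length at most
   size al, hence range over a finite type. *)
Definition bcoef (R : realType) n (a : prfh R n) (m : nat) (al : seq 'I_n) : R :=
  if al is [::] then 1 else
  \sum_(1 <= p < (size al).+1)
    \sum_(w : p.-tuple ((size al).-bseq 'I_n) |
        (flatten [seq val u | u <- w] == al) &&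
        all (fun u : seq 'I_n => 0 < size u)%N [seq val u | u <- w])
      (\prod_(u <- w) a u) * 'C(p + m - 1, m - 1)%:R.

Section polydomain.
Variables (R : realType) (k : nat) (n : 'I_k -> nat).
Variables (f : forall i, prfh R (n i)) (m : 'I_k -> nat).

(* An element of A^(n_1) x ... x A^(n_k) is a row vector of length
   n_1 + ... + n_k; entry z i j is its component z_{i,j}. *)
Definition entry A (z : 'rV[A]_(\sum_i n i)) i (j : 'I_(n i)) : A :=
  submxrow z i ord0 j.

Definition wentry (A : pzRingType) (z : 'rV[A]_(\sum_i n i)) i
    (al : seq 'I_(n i)) : A :=
  \prod_(j <- al) entry z j.

Section operators.
Variable H : hilbertType R.
Implicit Type X : 'rV[bop H]_(\sum_i n i).

Definition Phi_sum X i (Y Z : bop H) : Prop := forall x y,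
  (fun N => \sum_(1 <= p < N) \sum_(al : p.-tuple 'I_(n i))
    (f i al)%:C * ip ((wentry X al * Y * adj (wentry X al)) x) y)
  @ \oo --> ip (Z x) y.

(* The value is 0 if the series does not converge weakly.  When it converges
   for Y = 1, which polydomain requires, it converges absolutely for every Y,
   so that the grading by word length in Phi_sum is immaterial. *)
Definition Phi X i (Y : bop H) : bop H := xget 0 [set Z | Phi_sum X i Y Z].

Definition Delta X (p : 'I_k -> nat) : bop H -> bop H :=
  \big[comp/id]_(i < k) iter (p i) (fun Y => Y - Phi X i Y).

Definition polydomain : set 'rV[bop H]_(\sum_i n i) :=
  [set X | [/\ forall s t, s != t -> forall (i : 'I_(n s)) (j : 'I_(n t)),
                 entry X i * entry X j = entry X j * entry X i,
               forall i, exists Z, Phi_sum X i 1 Z &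
               forall p : 'I_k -> nat, (forall i, p i <= m i)%N ->
                 positive_op (Delta X p 1)]].

End operators.

Definition sradius (z : 'rV[R[i]]_(\sum_i n i)) i : \bar R :=
  (\esum_(al in [set al : seq 'I_(n i) | (0 < size al)%N])
    (f i al * rnorm (wentry z al) ^+ 2)%:E)%E.

Definition scalar_domain : set 'rV[R[i]]_(\sum_i n i) :=
  [set z | forall i, (sradius z i <= 1)%E].

Definition scalar_domain_strict : set 'rV[R[i]]_(\sum_i n i) :=
  [set z | forall i, (sradius z i < 1)%E].

Definition multiword := {dffun forall i : 'I_k, seq 'I_(n i)}.

Definition mcons i (j : 'I_(n i)) (be : multiword) : multiword :=
  [ffun i' => dfwith be i (j :: be i) i'].

(* F^2(H_{n_1}) (x) ... (x) F^2(H_{n_k}), with e^1_{be_1} (x) ... (x) e^k_{be_k}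
   as the canonical basis vector at be. *)
Definition fock := ell2 R multiword.

(* The bounded operator W_{i,j} exists since b_{g_j al} >= a_{g_j} b_al, and
   it is unique by density. *)
Definition umodel i (j : 'I_(n i)) : bop fock :=
  xget 0 [set T : bop fock | forall be : multiword, T (ell2_basis R be) =
    (Num.sqrt (bcoef (f i) (m i) (be i) /
               bcoef (f i) (m i) (j :: be i)))%:C *: ell2_basis R (mcons j be)].

Definition polydomain_algebra : set (bop fock) :=
  smallest [set A : set (bop fock) | [/\ closed A, A 1,
      forall a S T, A S -> A T -> A (a *: S + T) &
      forall S T, A S -> A T -> A (S * T)]]
    [set T | exists i (j : 'I_(n i)), T = umodel j].

Definition gamma_vec (mu : 'rV[R[i]]_(\sum_i n i)) : fock :=
  (\prod_i ((1 - fine (sradius mu i)) `^ ((m i)%:R / 2)))%:C *: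
  summability.sum (fun be : multiword =>
    (\prod_i ((wentry mu (be i))^* * (Num.sqrt (bcoef (f i) (m i) (be i)))%:C))
    *: ell2_basis R be).

Definition berezin (mu : 'rV[R[i]]_(\sum_i n i)) (T : bop fock) : R[i] :=
  ip (T (gamma_vec mu)) (gamma_vec mu).

End polydomain.

Record unital_cc_isomorphism (R : realType) (H H' : hilbertType R)
    (A : set (bop H)) (A' : set (bop H')) (Psi : bop H -> bop H') : Prop := {
  cc_bij : set_bij A A' Psi;
  cc_lin : forall a S T, A S -> A T -> Psi (a *: S + T) = a *: Psi S + Psi T;
  cc_mul : forall S T, A S -> A T -> Psi (S * T) = Psi S * Psi T;
  cc_unit : Psi 1 = 1;
  cc_contr : forall N (M : 'M[bop H]_N), (forall i j, A (M i j)) ->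
    mxopnorm (map_mx Psi M) <= mxopnorm M
}.

Definition homeomorphism_onto (T U : topologicalType) (A : set T) (B : set U)
    (phi : T -> U) : Prop :=
  set_bij A B phi /\ exists psi : U -> T,
    [/\ {in A, cancel phi psi}, {within A, continuous phi} &
        {within B, continuous psi}].

(* Differentiability over the field R[i] is complex differentiability. *)
Definition holomorphic_on (R : realType) (V W : normedModType R[i])
    (A : set V) (phi : V -> W) : Prop :=
  forall z, A z -> differentiable phi z.

Definition biholomorphic_onto (R : realType) (V W : normedModType R[i])
    (A : set V) (B : set W) (phi : V -> W) : Prop :=
  set_bij A B phi /\ exists psi : W -> V,
    [/\ {in A, cancel phi psi}, holomorphic_on A phi & holomorphic_on B psi].

Definition berezin_limit (R : realType) k (n : 'I_k -> nat)
    (f : forall i, prfh R (n i)) (m : 'I_k -> nat)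
    k' (l : 'I_k' -> nat) (g : forall i, prfh R (l i)) (d : 'I_k' -> nat)
    (Psi : bop (fock R n) -> bop (fock R l))
    (la : 'rV[R[i]]_(\sum_i l i)) : 'rV[R[i]]_(\sum_i n i) :=
  \mxrow_(i < k) \row_(j < n i)
    lim (berezin g d (r%:C *: la) (Psi (umodel f m j)) @[r --> (1:R)^'-]).

(* Main.v *)
(** A point of the scalar domain is the same thing as a character of the polydomain algebra. For a strict point mu the vector Gamma_mu is a unit vector with <W x, Gamma_mu> = mu <x, Gamma_mu> for the entries of the universal model, so the Berezin transform at mu is a character; radial limits give characters at all points of the closed domain. Conversely, a character of a Banach algebra is contractive, and the row [sqrt a_alpha W_alpha] is a contraction since sum a_alpha b_gamma <= b_beta over the factorizations alpha gamma = beta; hence the values of a character at the generators lie in the closed domain. The map phi is therefore the transpose of Psi on characters, with inverse the transpose of the inverse of Psi, and it is a homeomorphism.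

At an interior point lambda, the transform of T is <T 1, v(lambda)> for a vector v(lambda) given by monomials, and a larger polyradius still lies strictly inside, which makes phi complex differentiable. If the derivative of phi killed a direction h, the operators T for which the transform of Psi T has zero derivative along h would form a closed algebra containing the generators (closedness is Cauchy's estimate, obtained by averaging over roots of unity), so all transforms would be stationary along h, which is absurd for a coordinate. Derivatives are thus injective in both directions; as 0 is an interior point of both domains, the dimensions agree, and Newton's iteration shows that phi is open on the interior. *)

Require Import Defs.
From HB Require Import structures.
From mathcomp Require Import all_boot all_order all_algebra finmap.
From mathcomp Require Import all_classical all_reals all_analysis.
From mathcomp Require Import complex ring lra.
From mathcomp Require separable cyclotomic cyclic.
From mathcomp.analysis Require showcase.summability.

Set Implicit Arguments.
Unset Strict Implicit.
Unset Printing Implicit Defensive.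

Import Order.TTheory GRing.Theory Num.Theory numFieldNormedType.Exports.

Local Open Scope complex_scope.
Local Open Scope ring_scope.
Local Open Scope classical_set_scope.

(* Two bounds shape the argument. The derivative of a transform has to pass to norm limits of
   operators; the composite of a transform with [Psi] is again a character, hence bounded by the
   norm of the operator it is applied to, and this bound, uniform over a ball, is what Cauchy's
   estimate consumes. The analysis near an interior point takes place in the Fock space, after the
   normalising factor of Gamma has been divided out: estimates for single monomials become norm
   estimates because every coordinate is dominated by the matching coordinate of one fixed
   square-summable vector, the one at the enlarged polyradius. The remainder is controlled for two
   points at once: if both lie within c d of the centre and within e d of each other, the error is
   of order e c. With e = c and one point at the centre this is differentiability; with c small and
   fixed it is the contraction behind Newton's iteration. Averages over roots of unity are finite
   sums over points of the ball, so they keep every bound that holds on the ball. *)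
#[local] Existing Instance summability.totally_filter.

(** * Real-valued norms, and topology expressed through them *)

Section complex_norm.
Variable R : realType.
Implicit Types z w : R[i].

Lemma rnormM z w : rnorm (z * w) = rnorm z * rnorm w.
Proof. by apply: complexI; rewrite rmorphM /= !rnormE normrM. Qed.

Lemma rnorm1 : rnorm (1 : R[i]) = 1.
Proof. by apply: complexI; rewrite rnormE normr1. Qed.

Lemma rnormC z : rnorm z^* = rnorm z.
Proof. by apply: complexI; rewrite !rnormE norm_conjC. Qed.

Lemma rnormV z : rnorm z^-1 = (rnorm z)^-1.
Proof. by apply: complexI; rewrite fmorphV /= !rnormE normfV. Qed.

Lemma rnorm_prod (I : Type) (s : seq I) (P : pred I) (F : I -> R[i]) :
  rnorm (\prod_(i <- s | P i) F i) = \prod_(i <- s | P i) rnorm (F i).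
Proof.
elim/big_rec2: _ => [|i y x _ <-]; [exact: rnorm1|exact: rnormM].
Qed.

Lemma rnorm_sum (V : normedModType R[i]) (I : Type) (s : seq I) (P : pred I)
  (F : I -> V) :
  rnorm (\sum_(i <- s | P i) F i) <= \sum_(i <- s | P i) rnorm (F i).
Proof.
elim/big_rec2: _ => [|i y x _ xy]; first by rewrite rnorm0.
by apply: le_trans (rnormD _ _) _; rewrite lerD2l.
Qed.

Lemma rnormB (V : normedModType R[i]) (x y : V) : rnorm (x - y) = rnorm (y - x).
Proof. by rewrite -rnormN opprB. Qed.

Lemma rnormB_le (V : normedModType R[i]) (x y : V) :
  rnorm (x - y) <= rnorm x + rnorm y.
Proof. by apply: le_trans (rnormD _ _) _; rewrite rnormN. Qed.

Lemma rnorm_gt0 (V : normedModType R[i]) (x : V) : (0 < rnorm x) = (x != 0).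
Proof.
rewrite lt_def rnorm_ge0 andbT; congr (~~ _).
by apply/eqP/eqP => [/rnorm0_eq0//|->]; exact: rnorm0.
Qed.

Lemma rnorm_le0 (V : normedModType R[i]) (x : V) :
  (forall e, 0 < e -> rnorm x <= e) -> x = 0.
Proof.
move=> xe; apply: rnorm0_eq0; apply/eqP; rewrite eq_le rnorm_ge0 andbT.
by apply/ler_addgt0Pr => e e0; rewrite add0r xe.
Qed.

Lemma conjCR (r : R) : (r%:C : R[i])^* = r%:C.
Proof. exact: conjc_real. Qed.

Lemma mul_conjC z : z * z^* = (rnorm z ^+ 2)%:C.
Proof. by rewrite rmorphXn /= rnormE sqr_normc. Qed.

Lemma cvg_rnormP (T : Type) (F : set_system T) (FF : Filter F)
  (V : normedModType R[i]) (f : T -> V) (l : V) :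
  (f @ F --> l) <->
  (forall e : R, 0 < e -> \forall x \near F, rnorm (f x - l) < e).
Proof.
split => [/cvgrPdist_lt fl e e0|fl].
  have e0C : 0 < e%:C :> R[i] by rewrite ltcR.
  by apply: filterS (fl _ e0C) => x; rewrite -rnormE ltcR rnormB.
apply/cvgrPdist_lt => e /gt0_complex[r r0 ->].
by apply: filterS (fl _ r0) => x; rewrite -rnormE ltcR rnormB.
Qed.

Lemma nbhs_rnormP (V : normedModType R[i]) (x : V) (A : set V) :
  nbhs x A <-> exists2 e : R, 0 < e & forall y, rnorm (y - x) < e -> A y.
Proof.
split => [/nbhs_ballP[_ /gt0_complex[r r0 ->] rA]|[e e0 eA]].
  exists r => // y yx; apply: rA.
  by rewrite -ball_normE /= -rnormE ltcR rnormB.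
apply/nbhs_ballP; exists e%:C; first by rewrite /= ltcR.
by move=> y; rewrite -ball_normE /= -rnormE ltcR rnormB; exact: eA.
Qed.

Lemma closed_rnormP (V : normedModType R[i]) (A : set V) :
  closed A <-> forall x, (forall e : R, 0 < e ->
    exists2 y, A y & rnorm (y - x) < e) -> A x.
Proof.
split => [cA x xA|xA x cAx].
  apply: cA => B /nbhs_rnormP[e e0 eB]; have [y Ay yx] := xA _ e0.
  by exists y; split => //; exact: eB.
apply: xA => e e0; have [|y [Ay yx]] := cAx [set y | rnorm (y - x) < e].
  by apply/nbhs_rnormP; exists e.
by exists y.
Qed.

(** Real and imaginary parts are 1-Lipschitz, so each converges by completeness of the reals. The
    filter form serves both sequences and radial limits. *)
Lemma complex_cauchy_cvg (F : set_system R[i]) : ProperFilter F ->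
  (forall e : R, 0 < e -> exists2 A, F A &
    forall z w, A z -> A w -> rnorm (z - w) < e) -> exists l : R[i], F --> l.
Proof.
move=> FF Fc.
have part (p : R[i] -> R) : (forall z, `|p z| <= rnorm z) ->
    (forall z w, p (z - w) = p z - p w) -> exists l : R,
    forall e, 0 < e -> \forall z \near F, `|p z - l| < e.
  move=> ple pB; have /cauchy_cvgP/cvg_ex[l Gl] : cauchy (p @ F).
    apply/cauchy_ballP => e e0; have [A FA Ae] := Fc _ e0.
    exists (p @` A, p @` A) => /=.
      by split; apply: (@filterS _ F _ A _ _ FA) => x Ax /=; exists x.
    move=> [_ _] /= [[x Ax <-] [y Ay <-]]; rewrite -ball_normE /= -pB.
    exact: le_lt_trans (ple _) (Ae _ _ Ax Ay).
  exists l => e e0; have /cvgrPdist_lt/(_ e e0) := Gl.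
  by apply: filterS => x; rewrite distrC.
have [||a Ha] := part (@complex.Re R); last 1 first.
have [||b Hb] := part (@complex.Im R); last 1 first.
- exists (a +i* b); apply/(@cvg_rnormP _ F _ _ id) => e e0.
  have e20 : 0 < e / 2 by rewrite divr_gt0.
  apply: filterS2 (Ha _ e20) (Hb _ e20) => -[u v] /= ua vb.
  rewrite -ltr_sqr ?nnegrE ?rnorm_ge0 ?ltW // rnorm_sqr /=.
  rewrite -(real_normK (num_real (u - a))) -(real_normK (num_real (v - b))).
  have := normr_ge0 (u - a); have := normr_ge0 (v - b).
  by move: ua vb; set p := `|_|; set q := `|_|; nra.
- move=> z; rewrite -ler_sqr ?nnegrE ?rnorm_ge0 // rnorm_sqr real_normK ?num_real //.
  by rewrite lerDr sqr_ge0.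
- by move=> [? ?] [? ?].
- move=> z; rewrite -ler_sqr ?nnegrE ?rnorm_ge0 // rnorm_sqr real_normK ?num_real //.
  by rewrite lerDl sqr_ge0.
- by move=> [? ?] [? ?].
Qed.

End complex_norm.

(** * Sesquilinearity, Cauchy-Schwarz and sequential completeness *)

Section hilbert_theory.
Variables (R : realType) (H : hilbertType R).
Implicit Types x y : H.

Lemma ip0l y : ip 0 y = 0.
Proof. by rewrite -(scale0r (0 : H)) ipZl mul0r. Qed.

Lemma ip0r x : ip x 0 = 0.
Proof. by rewrite ipC ip0l conjC0. Qed.

Lemma ipNl x y : ip (- x) y = - ip x y.
Proof. by rewrite -scaleN1r ipZl mulN1r. Qed.

Lemma ipBl x y z : ip (x - y) z = ip x z - ip y z.
Proof. by rewrite ipDl ipNl. Qed.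

Lemma ipDr x y z : ip x (y + z) = ip x y + ip x z.
Proof. by rewrite ipC ipDl rmorphD /= -!ipC. Qed.

Lemma ipZr a x y : ip x (a *: y) = a^* * ip x y.
Proof. by rewrite ipC ipZl rmorphM /= -ipC. Qed.

Lemma ipBr x y z : ip x (y - z) = ip x y - ip x z.
Proof. by rewrite ipDr -scaleN1r ipZr rmorphN rmorph1 mulN1r. Qed.

Lemma ip_suml (I : Type) (s : seq I) (F : I -> H) y :
  ip (\sum_(i <- s) F i) y = \sum_(i <- s) ip (F i) y.
Proof. by apply: (big_morph (fun x => ip x y)); [move=> ? ?; exact: ipDl|exact: ip0l]. Qed.

Lemma ip_sumr (I : Type) (s : seq I) (F : I -> H) x :
  ip x (\sum_(i <- s) F i) = \sum_(i <- s) ip x (F i).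
Proof. by apply: (big_morph (fun y => ip x y)); [move=> ? ?; exact: ipDr|exact: ip0r]. Qed.

Lemma ip_rnorm x : ip x x = (rnorm x ^+ 2)%:C.
Proof. by rewrite ipE -rnormE rmorphXn. Qed.

Lemma cauchy_schwarz x y : rnorm (ip x y) <= rnorm x * rnorm y.
Proof.
have [->|y0] := eqVneq y 0; first by rewrite ip0r !rnorm0 mulr0.
have ry0 : 0 < rnorm y by rewrite rnorm_gt0.
(* The vector c y is the orthogonal projection of x onto the line of y. *)
pose c := ip x y / (rnorm y ^+ 2)%:C.
have : 0 <= rnorm (x - c *: y) ^+ 2 by rewrite sqr_ge0.
rewrite -lecR -ip_rnorm ipBl !ipBr !ipZl !ipZr.
have yn0 : (rnorm y ^+ 2)%:C != 0 :> R[i].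
  by rewrite (_ : 0 = 0%:C) // (inj_eq (@complexI _)) expf_neq0 // gt_eqF.
have -> : c^* * ip x y = (rnorm (ip x y) ^+ 2 / rnorm y ^+ 2)%:C.
  rewrite rmorphM fmorphV /= conjCR mulrAC [_^* * _]mulrC mul_conjC.
  by rewrite -rmorphV ?unitfE ?expf_neq0 ?gt_eqF // -rmorphM.
have -> : c * (c^* * ip y y) = c * ip y x.
  rewrite rmorphM fmorphV /= conjCR ip_rnorm -mulrA [_^-1 * _]mulrC.
  by rewrite mulfV // mulr1 -ipC.
rewrite subrr subr0 ip_rnorm -rmorphB lecR subr_ge0.
rewrite ler_pdivrMr ?exprn_gt0 // -exprMn ler_sqr //.
  by rewrite nnegrE rnorm_ge0.
by rewrite nnegrE mulr_ge0 ?rnorm_ge0.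
Qed.

Lemma hilbert_cauchy_cvg (u : nat -> H) : (forall e : R, 0 < e ->
    exists N, forall m n, (N <= m)%N -> (N <= n)%N -> rnorm (u m - u n) < e) ->
  exists l : H, u @ \oo --> l.
Proof.
move=> uc; apply/cvg_ex/cauchy_cvgP/cauchy_ballP => _ /gt0_complex[e e0 ->].
have [N Nu] := uc _ e0.
exists (u @` [set n | (N <= n)%N], u @` [set n | (N <= n)%N]) => /=.
  by split; exists N => // n /= Nn; exists n.
move=> [_ _] /= [[m Nm <-] [n Nn <-]].
by rewrite -ball_normE /= -rnormE ltcR; exact: Nu.
Qed.

End hilbert_theory.

(** * The operator norm and completeness of the bounded operators *)

Section bop_theory.
Variables (R : realType) (H : hilbertType R).
Implicit Types S T : bop H.

Lemma bop_le T x : rnorm (T x) <= rnorm T * rnorm x.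
Proof.
have -> : rnorm T = opnorm T by apply: complexI; rewrite rnormE.
exact: opnormP.
Qed.

Lemma bop_rnorm_le T (M : R) : 0 <= M ->
  (forall x, rnorm (T x) <= M * rnorm x) -> rnorm T <= M.
Proof.
have -> : rnorm T = opnorm T by apply: complexI; rewrite rnormE.
move=> M0 TM; apply: ge_sup; first by exists 0, 0; rewrite /= ?linear0 rnorm0.
by move=> _ [x /= x1 <-]; apply: le_trans (TM x) _; rewrite ler_piMr.
Qed.

Lemma bop_rnormM S T : rnorm (S * T) <= rnorm S * rnorm T.
Proof.
apply: bop_rnorm_le => [|x]; first by rewrite mulr_ge0 ?rnorm_ge0.
rewrite bopM; apply: le_trans (bop_le _ _) _.
by rewrite -mulrA ler_wpM2l ?rnorm_ge0 ?bop_le.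
Qed.

Lemma bopB S T x : (S - T) x = S x - T x. Proof. by []. Qed.

Lemma bop_sum (I : Type) (s : seq I) (F : I -> bop H) x :
  (\sum_(i <- s) F i) x = \sum_(i <- s) F i x.
Proof. by apply: (big_morph (fun T : bop H => T x)). Qed.

Lemma bounded_linearP (T : H -> H) (M : R) : linear T ->
  (forall x, rnorm (T x) <= M * rnorm x) -> T \in @bounded_linear R H.
Proof.
move=> Tl TM; rewrite inE; split => // x; apply/cvg_rnormP => e e0.
have M0 : 0 < `|M| + 1 by rewrite ltr_wpDl.
have TB y z : T (y - z) = T y - T z.
  by rewrite -[- z]scaleN1r addrC Tl scaleN1r addrC.
apply/nbhs_rnormP; exists (e / (`|M| + 1)); first by rewrite divr_gt0.
move=> y yx; rewrite -TB; apply: le_lt_trans (TM _) _.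
apply: (@le_lt_trans _ _ ((`|M| + 1) * rnorm (y - x))).
  by rewrite ler_wpM2r ?rnorm_ge0 // (le_trans (ler_norm _)) // lerDl.
by rewrite mulrC -ltr_pdivlMr.
Qed.

(** The pointwise limit is linear, and the Cauchy bound passes to it with the same N for all
    vectors; this gives both its boundedness and convergence in norm. *)
Lemma bop_limit (u : nat -> bop H) : (forall e : R, 0 < e ->
    exists N, forall m n, (N <= m)%N -> (N <= n)%N -> rnorm (u m - u n) < e) ->
  exists T : bop H, forall e : R, 0 < e ->
    exists N, forall n, (N <= n)%N -> rnorm (u n - T) <= e.
Proof.
move=> uc.
have /boolp.choice[T HT] : forall x, exists l : H, (fun n => u n x) @ \oo --> l.
  move=> x; apply: hilbert_cauchy_cvg => e e0.
  (* The added 1 keeps the denominator positive when x is 0; later constants use the same device. *)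
  have d0 : 0 < e / (rnorm x + 1) by rewrite divr_gt0 // ltr_wpDl ?rnorm_ge0.
  have [N Nu] := uc _ d0; exists N => m n Nm Nn; rewrite -bopB.
  apply: le_lt_trans (bop_le _ _) _.
  apply: (@le_lt_trans _ _ (e / (rnorm x + 1) * rnorm x)).
    by rewrite ler_wpM2r ?rnorm_ge0 // ltW // Nu.
  rewrite mulrAC ltr_pdivrMr ?ltr_wpDl ?rnorm_ge0 // ltr_pM2l //.
  by rewrite ltrDl.
have Tl : linear T.
  move=> a x y; rewrite -(cvg_lim (@norm_hausdorff _ H) (HT (a *: x + y))).
  apply: cvg_lim; first exact: norm_hausdorff.
  rewrite (_ : (fun n => _) = (fun n => a *: u n x + u n y)); last first.
    by apply/funext => n; rewrite linearP.
  by apply: cvgD => //; apply: cvgZr.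
have key e : 0 < e -> exists N, forall n, (N <= n)%N ->
    forall x, rnorm (u n x - T x) <= e * rnorm x.
  move=> e0; have [N Nu] := uc _ e0; exists N => n Nn x.
  apply/ler_addgt0Pr => d d0.
  have /cvg_rnormP/(_ _ d0)[N' _ HN'] := HT x.
  have := HN' _ (leq_maxr N N'); set p := maxn N N' => upT.
  rewrite -(subrKA (u p x)); apply: le_trans (rnormD _ _) _; apply: lerD; last exact: ltW.
  rewrite -bopB; apply: le_trans (bop_le _ _) _.
  by rewrite ler_wpM2r ?rnorm_ge0 // ltW // Nu // leq_maxl.
have [N HN] := key 1 ltr01.
have Tb : T \in @bounded_linear R H.
  apply: (@bounded_linearP _ (rnorm (u N) + 1)) => // x.
  rewrite -[T x](subKr (u N x)); apply: le_trans (rnormB_le _ _) _.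
  by rewrite mulrDl lerD ?bop_le // HN.
exists (Bop Tb) => e e0; have [N' HN'] := key e e0; exists N' => n Nn.
by apply: bop_rnorm_le => [|x]; [exact: ltW|exact: HN'].
Qed.

End bop_theory.

(** * Square-summable families: domination, finite approximation, coordinates *)

Section ell2_theory.
Variables (R : realType) (I : choiceType).
Implicit Types (x y : ell2 R I) (J : {fset I}).

Lemma ell2_sum_le x J : \sum_(i <- J) rnorm (x i) ^+ 2 <= rnorm x ^+ 2.
Proof.
have xl2 := valP x.
have x0 : (0 <= \esum_(i in [set: I]) (rnorm (x i) ^+ 2)%:E)%E.
  by apply: esum_ge0 => i _; rewrite lee_fin sqr_ge0.
have -> : rnorm x ^+ 2 = fine (\esum_(i in [set: I]) (rnorm (x i) ^+ 2)%:E)%E.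
  by rewrite {1}/rnorm ell2_normE sqr_sqrtr //= fine_ge0.
rewrite -lee_fin fineK; last by move: xl2; rewrite inE /= => xl2; rewrite ge0_fin_numE.
apply: esum_ge; exists [set` J]; first by split => //; exact: finite_fset.
by rewrite -sumEFin fsbig_finite ?finite_fset //= set_fsetK.
Qed.

Lemma esum_sqr_le (x : I -> R[i]) (M : R) :
  (forall J, \sum_(i <- J) rnorm (x i) ^+ 2 <= M) ->
  (\esum_(i in [set: I]) (rnorm (x i) ^+ 2)%:E <= M%:E)%E.
Proof.
move=> xM; apply: ge_ereal_sup => _ [F [finF _] <-].
rewrite fsbig_finite //= sumEFin lee_fin; exact: xM.
Qed.

Lemma sqsummable_le (x : I -> R[i]) (M : R) :
  (forall J, \sum_(i <- J) rnorm (x i) ^+ 2 <= M) -> x \in @sqsummable R I.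
Proof. by move=> xM; rewrite inE /=; apply: le_lt_trans (esum_sqr_le xM) (ltry _). Qed.

Lemma ell2_sqr_le x (M : R) :
  (forall J, \sum_(i <- J) rnorm (x i) ^+ 2 <= M) -> rnorm x ^+ 2 <= M.
Proof.
move=> xM; have x0 : (0 <= \esum_(i in [set: I]) (rnorm (x i) ^+ 2)%:E)%E.
  by apply: esum_ge0 => i _; rewrite lee_fin sqr_ge0.
rewrite {1}/rnorm ell2_normE sqr_sqrtr //= ?fine_ge0 // -lee_fin fineK ?esum_sqr_le //.
by rewrite ge0_fin_numE //; apply: le_lt_trans (esum_sqr_le xM) (ltry _).
Qed.

Lemma ell2_le x (M : R) : 0 <= M ->
  (forall J, \sum_(i <- J) rnorm (x i) ^+ 2 <= M ^+ 2) -> rnorm x <= M.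
Proof. by move=> M0 xM; rewrite -ler_sqr ?nnegrE ?rnorm_ge0 // ell2_sqr_le. Qed.

Lemma sqsummable_dom (x : I -> R[i]) y (c : R) : 0 <= c ->
  (forall i, rnorm (x i) <= c * rnorm (y i)) -> x \in @sqsummable R I.
Proof.
move=> c0 xy; apply: (@sqsummable_le _ (c ^+ 2 * rnorm y ^+ 2)) => J.
apply: le_trans (ler_wpM2l (sqr_ge0 c) (ell2_sum_le y J)); rewrite big_distrr /=.
apply: ler_sum => i _; rewrite -exprMn ler_sqr ?nnegrE ?rnorm_ge0 //.
by rewrite mulr_ge0 ?rnorm_ge0.
Qed.

Lemma ell2_dom x y (c : R) : 0 <= c ->
  (forall i, rnorm (x i) <= c * rnorm (y i)) -> rnorm x <= c * rnorm y.
Proof.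
move=> c0 xy; apply: ell2_le => [|J]; first by rewrite mulr_ge0 ?rnorm_ge0.
rewrite exprMn.
apply: le_trans (ler_wpM2l (sqr_ge0 c) (ell2_sum_le y J)); rewrite big_distrr /=.
apply: ler_sum => i _; rewrite -exprMn ler_sqr ?nnegrE ?rnorm_ge0 //.
by rewrite mulr_ge0 ?rnorm_ge0.
Qed.

Lemma ell2D x y i : (x + y) i = x i + y i. Proof. by []. Qed.
Lemma ell2B x y i : (x - y) i = x i - y i. Proof. by []. Qed.
Lemma ell2Z a x i : (a *: x) i = a * x i. Proof. by []. Qed.

Lemma ell2P x y : (forall i, x i = y i) -> x = y.
Proof. by move=> xy; apply/val_inj/funext. Qed.

Lemma ell2_sumE (T : Type) (s : seq T) (F : T -> ell2 R I) i :
  (\sum_(t <- s) F t) i = \sum_(t <- s) F t i.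
Proof. by apply: (big_morph (fun x : ell2 R I => x i)). Qed.

Lemma ell2_basisE (i j : I) : ell2_basis R i j = (i == j)%:R. Proof. by []. Qed.

Lemma psumE (V : zmodType) (F : I -> V) J :
  summability.partial_sum F J = \sum_(i <- J) F i.
Proof. by rewrite /summability.partial_sum big_seq_fsetE. Qed.

Lemma fin_approxE x J i :
  (x - \sum_(j <- J) x j *: ell2_basis R j) i = if i \in J then 0 else x i.
Proof.
rewrite ell2B ell2_sumE; case: ifPn => iJ.
  rewrite (big_fsetD1 i) // big_seq big1 => [|j]; last first.
    by rewrite !inE => /andP[ji _]; rewrite ell2Z ell2_basisE (negbTE ji) mulr0.
  by rewrite Monoid.mulm1 ell2Z ell2_basisE eqxx mulr1 subrr.
rewrite big_seq big1 ?subr0 // => j jJ.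
rewrite ell2Z ell2_basisE; case: eqVneq => [ji|]; last by rewrite mulr0.
by rewrite -ji jJ in iJ.
Qed.

Lemma fsum_mono (F : I -> R) J J' : (forall i, 0 <= F i) -> (J `<=` J')%fset ->
  \sum_(i <- J) F i <= \sum_(i <- J') F i.
Proof.
move=> F0 JJ'; rewrite [leRHS](big_fsetID _ (mem J)) /=.
have -> : [fset i in J' | i \in J]%fset = J.
  apply/fsetP => i; rewrite !inE; case: (boolP (i \in J)) => [iJ|]; last by rewrite andbF.
  by rewrite (fsubsetP JJ').
by rewrite lerDl sumr_ge0.
Qed.

(** Choose J0 whose sum of squares misses the squared norm by less than (e/2)^2. For J containing J0
    the residual vanishes on J0 and agrees with x or 0 elsewhere, so its squared norm is at most
    that gap. *)
Lemma ell2_approx x : (\sum_(j <- J) x j *: ell2_basis R j)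
  @[J --> @summability.totally I] --> x.
Proof.
apply/cvg_rnormP => e e0.
have e20 : 0 < e / 2 by rewrite divr_gt0.
have [J0 HJ0] : exists J, rnorm x ^+ 2 - (e / 2) ^+ 2 < \sum_(i <- J) rnorm (x i) ^+ 2.
  apply: contrapT => /forallNP xe.
  suff : rnorm x ^+ 2 <= rnorm x ^+ 2 - (e / 2) ^+ 2.
    have : 0 < (e / 2) ^+ 2 by rewrite exprn_gt0.
    lra.
  by apply: ell2_sqr_le => J; have /negP := xe J; rewrite -leNgt.
exists J0 => // J /= J0J; rewrite rnormB.
apply: (@le_lt_trans _ _ (e / 2)); last by lra.
apply: ell2_le => [|K]; first exact: ltW.
pose D := (K `|` J)%fset.
pose g i := rnorm ((x - \sum_(j <- J) x j *: ell2_basis R j) i) ^+ 2.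
have gD : \sum_(i <- K) g i <= \sum_(i <- D) g i.
  by apply: fsum_mono; [move=> i; exact: sqr_ge0|exact: fsubsetUl].
have := ell2_sum_le x D; rewrite (big_fsetID _ (mem J0)) /=.
have -> : [fset i in D | i \in J0]%fset = J0.
  apply/fsetP => i; rewrite !inE; case: (boolP (i \in J0)) => [iJ0|]; last by rewrite andbF.
  by rewrite (fsubsetP J0J) // orbT.
move=> xD; apply: (le_trans gD); rewrite (big_fsetID _ (mem J0)) /=.
rewrite big_seq big1 ?add0r => [|i]; last first.
  by rewrite !inE => /andP[_ /(fsubsetP J0J) iJ]; rewrite /g fin_approxE iJ rnorm0 expr0n.
apply: (@le_trans _ _ (\sum_(i <- [fset i in D | i \notin J0]%fset) rnorm (x i) ^+ 2)).
  apply: ler_sum => i _; rewrite /g fin_approxE; case: ifP => // _.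
  by rewrite rnorm0 expr0n sqr_ge0.
by move: xD HJ0; lra.
Qed.

Lemma ell2_ip_basis x i : ip x (ell2_basis R i) = x i.
Proof.
rewrite -[LHS]/(ell2_ip x (ell2_basis R i)) /ell2_ip /summability.sum.
apply: cvg_lim => //; apply: cvg_near_cst; exists [fset i]%fset => // J /= iJ.
have {}iJ : i \in J by rewrite (fsubsetP iJ) // inE.
rewrite psumE (big_fsetD1 i) // big_seq big1 => [|j].
  by rewrite Monoid.mulm1 /ell2_basis_fun eqxx conjC1 mulr1.
rewrite !inE => /andP[ji _].
by rewrite /ell2_basis_fun eq_sym (negbTE ji) conjC0 mulr0.
Qed.

(** The equation says that the adjoint of T maps y to the conjugate of c times z. Written with inner
    products it needs testing on basis vectors only, both sides being continuous in x. *)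
Lemma bop_ip_ext (T : bop (ell2 R I)) y z c :
  (forall i, ip (T (ell2_basis R i)) y = c * ip (ell2_basis R i) z) ->
  forall x, ip (T x) y = c * ip x z.
Proof.
move=> Tyz x; apply/eqP; rewrite -subr_eq0; apply/eqP/rnorm_le0 => e e0.
(* K bounds the norm of the functional given by the difference of the two sides. *)
pose K := rnorm T * rnorm y + rnorm c * rnorm z + 1.
have K0 : 0 < K by rewrite ltr_wpDl // addr_ge0 ?mulr_ge0 ?rnorm_ge0.
have eK : 0 < e / K by rewrite divr_gt0.
have [J _ HJ] := (cvg_rnormP _ _ _).1 (@ell2_approx x) _ eK.
have {HJ} := HJ J (fsubset_refl J); set s := \sum_(j <- J) _ => sx.
have -> : ip (T x) y - c * ip x z = ip (T (x - s)) y - c * ip (x - s) z.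
  rewrite linearB !ipBl mulrBr; suff -> : ip (T s) y = c * ip s z by ring.
  rewrite linear_sum !ip_suml big_distrr /=; apply: eq_bigr => i _.
  by rewrite linearZ !ipZl Tyz mulrCA.
apply: (@le_trans _ _ (K * rnorm (x - s))); last first.
  by rewrite mulrC -ler_pdivlMr // ltW // rnormB.
apply: le_trans (rnormB_le _ _) _; rewrite /K 2!mulrDl mul1r -addrA lerD //.
  rewrite mulrAC; apply: le_trans (cauchy_schwarz _ _) _.
  by rewrite ler_wpM2r ?rnorm_ge0 // bop_le.
rewrite rnormM -mulrA; apply: (@le_trans _ _ (rnorm c * (rnorm z * rnorm (x - s)))).
  by rewrite ler_wpM2l ?rnorm_ge0 // mulrC cauchy_schwarz.
by rewrite lerDl rnorm_ge0.
Qed.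

End ell2_theory.

(** * The weights b as coefficients of (1 - f)^(-m) *)

Section words.
Variables (R : realType) (n : nat) (a : prfh R n).
Implicit Types (w : seq 'I_n).

(* The coefficients of the p-th power of the series with coefficients a. *)
Fixpoint pow_coef (p : nat) w : R :=
  if p is p'.+1 then \sum_(s < (size w).+1) a (take s w) * pow_coef p' (drop s w)
  else (w == [::])%:R.

Lemma pow_coef_ge0 p w : 0 <= pow_coef p w.
Proof.
elim: p w => [|p IHp] w /=; first by rewrite ler0n.
by apply: sumr_ge0 => s _; rewrite mulr_ge0 ?coef_ge0.
Qed.

Lemma pow_coef_small p w : (size w < p)%N -> pow_coef p w = 0.
Proof.
elim: p w => [|p IHp] w //= wp; rewrite big1 // => -[[|s] /= sw] _.
  by rewrite take0 coef_nil mul0r.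
rewrite IHp ?mulr0 // size_drop ltn_subLR //.
by apply: leq_trans wp _; rewrite addSn ltnS leq_addl.
Qed.

(** A word has exactly one prefix of each length, so prefixes correspond to cut positions; N only
    makes the index type finite. *)
Lemma sum_prefix N w (G : seq 'I_n -> R) : (size w <= N)%N ->
  \sum_(u : N.-bseq 'I_n | prefix u w) G u = \sum_(s < (size w).+1) G (take s w).
Proof.
move=> wN; transitivity (\sum_(s < (size w).+1)
    \sum_(u : N.-bseq 'I_n | val u == take s w) G u); last first.
  apply: eq_bigr => s _.
  have sN : (size (take s w) <= N)%N by rewrite (leq_trans _ wN) // size_take_min geq_minr.
  by rewrite (big_pred1 (Bseq sN)).
rewrite [RHS](exchange_big_dep xpredT) //=.
rewrite big_mkcond /=; apply: eq_bigr => u _; rewrite prefixE.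
case: ifPn => [/eqP uw|uw].
  have us : (size u < (size w).+1)%N.
    by rewrite ltnS -uw size_take_min geq_minr.
  rewrite (big_pred1 (Ordinal us)) // => s /=; apply/idP/idP => [/eqP us'|/eqP ->].
    by apply/eqP/val_inj; rewrite /= us' size_takel // -ltnS.
  by rewrite /= uw.
rewrite big_pred0 // => s; apply/negbTE; apply: contra uw => /eqP uw.
by rewrite {1}uw size_takel -?uw // -ltnS.
Qed.

(** Splitting off the first factor turns the sum over tuples into the recursion of [pow_coef]. That
    recursion also admits empty factors, which is harmless because the coefficient of the empty word
    is 0. *)
Lemma sum_factorizations N p w : (size w <= N)%N ->
  \sum_(t : p.-tuple (N.-bseq 'I_n) |
      (flatten [seq val u | u <- t] == w) &&
      all (fun u : seq 'I_n => 0 < size u)%N [seq val u | u <- t])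
    \prod_(u <- t) a u = pow_coef p w.
Proof.
elim: p w => [|p IHp] w wN.
  have [->|w0] := eqVneq w [::].
    rewrite (big_pred1 [tuple]) ?big_nil ?eqxx // => t.
    by rewrite tuple0 /= eqxx.
  by rewrite big_pred0 /= ?(negbTE w0) // => t; rewrite tuple0 /= eq_sym (negbTE w0).
pose h (x : N.-bseq 'I_n * p.-tuple (N.-bseq 'I_n)) := cons_tuple x.1 x.2.
rewrite (reindex h) /=; last first.
  exists (fun t => (thead t, behead_tuple t)) => [[u t] _|t _] /=.
    by rewrite /h /=; congr (_, _); apply/val_inj.
  by apply/val_inj; rewrite /= [in RHS](tuple_eta t).
rewrite -(pair_big_dep xpredT (fun (u : N.-bseq 'I_n) (t : p.-tuple (N.-bseq 'I_n)) =>
   (u ++ flatten [seq val u | u <- t] == w) && ((0 < size u)%N &&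
     all (fun u : seq 'I_n => 0 < size u)%N [seq val u | u <- t]))
   (fun u t => \prod_(v <- (u :: t)) a v)) /=.
transitivity (\sum_(u : N.-bseq 'I_n | prefix u w) a u * pow_coef p (drop (size u) w));
  last first.
  rewrite (sum_prefix (fun u => a u * pow_coef p (drop (size u) w)) wN).
  by apply: eq_bigr => s _; rewrite /= size_takel // -ltnS.
rewrite [RHS]big_mkcond /=; apply: eq_bigr => u _.
have [u0|u0] := posnP (size u).
  have -> : (u : seq _) = [::] by apply/eqP; rewrite -size_eq0 u0.
  by rewrite big_pred0 ?coef_nil ?mul0r ?if_same // => t; rewrite andbF.
rewrite prefixE; case: ifPn => [/eqP uw|uw]; last first.
  rewrite big_pred0 // => t; apply/negbTE; apply: contra uw => /andP[/eqP <- _].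
  by rewrite take_size_cat.
rewrite -IHp ?size_drop ?(leq_trans (leq_subr _ _)) // big_distrr /=.
apply: eq_big => [t|t _]; last by rewrite big_cons.
by rewrite -{1}(cat_take_drop (size u) w) uw eqseq_cat // eqxx.
Qed.

(** This is the negative binomial expansion of (1 - f)^(-m). Powers above the length of w contribute
    nothing, so N is free, and words of different lengths can share one range of summation. The term
    p = 0 accounts for the empty word. *)
Lemma bcoefE m N w : (0 < m)%N -> (size w <= N)%N ->
  bcoef a m w = \sum_(p < N.+1) pow_coef p w * 'C(p + m - 1, m - 1)%:R.
Proof.
move=> m0 wN.
transitivity (\sum_(0 <= p < N.+1) pow_coef p w * 'C(p + m - 1, m - 1)%:R); last first.
  by rewrite big_mkord.
rewrite (big_cat_nat _ (n := (size w).+1)) //= [X in _ + X]big_nat_cond.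
rewrite [X in _ + X]big1 ?addr0 => [|p /andP[/andP[wp _] _]]; last first.
  by rewrite pow_coef_small ?mul0r.
rewrite big_ltn // add0n binn mulr1 /bcoef /=.
case: w {wN} => [|j w]; first by rewrite big_geq // eqxx addr0.
rewrite /= add0r; apply: eq_bigr => p _.
by rewrite -big_distrl /= sum_factorizations.
Qed.

Lemma bcoef_ge0 m w : (0 < m)%N -> 0 <= bcoef a m w.
Proof.
move=> m0; rewrite (bcoefE m0 (leqnn _)); apply: sumr_ge0 => p _.
by rewrite mulr_ge0 ?pow_coef_ge0.
Qed.

(** Coefficientwise f (1 - f)^(-m) <= (1 - f)^(-m): multiplication by f raises p by one, and the
    binomial coefficient grows with p. *)
Lemma bcoef_conv m w : (0 < m)%N ->
  \sum_(s < (size w).+1) a (take s w) * bcoef a m (drop s w) <= bcoef a m w.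
Proof.
move=> m0; rewrite (bcoefE m0 (leqnSn _)).
rewrite [leRHS]big_ord_recl /= ler_wpDl ?mulr_ge0 ?ler0n //.
under eq_bigr => s _.
  rewrite (bcoefE (N := size w) m0) ?size_drop ?leq_subr // big_distrr /=.
  over.
rewrite exchange_big /=; apply: ler_sum => p _; rewrite big_distrl /=.
apply: ler_sum => s _; rewrite -mulrA ler_wpM2l ?coef_ge0 //.
rewrite ler_wpM2l ?pow_coef_ge0 // ler_nat /bump /= leq_bin2l //.
by rewrite leq_sub2r // leq_add2r.
Qed.

Lemma bcoef_cat m u w : (0 < m)%N -> a u * bcoef a m w <= bcoef a m (u ++ w).
Proof.
move=> m0; apply: le_trans (bcoef_conv _ m0).
have us : (size u < (size (u ++ w)).+1)%N by rewrite ltnS size_cat leq_addr.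
rewrite (bigD1 (Ordinal us)) //= take_size_cat // drop_size_cat // lerDl.
by apply: sumr_ge0 => s _; rewrite mulr_ge0 ?coef_ge0 ?bcoef_ge0.
Qed.

Lemma bcoef_gt0 m w : (0 < m)%N -> 0 < bcoef a m w.
Proof.
move=> m0; elim: w => [|j w IHw]; first by rewrite /bcoef.
by apply: lt_le_trans (bcoef_cat [:: j] w m0); rewrite mulr_gt0 ?coef_letter.
Qed.

End words.

(** * Unconditional sums of nonnegative terms, and the negative binomial series *)

Section esum_theory.
Variable R : realType.

Lemma esum_swap (T1 T2 : choiceType) (F : T1 -> T2 -> \bar R) :
  (forall x y, 0 <= F x y)%E ->
  (\esum_(x in setT) \esum_(y in setT) F x y =
   \esum_(y in setT) \esum_(x in setT) F x y)%E.
Proof.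
move=> F0; rewrite esum_esum // esum_esum; last by move=> *; exact: F0.
have E (U V : choiceType) : [set: U] `*`` (fun=> [set: V]) = setT by exact/seteqP.
rewrite !E (reindex_esum setT setT (fun p : T2 * T1 => (p.2, p.1))) /=; last first.
- split => //= [[x y] [x' y'] _ _ /= [-> ->]//|[x y] _].
  by exists (y, x).
- by [].
Qed.

Lemma esumZ (T : choiceType) (D : set T) (c : R) (F : T -> R) :
  0 <= c -> (forall x, 0 <= F x) ->
  (\esum_(x in D) (c * F x)%:E = c%:E * \esum_(x in D) (F x)%:E)%E.
Proof.
(* One inequality suffices: for c > 0 the reverse one is its instance at c^-1 and c F. *)
have h (d : R) (G : T -> R) : 0 <= d -> (forall x, 0 <= G x) ->
    (\esum_(x in D) (d * G x)%:E <= d%:E * \esum_(x in D) (G x)%:E)%E.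
  move=> d0 G0; apply: ge_ereal_sup => _ [A [finA AD] <-].
  rewrite fsbig_finite //= sumEFin -big_distrr EFinM /=.
  apply: lee_wpmul2l; first by rewrite lee_fin.
  by apply: esum_ge; exists A; rewrite // fsbig_finite //= sumEFin.
move=> c0 F0; apply/eqP; rewrite eq_le h //=.
have [->|cn0] := eqVneq c 0.
  by rewrite mul0e; apply: esum_ge0 => x _; rewrite mul0r.
have cp : 0 < c by rewrite lt_def cn0.
have := h c^-1 (fun x => c * F x); rewrite invr_ge0 => /(_ c0).
under eq_esum => x _ do rewrite mulrA mulVf // mul1r.
rewrite -(@lee_pmul2l _ c%:E) ?lte_fin // => h1.
have {}h1 := h1 (fun x => mulr_ge0 c0 (F0 x)).
apply: (le_trans h1); by rewrite muleA -EFinM mulfV // mul1e.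
Qed.

Lemma esum_ord (N : nat) (F : nat -> R) : (forall p, 0 <= F p) ->
  (\esum_(p in `I_N) (F p)%:E = (\sum_(p < N) F p)%:E)%E.
Proof.
move=> F0; rewrite esum_fset ?finite_II //; last by move=> p _; rewrite lee_fin.
by rewrite -fsbig_ord sumEFin.
Qed.

Lemma esum_ord_support (N : nat) (F : nat -> R) : (forall p, 0 <= F p) ->
  (forall p, (N <= p)%N -> F p = 0) ->
  (\esum_(p in setT) (F p)%:E = (\sum_(p < N) F p)%:E)%E.
Proof.
move=> F0 FN; rewrite -esum_ord // [RHS]esum_mkcond; apply: eq_esum => p _.
by case: ifPn => //; rewrite notin_setE /= => /negP; rewrite -leqNgt => /FN ->.
Qed.

(** A word together with a cut position is the same as a pair of words, so the sum of a convolution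
    is a product of sums. *)
Lemma esum_conv (T : choiceType) (F G : seq T -> R) (u v : R) :
  (forall w, 0 <= F w) -> (forall w, 0 <= G w) ->
  (\esum_(w in setT) (F w)%:E = u%:E)%E -> (\esum_(w in setT) (G w)%:E = v%:E)%E ->
  (\esum_(w in setT)
    (\sum_(s < (size w).+1) F (take s w) * G (drop s w))%:E = (u * v)%:E)%E.
Proof.
move=> F0 G0 Fu Gv; have FG0 x y : 0 <= F x * G y by rewrite mulr_ge0.
have u0 : 0 <= u by rewrite -lee_fin -Fu; apply: esum_ge0 => w _; rewrite lee_fin.
transitivity (\esum_(x in setT) \esum_(y in setT) (F x * G y)%:E)%E; last first.
  under eq_esum => x _ do rewrite esumZ // Gv -EFinM mulrC.
  have v0 : 0 <= v by rewrite -lee_fin -Gv; apply: esum_ge0 => w _; rewrite lee_fin.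
  by rewrite esumZ // Fu -EFinM mulrC.
under eq_esum => w _.
  rewrite -(@esum_ord (size w).+1 (fun s => F (take s w) * G (drop s w))) //.
  over.
rewrite esum_esum; last by move=> *; rewrite lee_fin.
rewrite esum_esum; last by move=> *; rewrite lee_fin.
rewrite [RHS](reindex_esum ([set: seq T] `*`` (fun w => `I_(size w).+1)) _
  (fun p => (take p.2 p.1, drop p.2 p.1))) //.
split => //= [[w s] [w' s']|[x y] _] /=.
  rewrite !inE /= => -[_ sw] [_ sw'] [tt dd].
  have ss : s = s'.
    by have := congr1 size tt; rewrite !size_takel.
  by rewrite -(cat_take_drop s w) tt dd ss cat_take_drop.
exists (x ++ y, size x) => /=; last by rewrite take_size_cat ?drop_size_cat.
by split => //; rewrite /= ltnS size_cat leq_addr.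
Qed.

(** Pascal's rule gives t (m+1) (N+1) = t m (N+1) + u t (m+1) N for the partial sums t. They
    increase and are bounded, so the limit x exists and solves x = L + u x, with L the limit one
    level below. *)
Lemma negbin_cvg (u : R) (m : nat) : 0 <= u < 1 ->
  (fun N => \sum_(p < N) 'C(p + m, m)%:R * u ^+ p) @ \oo --> (1 - u) ^- m.+1.
Proof.
move=> /andP[u0 u1]; have u10 : 0 < 1 - u by rewrite subr_gt0.
pose t m N := \sum_(p < N) 'C(p + m, m)%:R * u ^+ p.
have tS m' N : t m'.+1 N.+1 = t m' N.+1 + u * t m'.+1 N.
  rewrite /t big_ord_recl [in X in _ = X + _]big_ord_recl /= !add0n !binn -addrA.
  congr (_ + _); rewrite big_distrr -big_split /=; apply: eq_bigr => p _.
  by rewrite (_ : bump 0 p = p.+1) // addSn binS natrD exprS (addSnnS p m'); ring.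
have t0S N : t 0%N N.+1 = 1 + u * t 0%N N.
  rewrite /t big_ord_recl /= bin0 mul1r expr0; congr (_ + _).
  by rewrite big_distrr /=; apply: eq_bigr => p _; rewrite !bin0 !mul1r exprS.
have tmono m' N : t m' N <= t m' N.+1.
  by rewrite /t [leRHS]big_ord_recr /= lerDl mulr_ge0 ?exprn_ge0.
(* Covers both the base case, with c constantly 1, and the induction step, with c = t m. *)
have step (c : nat -> R) m' L : (forall N, t m' N.+1 = c N.+1 + u * t m' N) ->
    c @ \oo --> L -> (forall N, c N <= L) -> t m' @ \oo --> L / (1 - u) /\ 
      forall N, t m' N <= L / (1 - u).
  move=> tc cL cL1.
  have tb N : t m' N <= L / (1 - u).
    rewrite ler_pdivlMr // mulrBr mulr1 lerBlDr; apply: le_trans (tmono _ _) _.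
    by rewrite tc lerD // mulrC.
  split => //.
  have tcv : cvgn (t m').
    apply: nondecreasing_is_cvgn; last by exists (L / (1 - u)) => _ [N _ <-].
    by apply/nondecreasing_seqP => N; exact: tmono.
  have l1 : t m' N.+1 @[N --> \oo] --> limn (t m') by rewrite (cvg_shiftS (t m')).
  have l2 : t m' N.+1 @[N --> \oo] --> L + u * limn (t m').
    rewrite (_ : (fun N => _) = fun N => c N.+1 + u * t m' N); last exact/funext.
    apply: cvgD; first by rewrite (cvg_shiftS c).
    by apply: cvgMr.
  have := cvg_unique _ l1 l2 => /(_ (@norm_hausdorff _ R^o)) e.
  have {}e : limn (t m') = L + u * limn (t m') by apply: e.
  rewrite (_ : L / (1 - u) = limn (t m')) //.
  by apply: (mulIf (lt0r_neq0 u10)); rewrite mulfVK ?gt_eqF //; move: e; lra.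
suff [] : t m @ \oo --> (1 - u) ^- m.+1 /\ forall N, t m N <= (1 - u) ^- m.+1 by [].
elim: m => [|m [IH1 IH2]].
  rewrite expr1 -[_^-1]mul1r; apply: (step (fun=> 1)) => //; exact: cvg_cst.
rewrite exprS invfM mulrC; exact: (step (t m)).
Qed.

End esum_theory.

(** * Evaluating the powers of f and (1 - f)^(-m) at nonnegative multiplicative weights *)

Section word_sums.
Variables (R : realType) (n : nat) (a : prfh R n) (c : 'I_n -> R).
Hypothesis c_ge0 : forall j, 0 <= c j.

Let cw (w : seq 'I_n) := \prod_(j <- w) c j.

Let cw_ge0 w : 0 <= cw w.
Proof. exact: prodr_ge0. Qed.

(** The weight [cw] is multiplicative under concatenation, so [esum_conv] turns each convolution
    with a into a factor u. *)
Lemma esum_pow_coef (u : R) p :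
  (\esum_(w in setT) (a w * cw w)%:E = u%:E)%E ->
  (\esum_(w in setT) (pow_coef a p w * cw w)%:E = (u ^+ p)%:E)%E.
Proof.
move=> au; elim: p => [|p IHp] /=.
  transitivity (\esum_(w in [set ([::] : seq 'I_n)]) (1%:E : \bar R))%E.
    rewrite [RHS]esum_mkcond; apply: eq_esum => w _.
    case: eqVneq => [->|w0]; first by rewrite mem_set // /cw big_nil mulr1.
    by rewrite memNset ?mul0r //; exact/eqP.
  by rewrite esum_set1.
have := esum_conv _ _ au IHp; rewrite exprS => <-.
- apply: eq_esum => w _; congr _%:E; rewrite big_distrl /=; apply: eq_bigr => s _.
  have -> : cw w = cw (take s w) * cw (drop s w).
    by rewrite /cw -big_cat cat_take_drop.
  by rewrite mulrACA.
- by move=> w; rewrite mulr_ge0 ?coef_ge0.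
- by move=> w; rewrite mulr_ge0 ?pow_coef_ge0.
Qed.

Lemma esum_bcoef (u : R) m : (0 < m)%N -> u < 1 ->
  (\esum_(w in setT) (a w * cw w)%:E = u%:E)%E ->
  (\esum_(w in setT) (bcoef a m w * cw w)%:E = ((1 - u) ^- m)%:E)%E.
Proof.
case: m => // m _ u1 au.
have u0 : 0 <= u.
  by rewrite -lee_fin -au; apply: esum_ge0 => w _; rewrite lee_fin mulr_ge0 ?coef_ge0.
(* The sum up to the length of w is extended to all p, so that its range no longer depends on w when
   the two sums are exchanged. *)
under eq_esum => w _.
  rewrite (bcoefE a (m := m.+1) (ltn0Sn _) (leqnn _)) big_distrl /=.
  rewrite -(@esum_ord_support _ (size w).+1 (fun p =>
    pow_coef a p w * 'C(p + m.+1 - 1, m.+1 - 1)%:R * cw w)); last 2 first.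
  - by move=> p; rewrite !mulr_ge0 ?pow_coef_ge0.
  - by move=> p wp; rewrite pow_coef_small ?mul0r.
  over.
rewrite esum_swap => [|w p]; last by rewrite lee_fin !mulr_ge0 ?pow_coef_ge0.
under eq_esum => p _.
  under eq_esum => w _ do rewrite mulrAC [_ * 'C(_, _)%:R]mulrC.
  rewrite esumZ // ?(esum_pow_coef p au) -?EFinM; last first.
    by move=> w; rewrite mulr_ge0 ?pow_coef_ge0.
  over.
have F0 p : (0 <= ('C(p + m.+1 - 1, m.+1 - 1)%:R * u ^+ p)%:E)%E.
  by rewrite lee_fin mulr_ge0 ?exprn_ge0.
rewrite -(nneseries_esumT (a := fun p => ('C(p + m.+1 - 1, m.+1 - 1)%:R * u ^+ p)%:E)) //.
apply: cvg_lim => //.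
rewrite (_ : (fun N => _) = (fun N => (\sum_(p < N) 'C(p + m, m)%:R * u ^+ p)%:E)).
  by apply: cvg_EFin; [exact: nearW|apply: negbin_cvg; rewrite u0].
apply/funext => N; rewrite big_mkord sumEFin; congr _%:E.
by apply: eq_bigr => p _; rewrite addnS !subn1.
Qed.

End word_sums.

(** * Replacing, prefixing and unprefixing one component of a multiword *)

Section multiwords.
Variables (k : nat) (n : 'I_k -> nat).
Implicit Types be ga : multiword n.

(** Generalises [mcons]: [mcons j be] is convertible to [upd be (j :: be i)]. *)
Definition upd be i (w : seq 'I_(n i)) : multiword n :=
  [ffun i' => dfwith be i w i'].

Lemma upd_in be i (w : seq 'I_(n i)) : upd be w i = w.
Proof. by rewrite ffunE dfwithin. Qed.

Lemma upd_out be i (w : seq 'I_(n i)) i' : i != i' -> upd be w i' = be i'.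
Proof. by move=> ii'; rewrite ffunE dfwithout. Qed.

Lemma upd_upd be i (w w' : seq 'I_(n i)) : upd (upd be w) w' = upd be w'.
Proof.
apply/ffunP => i'; have [<-|ii'] := eqVneq i i'; first by rewrite !upd_in.
by rewrite !upd_out.
Qed.

Lemma upd_id be i : upd be (be i) = be.
Proof.
apply/ffunP => i'; have [<-|ii'] := eqVneq i i'; first by rewrite upd_in.
by rewrite upd_out.
Qed.

(** Total on purpose: it drops as many letters as al has, and inverts prefixing by al only when al
    is a prefix of the i-th word. *)
Definition unprefix i (al : seq 'I_(n i)) ga : multiword n :=
  upd ga (drop (size al) (ga i)).

Lemma unprefixK i (al : seq 'I_(n i)) ga : prefix al (ga i) ->
  upd (unprefix al ga) (al ++ unprefix al ga i) = ga.
Proof.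
rewrite /unprefix upd_in upd_upd prefixE => /eqP alga.
by rewrite -[X in X ++ _]alga cat_take_drop upd_id.
Qed.

Lemma updK i (al : seq 'I_(n i)) be : unprefix al (upd be (al ++ be i)) = be.
Proof. by rewrite /unprefix upd_in upd_upd drop_size_cat // upd_id. Qed.

Lemma upd_eq i (al : seq 'I_(n i)) be ga :
  (upd be (al ++ be i) == ga) = prefix al (ga i) && (be == unprefix al ga).
Proof.
apply/eqP/andP => [<-|[alga /eqP ->]]; last exact: unprefixK.
by rewrite updK upd_in prefix_prefix eqxx.
Qed.

Variable R : realType.

(** Removing the prefix al is injective on the multiwords that carry it, so the left side sums
    distinct coordinates of x. *)
Lemma unprefix_sum_le (x : fock R n) i (al : seq 'I_(n i)) (J : {fset multiword n}) :
  \sum_(ga <- J | prefix al (ga i)) rnorm (x (unprefix al ga)) ^+ 2 <= rnorm x ^+ 2.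
Proof.
apply: le_trans (ell2_sum_le x [fset unprefix al ga | ga in J & prefix al (ga i)]%fset).
rewrite big_imfset /=; last first.
  move=> be ga /andP[_ bep] /andP[_ gap] bg.
  by rewrite -(unprefixK bep) -(unprefixK gap) bg.
by rewrite big_filter.
Qed.

End multiwords.

(** * Sums over multiwords as products of sums over words *)

Section finite_products.
Variable R : realType.

Lemma real_prod_cvg (T : Type) (r : seq T) (p : T -> nat -> R) (s : T -> R) :
  (forall i, p i @ \oo --> s i) ->
  (fun N => \prod_(i <- r) p i N) @ \oo --> \prod_(i <- r) s i.
Proof.
move=> ps; elim: r => [|i r IHr].
  by under eq_fun do rewrite big_nil; rewrite big_nil; exact: cvg_cst.
by under eq_fun do rewrite big_cons; rewrite big_cons; exact: cvgM.
Qed.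

Lemma bseq_sum_le (T : finType) (g : seq T -> R) (s : R) N :
  (forall w, 0 <= g w) -> (\esum_(w in setT) (g w)%:E = s%:E)%E ->
  \sum_(w : N.-bseq T) g w <= s.
Proof.
move=> g0 gs; rewrite -lee_fin -gs.
pose A := [fset val w | w : N.-bseq T]%fset.
apply: esum_ge; exists [set` A]; first by split => //; exact: finite_fset.
rewrite fsbig_finite ?finite_fset //= set_fsetK sumEFin lee_fin.
rewrite big_imfset /=; last by move=> ? ? _ _; exact: val_inj.
by rewrite big_enum.
Qed.

Lemma fset_bseq_le (T : finType) (g : seq T -> R) (J : {fset seq T}) N :
  (forall w, 0 <= g w) -> (forall w, w \in J -> (size w <= N)%N) ->
  \sum_(w <- J) g w <= \sum_(w : N.-bseq T) g w.
Proof.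
move=> g0 JN; pose A := [fset val w | w : N.-bseq T]%fset.
have -> : \sum_(w : N.-bseq T) g w = \sum_(w <- A) g w.
  rewrite big_imfset /=; last by move=> ? ? _ _; exact: val_inj.
  by rewrite big_enum.
apply: fsum_mono => //; apply/fsubsetP => w /JN wN.
by apply/imfsetP; exists (Bseq wN).
Qed.

Lemma bseq_sum_cvg (T : finType) (g : seq T -> R) (s : R) :
  (forall w, 0 <= g w) -> (\esum_(w in setT) (g w)%:E = s%:E)%E ->
  (fun N => \sum_(w : N.-bseq T) g w) @ \oo --> s.
Proof.
move=> g0 gs; apply/cvgrPdist_lt => e e0.
have [J HJ] : exists J : {fset seq T}, s - e < \sum_(w <- J) g w.
  apply: contrapT => /forallNP xe.
  suff : (s%:E <= (s - e)%:E)%E by rewrite lee_fin; lra.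
  rewrite -gs; apply: ge_ereal_sup => _ [F [finF _] <-].
  rewrite fsbig_finite //= sumEFin lee_fin.
  by have /negP := xe (fset_set F); rewrite -leNgt.
exists (\max_(w <- J) size w) => // N /= NJ.
have JN w : w \in J -> (size w <= N)%N.
  move=> wJ; apply: leq_trans NJ; exact: (@leq_bigmax_seq _ (enum_fset J) xpredT size w wJ isT).
have := fset_bseq_le g0 JN; have := bseq_sum_le N g0 gs => h1 h2.
by rewrite ger0_norm ?subr_ge0 //; move: HJ h1 h2; lra.
Qed.

Variables (k : nat) (n : 'I_k -> nat).
Variables (g : forall i : 'I_k, seq 'I_(n i) -> R).
Arguments g : clear implicits.
Hypothesis g_ge0 : forall i w, 0 <= g i w.

Let T N i : finType := N.-bseq 'I_(n i).

Let h N (t : fprod (T N)) : multiword n := [ffun i => val (t i)].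

Let h_inj N : injective (@h N).
Proof.
move=> t t' tt'; apply/fprodP => i; apply: val_inj.
by have /ffunP/(_ i) := tt'; rewrite !ffunE.
Qed.

Let box N := [fset h t | t : fprod (T N)]%fset.

(** Finite distributivity over the multiwords whose components all have length at most N; such boxes
    exhaust the multiwords. *)
Let box_sum N : \sum_(be <- box N) \prod_(i < k) g i (be i) =
  \prod_i \sum_(w : N.-bseq 'I_(n i)) g i w.
Proof.
rewrite big_imfset /=; last by move=> ? ? _ _; exact: h_inj.
rewrite big_enum /=.
pose P_ i : {ffun T N i -> R} := [ffun w : T N i => g i w].
transitivity (\sum_(t : fprod (T N)) \prod_i P_ i (t i)).
  by apply: eq_bigr => t _; apply: eq_bigr => i _; rewrite !ffunE.
transitivity (\prod_i \sum_(w : T N i) P_ i w); last first.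
  by apply: eq_bigr => i _; apply: eq_bigr => w _; rewrite ffunE.
under [RHS]eq_bigr => i _ do rewrite (big_tag (fun i => P_ i) i).
by rewrite bigA_distr_big_dep -big_fprod.
Qed.

Let sub_box N (be : multiword n) : (forall i, (size (be i) <= N)%N) -> be \in box N.
Proof.
move=> beN; apply/imfsetP => /=; exists (fprod_of_fun (fun i => Bseq (beN i) : T N i)) => //.
by apply/ffunP => i; rewrite ffunE fprodE.
Qed.

Lemma multiword_sum_le (s : 'I_k -> R) (J : {fset multiword n}) :
  (forall i, \esum_(w in setT) (g i w)%:E = (s i)%:E)%E ->
  \sum_(be <- J) \prod_i g i (be i) <= \prod_i s i.
Proof.
move=> gs; pose N := (\max_(be <- J) \max_(i < k) size (be i))%N.
apply: (@le_trans _ _ (\sum_(be <- box N) \prod_(i < k) g i (be i))).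
  apply: fsum_mono => [be|]; first exact: prodr_ge0.
  apply/fsubsetP => be beJ; apply: sub_box => i.
  apply: leq_trans (@leq_bigmax_seq _ (enum_fset J) xpredT (fun be : multiword n => \max_(i < k) size (be i))%N be beJ isT).
  exact: (@leq_bigmax _ (fun i => size (be i)) i).
rewrite box_sum; apply: ler_prod => i _; rewrite sumr_ge0 //=.
exact: bseq_sum_le (@g_ge0 i) (gs i).
Qed.

(** Together with [multiword_sum_le] this evaluates the sum over all multiwords: the box sums are
    among the finite sums bounded by M, and they converge to the product. *)
Lemma multiword_sum_ge (s : 'I_k -> R) (M : R) :
  (forall i, \esum_(w in setT) (g i w)%:E = (s i)%:E)%E ->
  (forall J : {fset multiword n}, \sum_(be <- J) \prod_i g i (be i) <= M) ->
  \prod_i s i <= M.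
Proof.
move=> gs gM.
have h1 := real_prod_cvg (r := index_enum 'I_k) (fun i => bseq_sum_cvg (@g_ge0 i) (gs i)).
rewrite -(cvg_lim (@norm_hausdorff _ R^o) h1); apply: limr_le; first exact: cvgP h1.
by apply: nearW => N; rewrite -box_sum.
Qed.

End finite_products.

(** * Weighted shifts, the universal model and the row contraction *)

Section shifts.
Variables (R : realType) (k : nat) (n m : 'I_k -> nat).
Variable f : forall i : 'I_k, prfh R (n i).
Hypothesis m_gt0 : forall i, (0 < m i)%N.
Implicit Types (be ga : multiword n) (x : fock R n).

Local Notation b i := (bcoef (f i) (m i)).

Let b_gt0 i w : 0 < b i w.
Proof. exact: bcoef_gt0. Qed.

Definition shift_weight i (al : seq 'I_(n i)) be : R :=
  Num.sqrt (b i (be i) / b i (al ++ be i)).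

Lemma shift_weight_le i (al : seq 'I_(n i)) be : 0 < f i al ->
  shift_weight al be ^+ 2 <= (f i al)^-1.
Proof.
move=> fal; rewrite /shift_weight sqr_sqrtr ?divr_ge0 ?(ltW (b_gt0 _)) //.
by rewrite ler_pdivrMr // mulrC ler_pdivlMr // mulrC bcoef_cat.
Qed.

Let shift_fun i (al : seq 'I_(n i)) (x : multiword n -> R[i]) ga : R[i] :=
  if prefix al (ga i) then
    (shift_weight al (unprefix al ga))%:C * x (unprefix al ga)
  else 0.

(** The squared weights are at most 1 / a_al, since a_al b_be <= b_(al be). For single letters this
    shows that [umodel] is the intended shift and not its default value 0. *)
Lemma shift_exists i (al : seq 'I_(n i)) : 0 < f i al ->
  exists T : bop (fock R n), forall be : multiword n, T (ell2_basis R be) =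
    (shift_weight al be)%:C *: ell2_basis R (upd be (al ++ be i)).
Proof.
move=> fal; pose K := Num.sqrt (f i al)^-1.
have K0 : 0 <= K by rewrite sqrtr_ge0.
have K2 : K ^+ 2 = (f i al)^-1 by rewrite sqr_sqrtr // invr_ge0 ltW.
have bnd x (J : {fset multiword n}) :
    \sum_(ga <- J) rnorm (shift_fun al x ga) ^+ 2 <= (K * rnorm x) ^+ 2.
  rewrite exprMn.
  apply: le_trans (ler_wpM2l (sqr_ge0 K) (unprefix_sum_le x al J)).
  rewrite big_distrr /= [leRHS]big_mkcond /=; apply: ler_sum => ga _.
  rewrite /shift_fun; case: ifP => _; last by rewrite rnorm0 expr0n.
  rewrite rnormM rnorm_real exprMn ler_wpM2r ?sqr_ge0 //.
  by rewrite real_normK ?num_real // K2 shift_weight_le.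
have mem x : shift_fun al x \in @sqsummable R (multiword n).
  exact: sqsummable_le (bnd x).
pose T x : fock R n := Ell2 (mem x).
have Tl : linear T.
  move=> a x y; apply: ell2P => ga; rewrite ell2D ell2Z /= /shift_fun.
  case: ifP => _; last by rewrite mulr0 addr0.
  transitivity ((shift_weight al (unprefix al ga))%:C *
    (a * x (unprefix al ga) + y (unprefix al ga))); first by [].
  by rewrite mulrDr mulrCA.
have Tb : T \in @bounded_linear R (fock R n).
  apply: (@bounded_linearP _ _ _ K) => // x; apply: ell2_le => [|J].
    by rewrite mulr_ge0 ?rnorm_ge0.
  exact: bnd.
exists (Bop Tb) => be; apply: ell2P => ga.
rewrite ell2Z ell2_basisE upd_eq /= /shift_fun /ell2_basis_fun.
case: ifP => //= _; last by rewrite mulr0.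
by case: eqVneq => [<-//|]; rewrite !mulr0.
Qed.

Lemma umodelE i (j : 'I_(n i)) be : umodel f m j (ell2_basis R be) =
  (shift_weight [:: j] be)%:C *: ell2_basis R (upd be (j :: be i)).
Proof.
have [T HT] := @shift_exists i [:: j] (coef_letter (f i) j).
have : [set T : bop (fock R n) | forall be : multiword n, T (ell2_basis R be) =
    (Num.sqrt (bcoef (f i) (m i) (be i) /
               bcoef (f i) (m i) (j :: be i)))%:C *: ell2_basis R (mcons j be)]
    (umodel f m j).
  by apply: xgetPex; exists T.
exact.
Qed.

Definition umodel_word i (al : seq 'I_(n i)) : bop (fock R n) :=
  \prod_(j <- al) umodel f m j.

(** Along a word the ratios under the square roots telescope. *)
Lemma umodel_wordE i (al : seq 'I_(n i)) be : umodel_word al (ell2_basis R be) =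
  (shift_weight al be)%:C *: ell2_basis R (upd be (al ++ be i)).
Proof.
rewrite /umodel_word; elim: al => [|j al IHal].
  by rewrite big_nil bop1 /shift_weight /= upd_id divff ?gt_eqF // sqrtr1 scale1r.
rewrite big_cons bopM IHal linearZ /= umodelE scalerA -rmorphM /= upd_in upd_upd.
congr (_%:C *: _); rewrite /shift_weight -sqrtrM ?divr_ge0 ?(ltW (b_gt0 _)) //=.
by rewrite upd_in; congr Num.sqrt; rewrite mulrA mulfVK // gt_eqF.
Qed.

Lemma umodel_word_coord i (al : seq 'I_(n i)) x ga : umodel_word al x ga =
  if prefix al (ga i) then (shift_weight al (unprefix al ga))%:C * x (unprefix al ga)
  else 0.
Proof.
rewrite -ell2_ip_basis.
rewrite (@bop_ip_ext _ _ _ _ (ell2_basis R (unprefix al ga))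
  (if prefix al (ga i) then (shift_weight al (unprefix al ga))%:C else 0)).
  by rewrite ell2_ip_basis; case: ifP; rewrite ?mul0r.
move=> be; rewrite umodel_wordE ipZl !ell2_ip_basis !ell2_basisE upd_eq.
case: ifP => _ /=; last by rewrite mul0r mulr0.
by case: eqVneq => [<-//|_]; rewrite !mulr0.
Qed.

(** Each coordinate of S x is bounded by a weighted Cauchy-Schwarz inequality. In the sum over the
    coordinates every word al then contributes at most the squared norm of x, by
    [unprefix_sum_le]. *)
Lemma row_contraction i (F : {fset seq 'I_(n i)}) (c : seq 'I_(n i) -> R[i]) :
  rnorm (\sum_(al <- F) ((f i al)%:C * c al) *: umodel_word al) ^+ 2 <=
  \sum_(al <- F) f i al * rnorm (c al) ^+ 2.
Proof.
set S := \sum_(al <- F) _ *: _; set s := \sum_(al <- F) _ * _.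
have s0 : 0 <= s.
  by apply: sumr_ge0 => al _; rewrite mulr_ge0 ?coef_ge0 ?sqr_ge0.
suff : rnorm S <= Num.sqrt s.
  by rewrite -(ler_sqr (x := rnorm S)) ?nnegrE ?rnorm_ge0 ?sqrtr_ge0 // sqr_sqrtr.
apply: bop_rnorm_le => [|x]; first exact: sqrtr_ge0.
apply: ell2_le => [|J]; first by rewrite mulr_ge0 ?sqrtr_ge0 ?rnorm_ge0.
rewrite exprMn sqr_sqrtr //.
pose y ga al := rnorm (c al) * rnorm (x (unprefix al ga)).
have pointwise ga : rnorm (S x ga) ^+ 2 <=
    \sum_(al <- F | prefix al (ga i)) f i al * y ga al ^+ 2.
  pose q (al : seq 'I_(n i)) := shift_weight al (unprefix al ga).
  have q0 al : 0 <= q al by rewrite sqrtr_ge0.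
  (* Here q^2 is the b of the remaining word divided by the b of the whole word, so this is
     [bcoef_conv] restricted to the prefixes lying in F. *)
  have fq : \sum_(al <- F | prefix al (ga i)) f i al * q al ^+ 2 <= 1.
    have -> : \sum_(al <- F | prefix al (ga i)) f i al * q al ^+ 2 =
        (\sum_(al <- F | prefix al (ga i))
          f i al * b i (drop (size al) (ga i))) / b i (ga i).
      rewrite big_distrl /=; apply: eq_bigr => al; rewrite prefixE => /eqP alga.
      rewrite /q /shift_weight sqr_sqrtr ?divr_ge0 ?(ltW (b_gt0 _)) // upd_in.
      by rewrite -[X in X ++ _]alga cat_take_drop mulrA.
    rewrite ler_pdivrMr // mul1r; apply: le_trans (bcoef_conv _ _ (m_gt0 i)).
    have -> : \sum_(s < (size (ga i)).+1)
        f i (take s (ga i)) * b i (drop s (ga i)) =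
      \sum_(al <- [fset take (val s) (ga i) | s in 'I_(size (ga i)).+1]%fset)
        f i al * b i (drop (size al) (ga i)).
      rewrite big_imfset /=; last first.
        move=> s1 s2 _ _ /(congr1 size).
        by rewrite !size_takel -1?ltnS // => /val_inj.
      rewrite big_enum /=; apply: eq_bigr => s' _.
      by rewrite size_takel // -ltnS.
    rewrite -big_filter.
    have -> : \sum_(al <- [seq al <- F | prefix al (ga i)])
          f i al * b i (drop (size al) (ga i)) =
        \sum_(al <- [fset al in F | prefix al (ga i)]%fset)
          f i al * b i (drop (size al) (ga i)).
      rewrite big_filter; apply: esym; rewrite big_imfset //=.
      by rewrite big_filter.
    apply: fsum_mono => [al|]; first by rewrite mulr_ge0 ?coef_ge0 ?(ltW (b_gt0 _)).
    apply/fsubsetP => al; rewrite !inE /= prefixE => /andP[_ /eqP alga].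
    apply/imfsetP; have sz : (size al < (size (ga i)).+1)%N.
      by rewrite ltnS -alga size_take_min geq_minr.
    by exists (Ordinal sz).
  set z := \sum_(al <- F | prefix al (ga i)) f i al * (q al * y ga al).
  have Sz : rnorm (S x ga) <= z.
    rewrite bop_sum ell2_sumE; apply: le_trans (rnorm_sum _ _ _) _.
    rewrite /z [leRHS]big_mkcond; apply: ler_sum => al _.
    rewrite bopZ ell2Z umodel_word_coord; case: ifP => _; last by rewrite mulr0 rnorm0.
    rewrite !rnormM !rnorm_real !ger0_norm ?coef_ge0 ?q0 // /y.
    by rewrite -mulrA ler_wpM2l ?coef_ge0 // mulrCA.
  have z0 : 0 <= z by apply: le_trans Sz; exact: rnorm_ge0.
  apply: (@le_trans _ _ (z ^+ 2)).
    by rewrite ler_sqr ?nnegrE ?rnorm_ge0.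
  (* Expanding the squares gives z^2 <= sum of a y^2, because the weights a q^2 add up to at most
     1. *)
  have : 0 <= \sum_(al <- F | prefix al (ga i)) f i al * (q al * z - y ga al) ^+ 2.
    by apply: sumr_ge0 => al _; rewrite mulr_ge0 ?coef_ge0 ?sqr_ge0.
  have -> : \sum_(al <- F | prefix al (ga i)) f i al * (q al * z - y ga al) ^+ 2 =
     (\sum_(al <- F | prefix al (ga i)) f i al * q al ^+ 2) * z ^+ 2 - 2 * z * z +
     \sum_(al <- F | prefix al (ga i)) f i al * y ga al ^+ 2.
    have -> : 2 * z * z = \sum_(al <- F | prefix al (ga i))
        2 * z * (f i al * (q al * y ga al)) by rewrite -big_distrr.
    rewrite big_distrl -sumrB -big_split /=.
    by apply: eq_bigr => al _; ring.
  have := ler_wpM2r (sqr_ge0 z) fq; rewrite mul1r expr2; set V := \sum_(al <- F | _) _.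
  by lra.
apply: le_trans (ler_sum _ (fun ga _ => pointwise ga)) _.
under eq_bigr do rewrite big_mkcond.
rewrite exchange_big /= /s big_distrl /=; apply: ler_sum => al _.
rewrite -big_mkcond /= -[leRHS]mulrA -big_distrr /= ler_wpM2l ?coef_ge0 //.
under eq_bigr do rewrite exprMn.
by rewrite -big_distrr /= ler_wpM2l ?sqr_ge0 // unprefix_sum_le.
Qed.

End shifts.

(** * Closed algebras of operators and the contractivity of their characters *)

Section characters.
Variables (R : realType) (H : hilbertType R).

Definition closed_subalgebra (A : set (bop H)) : Prop :=
  [/\ closed A, A 1, forall a S T, A S -> A T -> A (a *: S + T) &
      forall S T, A S -> A T -> A (S * T)].

(** X is a total function constrained only on A; its continuity there is a consequence,
    [character_contractive]. *)
Definition character (A : set (bop H)) (X : bop H -> R[i]) : Prop :=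
  [/\ X 1 = 1, forall a S T, A S -> A T -> X (a *: S + T) = a * X S + X T &
      forall S T, A S -> A T -> X (S * T) = X S * X T].

Variable A : set (bop H).
Hypothesis algA : closed_subalgebra A.

Lemma subalg0 : A 0.
Proof.
by case: algA => _ A1 Al _; have := Al (-1) 1 1 A1 A1; rewrite scaleN1r addNr.
Qed.

Lemma subalgZ a S : A S -> A (a *: S).
Proof. by case: algA => _ _ Al _ AS; have := Al a S 0 AS subalg0; rewrite addr0. Qed.

Lemma subalgD S T : A S -> A T -> A (S + T).
Proof. by case: algA => _ _ Al _ AS AT; have := Al 1 S T AS AT; rewrite scale1r. Qed.

Lemma subalgB S T : A S -> A T -> A (S - T).
Proof.
by case: algA => _ _ Al _ AS AT; have := Al (-1) T S AT AS; rewrite scaleN1r addrC.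
Qed.

Lemma subalg_sum (I : Type) (r : seq I) (F : I -> bop H) :
  (forall i, A (F i)) -> A (\sum_(i <- r) F i).
Proof.
move=> AF; elim/big_rec: _ => [|i S _ AS]; first exact: subalg0.
exact: subalgD.
Qed.

Lemma subalg_prod (I : Type) (r : seq I) (F : I -> bop H) :
  (forall i, A (F i)) -> A (\prod_(i <- r) F i).
Proof.
case: algA => _ A1 _ AM AF; elim/big_rec: _ => [|i S _ AS] //; exact: AM.
Qed.

Lemma subalgX S N : A S -> A (S ^+ N).
Proof.
case: algA => _ A1 _ AM AS; elim: N => [|N IHN]; first by rewrite expr0.
by rewrite exprS; apply: AM.
Qed.

Section one_character.
Variable X : bop H -> R[i].
Hypothesis charX : character A X.

Lemma character0 : X 0 = 0.
Proof.
case: charX => X1 Xl _; case: algA => _ A1 _ _.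
by have := Xl (-1) 1 1 A1 A1; rewrite scaleN1r addNr X1 mulN1r addNr.
Qed.

Lemma characterZ a S : A S -> X (a *: S) = a * X S.
Proof.
case: charX => _ Xl _ AS.
by have := Xl a S 0 AS subalg0; rewrite !addr0 character0 addr0.
Qed.

Lemma characterB S T : A S -> A T -> X (S - T) = X S - X T.
Proof.
case: charX => _ Xl _ AS AT.
by have := Xl (-1) T S AT AS; rewrite scaleN1r addrC mulN1r [RHS]addrC.
Qed.

Lemma character_sum (I : Type) (r : seq I) (F : I -> bop H) :
  (forall i, A (F i)) -> X (\sum_(i <- r) F i) = \sum_(i <- r) X (F i).
Proof.
move=> AF; elim: r => [|i r IHr]; first by rewrite !big_nil character0.
case: charX => _ Xl _; rewrite !big_cons -IHr.
by have := Xl 1 _ _ (AF i) (subalg_sum r AF); rewrite scale1r mul1r.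
Qed.

Lemma character_prod (I : Type) (r : seq I) (F : I -> bop H) :
  (forall i, A (F i)) -> X (\prod_(i <- r) F i) = \prod_(i <- r) X (F i).
Proof.
case: charX => X1 _ XM AF; elim: r => [|i r IHr]; first by rewrite !big_nil.
by rewrite !big_cons -IHr XM //; exact: subalg_prod.
Qed.

Lemma bop_rnorm1 : rnorm (1 : bop H) <= 1.
Proof. by apply: bop_rnorm_le => // x; rewrite bop1 mul1r. Qed.

Lemma bop_rnormX (S : bop H) N : rnorm (S ^+ N) <= rnorm S ^+ N.
Proof.
elim: N => [|N IHN]; first by rewrite !expr0 bop_rnorm1.
rewrite !exprS; apply: le_trans (bop_rnormM _ _) _.
by rewrite ler_wpM2l ?rnorm_ge0.
Qed.

(** The partial sums of the geometric series are Cauchy in norm, and their limit stays in A because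
    A is closed. *)
Lemma neumann S : A S -> rnorm S < 1 -> exists2 U, A U & (1 - S) * U = 1.
Proof.
case: algA => cA A1 Al AM AS S1; set q := rnorm S in S1.
have q0 : 0 <= q by exact: rnorm_ge0.
have q10 : 0 < 1 - q by rewrite subr_gt0.
have qcvg e : 0 < e -> exists N, forall n, (N <= n)%N -> q ^+ n < e.
  move=> e0; have /cvgrPdist_lt/(_ _ e0)[N _ HN] : (fun n => q ^+ n) @ \oo --> (0 : R).
    by apply: cvg_expr; rewrite ger0_norm.
  by exists N => n Nn; have := HN n Nn; rewrite /= sub0r normrN ger0_norm ?exprn_ge0.
pose u N := \sum_(0 <= n < N) S ^+ n.
have uA N : A (u N) by apply: subalg_sum => i; exact: subalgX.
have uE N : (1 - S) * u N = 1 - S ^+ N.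
  elim: N => [|N IHN]; first by rewrite /u big_nil mulr0 expr0 subrr.
  rewrite /u big_nat_recr //= -/(u N) mulrDr IHN mulrBl mul1r -exprS.
  by rewrite addrA subrK.
have ud m n : (n <= m)%N -> rnorm (u m - u n) <= q ^+ n / (1 - q).
  move=> nm; rewrite /u (big_cat_nat _ nm) //= addrAC subrr add0r.
  apply: le_trans (rnorm_sum _ _ _) _.
  apply: (@le_trans _ _ (\sum_(n <= i < m) q ^+ i)).
    by apply: ler_sum => i _; exact: bop_rnormX.
  rewrite ler_pdivlMr //; suff -> : (\sum_(n <= i < m) q ^+ i) * (1 - q) = q ^+ n - q ^+ m.
    by rewrite gerBl exprn_ge0.
  rewrite -(subnKC nm); elim: (m - n)%N => [|p IHp].
    by rewrite addn0 big_geq // mul0r subrr.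
  by rewrite addnS big_nat_recr ?leq_addr //= mulrDl IHp exprS; ring.
have [e e0|U HU] := @bop_limit R H u.
  have [N HN] := qcvg (e * (1 - q)) (mulr_gt0 e0 q10).
  have h m n : (N <= n)%N -> (n <= m)%N -> rnorm (u m - u n) < e.
    move=> Nn nm; apply: le_lt_trans (ud _ _ nm) _.
    by rewrite ltr_pdivrMr // HN.
  exists N => m n Nm Nn; case: (leqP n m) => [|/ltnW] nm; first exact: h.
  by rewrite rnormB h.
exists U.
  apply: ((closed_rnormP A).1 cA) => e e0.
  have e20 : 0 < e / 2 by rewrite divr_gt0.
  have [N HN] := HU _ e20; exists (u N) => //.
  by apply: le_lt_trans (HN N (leqnn N)) _; lra.
apply/eqP; rewrite -subr_eq0; apply/eqP/rnorm_le0 => e e0.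
pose K := rnorm (1 - S) + 1.
have K0 : 0 < K by rewrite ltr_wpDl ?rnorm_ge0.
have [N1 HN1] := HU (e / 2 / K) (divr_gt0 (divr_gt0 e0 (ltr0Sn _ 1)) K0).
have [N2 HN2] := qcvg (e / 2) (divr_gt0 e0 (ltr0Sn _ 1)).
pose N := maxn N1 N2.
have -> : (1 - S) * U - 1 = - ((1 - S) * (u N - U) + S ^+ N).
  by rewrite mulrBr uE; set Y := (1 - S) * U; rewrite addrAC subrK opprB.
rewrite rnormN; apply: le_trans (rnormD _ _) _.
rewrite (splitr e); apply: lerD; last first.
  by apply: le_trans (bop_rnormX _ _) _; rewrite ltW // HN2 // leq_maxr.
apply: le_trans (bop_rnormM _ _) _.
apply: (@le_trans _ _ (K * (e / 2 / K))); last by rewrite mulrC mulfVK // gt_eqF.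
apply: ler_pM; rewrite ?rnorm_ge0 ?lerDl //; exact/HN1/leq_maxl.
Qed.

(** If X S exceeded the norm of S, then 1 - S / X S would have a right inverse in A by [neumann],
    although X sends it to 0. *)
Lemma character_contractive S : A S -> rnorm (X S) <= rnorm S.
Proof.
move=> AS; rewrite leNgt; apply/negP => SX.
have XS0 : 0 < rnorm (X S) by apply: le_lt_trans SX; exact: rnorm_ge0.
have XS : X S != 0 by rewrite -rnorm_gt0.
have [||U AU US] := @neumann ((X S)^-1 *: S).
- exact: subalgZ.
- by rewrite rnormZ rnormV mulrC ltr_pdivrMr // mul1r.
case: charX => X1 _ XM; case: algA => _ A1 _ _.
have := congr1 X US; rewrite XM ?characterB ?characterZ //.
- by rewrite X1 mulVf // subrr mul0r => /eqP; rewrite eq_sym oner_eq0.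
- exact: subalgZ.
- by apply: subalgB => //; exact: subalgZ.
Qed.

End one_character.
End characters.

(** * Entries and monomials of points *)

Section scalar_points.
Variables (R : realType) (k : nat) (n : 'I_k -> nat).
Implicit Types z : 'rV[R[i]]_(\sum_i n i).

Lemma entryE (A : Type) (z : 'rV[A]_(\sum_i n i)) i (j : 'I_(n i)) :
  entry z j = z ord0 (tagnat.Rank i j).
Proof. by rewrite /entry /submxrow !mxE. Qed.

Lemma entryZ a z i (j : 'I_(n i)) : entry (a *: z) j = a * entry z j.
Proof. by rewrite !entryE !mxE. Qed.

Lemma entryD z z' i (j : 'I_(n i)) : entry (z + z') j = entry z j + entry z' j.
Proof. by rewrite !entryE !mxE. Qed.

Lemma entryB z z' i (j : 'I_(n i)) : entry (z - z') j = entry z j - entry z' j.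
Proof. by rewrite !entryE !mxE. Qed.

Lemma entry_mxrow (c : forall i, 'I_(n i) -> R[i]) i (j : 'I_(n i)) :
  entry (\mxrow_(i < k) \row_(j < n i) c i j) j = c i j.
Proof. by rewrite /entry mxrowK mxE. Qed.

Lemma entryP z z' : (forall i (j : 'I_(n i)), entry z j = entry z' j) -> z = z'.
Proof.
move=> zz'; rewrite -[z]submxrowK -[z']submxrowK; apply: eq_mxrow => i.
by apply/rowP => j; exact: zz'.
Qed.

Lemma wentryE z i (al : seq 'I_(n i)) : wentry z al = \prod_(j <- al) entry z j.
Proof. by []. Qed.

Lemma rnorm_wentry z i (al : seq 'I_(n i)) :
  rnorm (wentry z al) ^+ 2 = \prod_(j <- al) rnorm (entry z j) ^+ 2.
Proof. by rewrite wentryE rnorm_prod prodrXl. Qed.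

Lemma wentryZ a z i (al : seq 'I_(n i)) :
  wentry (a *: z) al = a ^+ size al * wentry z al.
Proof.
rewrite !wentryE; elim: al => [|j al IHal]; first by rewrite !big_nil expr0 mul1r.
by rewrite !big_cons IHal entryZ /= exprS mulrACA.
Qed.

End scalar_points.

(** * The vectors Gamma at strict points as joint eigenvectors of the adjoints *)

Section strict_domain.
Variables (R : realType) (k : nat) (n m : 'I_k -> nat).
Variable f : forall i : 'I_k, prfh R (n i).
Hypothesis m_gt0 : forall i, (0 < m i)%N.
Implicit Types (z : 'rV[R[i]]_(\sum_i n i)) (be ga : multiword n) (x : fock R n).

Local Notation b i := (bcoef (f i) (m i)).

Let b_gt0 i w : 0 < b i w.
Proof. exact: bcoef_gt0. Qed.

Lemma sradius_ge0 z i : (0 <= sradius f z i)%E.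
Proof. by apply: esum_ge0 => al _; rewrite lee_fin mulr_ge0 ?coef_ge0 ?sqr_ge0. Qed.

Lemma sradiusE z i :
  sradius f z i = (\esum_(al in setT) (f i al * rnorm (wentry z al) ^+ 2)%:E)%E.
Proof.
rewrite /sradius [LHS]esum_mkcond; apply: eq_esum => al _.
case: al => [|j al]; first by rewrite memNset // coef_nil mul0r.
by rewrite mem_set.
Qed.

Lemma sradius_mono z z' i :
  (forall j : 'I_(n i), rnorm (entry z j) <= rnorm (entry z' j)) ->
  (sradius f z i <= sradius f z' i)%E.
Proof.
move=> zz'; apply: le_esum => al _; rewrite lee_fin ler_wpM2l ?coef_ge0 //.
rewrite !rnorm_wentry; apply: ler_prod => j _.
by rewrite sqr_ge0 /= ler_sqr ?nnegrE ?rnorm_ge0.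
Qed.

(** Only nonempty words occur, so every term gains at least the factor r^2. *)
Lemma sradius_scale z i (r : R) : 0 <= r <= 1 ->
  (sradius f (r%:C *: z) i <= (r ^+ 2)%:E * sradius f z i)%E.
Proof.
move=> /andP[r0 r1]; rewrite /sradius -esumZ ?sqr_ge0 //; last first.
  by move=> al; rewrite mulr_ge0 ?coef_ge0 ?sqr_ge0.
apply: le_esum => al /= al0; rewrite lee_fin [leRHS]mulrCA ler_wpM2l ?coef_ge0 //.
rewrite wentryZ rnormM exprMn ler_wpM2r ?sqr_ge0 //.
rewrite -rmorphXn rnorm_real ger0_norm ?exprn_ge0 // -exprM.
by rewrite ler_wiXn2l // leq_pmull.
Qed.

Lemma strict_scale z (r : R) : scalar_domain f z -> 0 <= r < 1 ->
  scalar_domain_strict f (r%:C *: z).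
Proof.
move=> Dz /andP[r0 r1] i.
have rr : 0 <= r <= 1 by rewrite r0 ltW.
apply: le_lt_trans (sradius_scale _ _ rr) _.
apply: (@le_lt_trans _ _ ((r ^+ 2)%:E * 1)%E).
  by apply: lee_wpmul2l; [rewrite lee_fin sqr_ge0|exact: Dz].
by rewrite mule1 lte_fin expr_lt1.
Qed.

Lemma strict_domainW z : scalar_domain_strict f z -> scalar_domain f z.
Proof. by move=> Dz i; exact/ltW/Dz. Qed.

Let u z i : R := fine (sradius f z i).

Let sradius_fine z i : scalar_domain_strict f z -> sradius f z i = (u z i)%:E.
Proof.
move=> Dz; rewrite fineK // ge0_fin_numE ?sradius_ge0 //.
exact: lt_trans (Dz i) (ltry _).
Qed.

Let u_lt1 z i : scalar_domain_strict f z -> u z i < 1.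
Proof. by move=> Dz; rewrite -lte_fin -sradius_fine. Qed.

Definition vfun z be : R[i] :=
  \prod_i ((wentry z (be i))^* * (Num.sqrt (b i (be i)))%:C).

Let g z i (w : seq 'I_(n i)) := b i w * rnorm (wentry z w) ^+ 2.

Let g_ge0 z i w : 0 <= @g z i w.
Proof. by rewrite mulr_ge0 ?sqr_ge0 ?(ltW (b_gt0 _)). Qed.

Let vfun_sqr z be : rnorm (vfun z be) ^+ 2 = \prod_(i < k) g z (be i).
Proof.
rewrite /vfun rnorm_prod -prodrXl; apply: eq_bigr => i _.
rewrite rnormM rnormC rnorm_real ger0_norm ?sqrtr_ge0 // exprMn mulrC.
by rewrite sqr_sqrtr ?(ltW (b_gt0 _)).
Qed.

Let g_sum z i : scalar_domain_strict f z ->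
  (\esum_(w in setT) (@g z i w)%:E = ((1 - u z i) ^- m i)%:E)%E.
Proof.
move=> Dz; have := sradius_fine i Dz; rewrite sradiusE.
under eq_esum do rewrite rnorm_wentry.
move=> h; rewrite -(esum_bcoef _ (m_gt0 i) (u_lt1 i Dz) h) //.
  by apply: eq_esum => w _; rewrite /g rnorm_wentry.
by move=> j; exact: sqr_ge0.
Qed.

Lemma vfun_sqsummable z : scalar_domain_strict f z ->
  vfun z \in @sqsummable R (multiword n).
Proof.
move=> Dz; apply: (@sqsummable_le _ _ _ (\prod_i (1 - u z i) ^- m i)) => J.
under [leLHS]eq_bigr do rewrite vfun_sqr.
by apply: multiword_sum_le => [i w|i]; [exact: g_ge0|exact: g_sum].
Qed.

(** Gamma without its normalising factor. The default 0 is taken when the coordinates are not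
    square-summable, which does not happen at strict points. *)
Definition vvec z : fock R n := insubd (0 : fock R n) (vfun z).

Lemma vvecE z be : scalar_domain_strict f z -> vvec z be = vfun z be.
Proof. by move=> Dz; rewrite /vvec val_insubd vfun_sqsummable. Qed.

(** In each factor the squares sum to (1 - f_i)^(-m_i) evaluated at the squared moduli of the
    entries. This is what [pref] normalises. *)
Lemma vvec_norm z : scalar_domain_strict f z ->
  rnorm (vvec z) ^+ 2 = \prod_i (1 - u z i) ^- m i.
Proof.
move=> Dz; apply/eqP; rewrite eq_le; apply/andP; split.
  apply: ell2_sqr_le => J; under [leLHS]eq_bigr do rewrite vvecE // vfun_sqr.
  by apply: multiword_sum_le => [i w|i]; [exact: g_ge0|exact: g_sum].
apply: (multiword_sum_ge (g := fun i => @g z i)) => [i w|i|J]; first exact: g_ge0.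
  exact: g_sum.
apply: le_trans (ell2_sum_le (vvec z) J).
by under [leRHS]eq_bigr do rewrite vvecE // vfun_sqr.
Qed.

Definition pref z : R := \prod_i ((1 - u z i) `^ ((m i)%:R / 2)).

Lemma gamma_vecE z : scalar_domain_strict f z ->
  gamma_vec f m z = (pref z)%:C *: vvec z.
Proof.
move=> Dz; congr (_ *: _); rewrite /summability.sum.
apply: cvg_lim; first exact: norm_hausdorff.
rewrite (_ : summability.partial_sum _ =
  fun J => \sum_(be <- J) vvec z be *: ell2_basis R be); first exact: ell2_approx.
apply/funext => J; rewrite psumE; apply: eq_bigr => be _.
by rewrite vvecE.
Qed.

Lemma gamma_vec_norm z : scalar_domain_strict f z -> rnorm (gamma_vec f m z) = 1.
Proof.
move=> Dz; apply/eqP; rewrite -(@eqrXn2 _ 2) ?rnorm_ge0 // expr1n.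
rewrite gamma_vecE // rnormZ rnorm_real exprMn vvec_norm // real_normK ?num_real //.
rewrite /pref -prodrXl -big_split /= big1 // => i _.
have u10 : 0 < 1 - u z i by rewrite subr_gt0 u_lt1.
rewrite -powR_mulrn ?powR_ge0 // -powRrM mulfVK ?pnatr_eq0 // powR_mulrn ?(ltW u10) //.
by rewrite mulfV // expf_neq0 // gt_eqF.
Qed.

(** Coordinate form of the eigenvector equation for the adjoint of W_{i,j}: the shift weight
    replaces sqrt b_(j be) by sqrt b_be. *)
Lemma vfun_upd z be i (j : 'I_(n i)) :
  vfun z (upd be (j :: be i)) * (shift_weight m f [:: j] be)%:C =
  (entry z j)^* * vfun z be.
Proof.
rewrite /vfun (bigD1 i) //= [in RHS](bigD1 i) //= upd_in.
under eq_bigr => i' ii' do rewrite upd_out 1?eq_sym //.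
set P := \prod_(i0 | _) _.
rewrite wentryE big_cons rmorphM /= -!wentryE /shift_weight /=.
have -> : Num.sqrt (b i (be i)) =
    Num.sqrt (b i (j :: be i)) * Num.sqrt (b i (be i) / b i (j :: be i)).
  rewrite -sqrtrM ?(ltW (b_gt0 _)) // mulrCA mulfV ?mulr1 //.
  by rewrite gt_eqF.
by rewrite rmorphM /=; ring.
Qed.

Lemma umodel_eigen z i (j : 'I_(n i)) x : scalar_domain_strict f z ->
  ip (umodel f m j x) (gamma_vec f m z) = entry z j * ip x (gamma_vec f m z).
Proof.
move=> Dz; apply: bop_ip_ext => be; rewrite gamma_vecE // !ipZr.
rewrite umodelE // ipZl [RHS]mulrCA; congr (_ * _).
have h ga : ip (ell2_basis R ga) (vvec z) = (vfun z ga)^*.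
  by rewrite ipC ell2_ip_basis vvecE.
rewrite !h -[X in _ = X * _]conjCK -rmorphM -vfun_upd rmorphM /= conjCR.
by rewrite mulrC.
Qed.

End strict_domain.

(** * Points of the scalar domain as characters of the polydomain algebra *)

Section polydomain_characters.
Variables (R : realType) (k : nat) (n m : 'I_k -> nat).
Variable f : forall i : 'I_k, prfh R (n i).
Hypothesis m_gt0 : forall i, (0 < m i)%N.
Implicit Types (z : 'rV[R[i]]_(\sum_i n i)) (T S : bop (fock R n)).

Local Notation A := (polydomain_algebra f m).

Lemma polydomain_subalgebra : closed_subalgebra A.
Proof.
split.
- by apply: closed_bigI => B [[]].
- by move=> B [[]].
- move=> a S T AS AT B BP; have [[_ _ Bl _] _] := BP.
  by apply: Bl; [exact: AS|exact: AT].
- move=> S T AS AT B BP; have [[_ _ _ BM] _] := BP.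
  by apply: BM; [exact: AS|exact: AT].
Qed.

Lemma polydomain_gen i (j : 'I_(n i)) : A (umodel f m j).
Proof. by apply: sub_gen_smallest; exists i, j. Qed.

(** Induction over the generated closed algebra, norm limits being the first case. Membership is
    carried along so that contractivity of characters is available in each case. *)
Lemma polydomain_ind (P : bop (fock R n) -> Prop) :
  (forall T, A T -> (forall e : R, 0 < e ->
    exists S, [/\ A S, P S & rnorm (S - T) < e]) -> P T) ->
  P 1 ->
  (forall a S T, A S -> A T -> P S -> P T -> P (a *: S + T)) ->
  (forall S T, A S -> A T -> P S -> P T -> P (S * T)) ->
  (forall i (j : 'I_(n i)), P (umodel f m j)) ->
  forall T, A T -> P T.
Proof.
move=> Pc P1 Pl PM Pg T AT; have [cA A1 Al AM] := polydomain_subalgebra.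
suff : A `<=` [set T | A T /\ P T] by move=> /(_ T AT) [].
apply: smallest_sub => /=; last first.
  by move=> _ [i [j ->]]; split; [exact: polydomain_gen|exact: Pg].
split => //.
- apply/closed_rnormP => U HU; have AU : A U.
    by apply: ((closed_rnormP A).1 cA) => e e0; have [S [AS _] SU] := HU e e0; exists S.
  split => //; apply: Pc => // e e0; have [S [AS PS] SU] := HU e e0.
  by exists S.
- by move=> a S U [AS PS] [AU PU]; split; [exact: Al|exact: Pl].
- by move=> S U [AS PS] [AU PU]; split; [exact: AM|exact: PM].
Qed.

Lemma berezin_eigen z T x : scalar_domain_strict f z -> A T ->
  ip (T x) (gamma_vec f m z) = berezin f m z T * ip x (gamma_vec f m z).
Proof.
move=> Dz AT; move: T AT x; set ga := gamma_vec f m z.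
have ga1 : rnorm ga = 1 by exact: gamma_vec_norm.
have gaga : ip ga ga = 1 by rewrite ip_rnorm ga1 expr1n.
(* Since Gamma is a unit vector, any eigenvalue is the Berezin transform; it remains to know that
   some eigenvalue exists. *)
have bE T c : (forall x, ip (T x) ga = c * ip x ga) -> berezin f m z T = c.
  by move=> Tc; rewrite /berezin Tc gaga mulr1.
have ipl x : rnorm (ip x ga) <= rnorm x.
  by apply: le_trans (cauchy_schwarz _ _) _; rewrite ga1 mulr1.
apply: polydomain_ind => [T AT HT x||a S T AS AT HS HT x|S T AS AT HS HT x|i j x].
- apply/eqP; rewrite -subr_eq0; apply/eqP/rnorm_le0 => e e0.
  pose K := 2 * rnorm x + 1.
  have K0 : 0 < K by rewrite ltr_wpDl // mulr_ge0 ?rnorm_ge0.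
  have [S [_ HS /ltW ST]] := HT (e / K) (divr_gt0 e0 K0).
  have -> : ip (T x) ga - berezin f m z T * ip x ga =
      berezin f m z (S - T) * ip x ga - ip ((S - T) x) ga.
    by rewrite /berezin !bopB !ipBl HS -/(berezin f m z S) mulrBl; ring.
  apply: le_trans (rnormB_le _ _) _.
  apply: (@le_trans _ _ (K * rnorm (S - T))); last first.
    by rewrite mulrC -ler_pdivlMr.
  have h1 : rnorm (ip ((S - T) x) ga) <= rnorm (S - T) * rnorm x.
    by apply: le_trans (ipl _) _; exact: bop_le.
  have h2 : rnorm (berezin f m z (S - T) * ip x ga) <= rnorm (S - T) * rnorm x.
    rewrite rnormM ler_pM ?rnorm_ge0 ?ipl //.
    by apply: le_trans (ipl _) _; apply: le_trans (bop_le _ _) _; rewrite ga1 mulr1.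
  by move: h1 h2 (rnorm_ge0 (S - T)); rewrite /K; lra.
- move=> x; have h y : ip ((1 : bop (fock R n)) y) ga = 1 * ip y ga by rewrite mul1r.
  have e1 : berezin f m z 1 = 1 by apply: bE => y; exact: h.
  by rewrite e1; exact: h.
- have h y : ip ((a *: S + T) y) ga =
      (a * berezin f m z S + berezin f m z T) * ip y ga.
    by rewrite bopD bopZ ipDl ipZl HS HT mulrDl mulrA.
  by rewrite h (bE _ _ h).
- have h y : ip ((S * T) y) ga = (berezin f m z S * berezin f m z T) * ip y ga.
    by rewrite bopM HS HT mulrA.
  by rewrite h (bE _ _ h).
- have h y := umodel_eigen m_gt0 j y Dz.
  by rewrite -/ga in h; rewrite h (bE _ _ h).
Qed.

Lemma berezin_character z : scalar_domain_strict f z -> character A (berezin f m z).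
Proof.
move=> Dz; have ga1 := gamma_vec_norm m_gt0 Dz; split => [|a S T AS AT|S T AS AT].
- by rewrite /berezin bop1 ip_rnorm ga1 expr1n.
- by rewrite /berezin bopD bopZ ipDl ipZl.
- by rewrite {1}/berezin bopM berezin_eigen.
Qed.

Lemma berezin_umodel z i (j : 'I_(n i)) : scalar_domain_strict f z ->
  berezin f m z (umodel f m j) = entry z j.
Proof.
move=> Dz; rewrite /berezin umodel_eigen // ip_rnorm gamma_vec_norm //.
by rewrite expr1n mulr1.
Qed.

Lemma umodel_word_mem i (al : seq 'I_(n i)) : A (umodel_word m f al).
Proof. by apply: (subalg_prod polydomain_subalgebra) => j; exact: polydomain_gen. Qed.

(** For a finite partial sum s of the radius, the operator S = sum of a_al conj(z_al) W_al satisfies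
    X S = s, while [row_contraction] bounds its squared norm by s. Contractivity gives s^2 <= s,
    hence s <= 1. *)
Lemma character_domain (X : bop (fock R n) -> R[i]) z : character A X ->
  (forall i (j : 'I_(n i)), X (umodel f m j) = entry z j) -> scalar_domain f z.
Proof.
move=> cX Xz i; have algA := polydomain_subalgebra.
apply: ge_ereal_sup => _ [F [finF _] <-].
rewrite fsbig_finite //= sumEFin lee_fin.
set J := fset_set F; set s := \sum_(al <- J) _.
have s0 : 0 <= s by apply: sumr_ge0 => al _; rewrite mulr_ge0 ?coef_ge0 ?sqr_ge0.
pose S : bop (fock R n) := \sum_(al <- J) ((f i al)%:C * (wentry z al)^*) *: umodel_word m f al.
have AS : A S.
  by apply: (subalg_sum algA) => al; apply: (subalgZ algA); exact: umodel_word_mem.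
have XS : X S = s%:C.
  rewrite (character_sum algA cX) => [|al]; last first.
    by apply: (subalgZ algA); exact: umodel_word_mem.
  rewrite rmorph_sum; apply: eq_bigr => al _ /=.
  rewrite (characterZ algA cX); last exact: umodel_word_mem.
  rewrite (character_prod algA cX) => [|j]; last exact: polydomain_gen.
  under eq_bigr do rewrite Xz.
  by rewrite -wentryE -mulrA [_^* * _]mulrC mul_conjC -rmorphM.
have h1 := character_contractive algA cX AS.
have h2 : rnorm S ^+ 2 <= s.
  apply: le_trans (@row_contraction _ _ _ _ f m_gt0 _ J (fun al => (wentry z al)^*)) _.
  by apply: ler_sum => al _; rewrite rnormC.
rewrite XS rnorm_real ger0_norm // in h1.
have {h1}h1 : s ^+ 2 <= s.
  by apply: le_trans h2; rewrite ler_sqr ?nnegrE // rnorm_ge0.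
rewrite leNgt; apply/negP => s1; move: h1; rewrite leNgt => /negP; apply.
by rewrite expr2 ltr_pMr // (lt_trans _ s1).
Qed.

Lemma character_eq (X Y : bop (fock R n) -> R[i]) : character A X -> character A Y ->
  (forall i (j : 'I_(n i)), X (umodel f m j) = Y (umodel f m j)) ->
  forall T, A T -> X T = Y T.
Proof.
move=> cX cY XY; have algA := polydomain_subalgebra.
have [X1 Xl XM] := cX; have [Y1 Yl YM] := cY.
apply: polydomain_ind => [T AT HT||a S T AS AT HS HT|S T AS AT HS HT|i j].
- apply/eqP; rewrite -subr_eq0; apply/eqP/rnorm_le0 => e e0.
  have [S [AS HS ST]] := HT (e / 2) (divr_gt0 e0 (ltr0Sn _ 1)).
  have -> : X T - Y T = Y (S - T) - X (S - T).
    by rewrite (characterB cX) // (characterB cY) // HS; ring.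
  apply: le_trans (rnormB_le _ _) _.
  have AST := subalgB algA AS AT.
  have := character_contractive algA cX AST.
  by have := character_contractive algA cY AST; lra.
- by rewrite X1 Y1.
- by rewrite Xl // Yl // HS HT.
- by rewrite XM // YM // HS HT.
- exact: XY.
Qed.

Section limits.
Variables (I : Type) (F : set_system I) (FF : ProperFilter F).
Variable X : I -> bop (fock R n) -> R[i].
Hypothesis charX : \forall t \near F, character A (X t).

(** Characters are uniformly contractive, hence equicontinuous, so convergence at the generators
    spreads to norm limits. *)
Lemma character_cvg (Y : bop (fock R n) -> R[i]) : character A Y ->
  (forall i (j : 'I_(n i)), X t (umodel f m j) @[t --> F] --> Y (umodel f m j)) ->
  forall T, A T -> X t T @[t --> F] --> Y T.
Proof.
move=> cY XY; have algA := polydomain_subalgebra.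
have [Y1 Yl YM] := cY.
apply: polydomain_ind => [T AT HT||a S T AS AT HS HT|S T AS AT HS HT|i j].
- apply/cvg_rnormP => e e0.
  have e3 : 0 < e / 3 by rewrite divr_gt0.
  have [S [AS HS ST]] := HT (e / 3) e3.
  have AST := subalgB algA AS AT.
  have hY := character_contractive algA cY AST.
  apply: filterS2 charX ((cvg_rnormP _ _ _).1 HS _ e3) => t ct XSt.
  have hX := character_contractive algA ct AST.
  have -> : X t T - Y T = (X t S - Y S) + (Y (S - T) - X t (S - T)).
    by rewrite (characterB ct) // (characterB cY) //; ring.
  apply: le_lt_trans (rnormD _ _) _.
  by have := rnormB_le (Y (S - T)) (X t (S - T)); lra.
- apply: (@cvg_trans _ ((fun=> Y 1) @ F)); last exact: cvg_cst.
  by apply: near_eq_cvg; apply: filterS charX => t [X1 _ _]; rewrite X1 Y1.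
- rewrite (Yl _ _ _ AS AT); have h : a * X t S + X t T @[t --> F] --> a * Y S + Y T.
    by apply: cvgD; [apply: cvgM; [exact: cvg_cst|exact: HS]|exact: HT].
  apply: cvg_trans h; apply: near_eq_cvg; apply: filterS charX => t [_ Xl _].
  by rewrite Xl.
- rewrite (YM _ _ AS AT); have h : X t S * X t T @[t --> F] --> Y S * Y T.
    by apply: cvgM; [exact: HS|exact: HT].
  apply: cvg_trans h; apply: near_eq_cvg; apply: filterS charX => t [_ _ XM].
  by rewrite XM.
- exact: XY.
Qed.

(** The same argument in Cauchy form, for use before a limit character is known; four errors occur,
    hence e / 4. *)
Lemma character_is_cvg :
  (forall i (j : 'I_(n i)), cvg (X t (umodel f m j) @[t --> F])) ->
  forall T, A T -> cvg (X t T @[t --> F]).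
Proof.
move=> Xg; have algA := polydomain_subalgebra.
apply: polydomain_ind => [T AT HT||a S T AS AT HS HT|S T AS AT HS HT|i j].
- apply/cvg_ex; apply: complex_cauchy_cvg => e e0.
  have e4 : 0 < e / 4 by rewrite divr_gt0.
  have [S [AS HS ST]] := HT (e / 4) e4.
  have AST := subalgB algA AS AT.
  pose B := [set t | character A (X t) /\ rnorm (X t S - lim (X t S @[t --> F])) < e / 4].
  exists [set X t T | t in B].
    apply: (filterS (P := B)) => [t Bt|]; first by exists t.
    exact: filterS2 charX ((cvg_rnormP _ _ _).1 HS _ e4).
  move=> _ _ [t [ct tS] <-] [t' [ct' tS'] <-].
  have hX := character_contractive algA ct AST.
  have hX' := character_contractive algA ct' AST.
  set l := lim _ in tS tS'.
  have -> : X t T - X t' T = ((X t S - l) - (X t' S - l)) +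
      (X t' (S - T) - X t (S - T)).
    by rewrite (characterB ct) // (characterB ct') //; ring.
  apply: le_lt_trans (rnormD _ _) _.
  have := rnormB_le (X t' (S - T)) (X t (S - T)).
  by have := rnormB_le (X t S - l) (X t' S - l); lra.
- apply: cvgP; apply: (@cvg_trans _ ((fun=> 1 : R[i]) @ F)); last exact: cvg_cst.
  by apply: near_eq_cvg; apply: filterS charX => t [X1 _ _]; rewrite X1.
- pose lS := lim (X t S @[t --> F]); pose lT := lim (X t T @[t --> F]).
  have h : a * X t S + X t T @[t --> F] --> a * lS + lT.
    by apply: cvgD; [apply: cvgM; [exact: cvg_cst|exact: HS]|exact: HT].
  apply: cvgP; apply: cvg_trans h; apply: near_eq_cvg.
  by apply: filterS charX => t [_ Xl _]; rewrite Xl.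
- pose lS := lim (X t S @[t --> F]); pose lT := lim (X t T @[t --> F]).
  have h : X t S * X t T @[t --> F] --> lS * lT.
    by apply: cvgM; [exact: HS|exact: HT].
  apply: cvgP; apply: cvg_trans h; apply: near_eq_cvg.
  by apply: filterS charX => t [_ _ XM]; rewrite XM.
- exact: Xg.
Qed.

Lemma character_lim : (forall T, A T -> cvg (X t T @[t --> F])) ->
  character A (fun T => lim (X t T @[t --> F])).
Proof.
move=> XT; split => [|a S T AS AT|S T AS AT]; apply: cvg_lim => //.
- apply: (@cvg_trans _ ((fun=> 1 : R[i]) @ F)); last exact: cvg_cst.
  by apply: near_eq_cvg; apply: filterS charX => t [X1 _ _]; rewrite X1.
- have h : a * X t S + X t T @[t --> F] -->
      a * lim (X t S @[t --> F]) + lim (X t T @[t --> F]).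
    by apply: cvgD; [apply: cvgM; [exact: cvg_cst|exact: XT]|exact: XT].
  apply: cvg_trans h; apply: near_eq_cvg.
  by apply: filterS charX => t [_ Xl _]; rewrite Xl.
- have h : X t S * X t T @[t --> F] -->
      lim (X t S @[t --> F]) * lim (X t T @[t --> F]).
    by apply: cvgM; exact: XT.
  apply: cvg_trans h; apply: near_eq_cvg.
  by apply: filterS charX => t [_ _ XM]; rewrite XM.
Qed.

End limits.

(* Locked, since unification would otherwise unfold it when comparing points. *)
Definition chi : 'rV[R[i]]_(\sum_i n i) -> bop (fock R n) -> R[i] :=
  locked (fun z T => lim (berezin f m (r%:C *: z) T @[r --> (1:R)^'-])).

Lemma chiE z : chi z = fun T => lim (berezin f m (r%:C *: z) T @[r --> (1:R)^'-]).
Proof. by rewrite /chi -lock. Qed.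

Lemma near_left1 : \forall r \near (1:R)^'-, 0 <= r < 1.
Proof.
near=> r; apply/andP; split; last by near: r; exact: nbhs_left_lt.
by near: r; apply: nbhs_left_ge; exact: ltr01.
Unshelve. all: by end_near. Qed.

Lemma berezin_near_character z : scalar_domain f z ->
  \forall r \near (1:R)^'-, character A (berezin f m (r%:C *: z)).
Proof.
move=> Dz; apply: filterS near_left1 => r r01.
by apply: berezin_character; exact: strict_scale.
Qed.

Lemma berezin_umodel_cvg z i (j : 'I_(n i)) : scalar_domain f z ->
  berezin f m (r%:C *: z) (umodel f m j) @[r --> (1:R)^'-] --> entry z j.
Proof.
move=> Dz; apply: (@cvg_trans _ ((fun r : R => r%:C * entry z j) @ (1:R)^'-)).
  apply: near_eq_cvg; apply: filterS near_left1 => r r01.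
  by rewrite berezin_umodel ?entryZ //; exact: strict_scale.
suff h : (r%:C * entry z j) @[r --> (1:R)^'-] --> 1 * entry z j by rewrite mul1r in h.
apply: cvgM; last exact: cvg_cst.
apply/cvg_rnormP => e e0; near=> r.
rewrite (_ : 1 = 1%:C) // -rmorphB rnorm_real distrC.
by near: r; apply: cvgr_dist_lt => //; exact: cvg_at_left_filter.
Unshelve. all: by end_near. Qed.

Lemma chi_is_cvg z T : scalar_domain f z -> A T ->
  cvg (berezin f m (r%:C *: z) T @[r --> (1:R)^'-]).
Proof.
move=> Dz AT; apply: (@character_is_cvg _ _ (at_left_proper_filter 1)
  (fun r : R => berezin f m (r%:C *: z))) => //; first exact: berezin_near_character.
by move=> i j; apply: cvgP; exact: berezin_umodel_cvg.
Qed.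

Lemma chi_character z : scalar_domain f z -> character A (chi z).
Proof.
move=> Dz; rewrite chiE; apply: (@character_lim _ _ (at_left_proper_filter 1)
  (fun r : R => berezin f m (r%:C *: z))); first exact: berezin_near_character.
by move=> T AT; exact: chi_is_cvg.
Qed.

Lemma chi_umodel z i (j : 'I_(n i)) : scalar_domain f z ->
  chi z (umodel f m j) = entry z j.
Proof. by move=> Dz; rewrite chiE; apply: cvg_lim => //; exact: berezin_umodel_cvg. Qed.

Lemma chi_unique (X : bop (fock R n) -> R[i]) z : character A X ->
  (forall i (j : 'I_(n i)), X (umodel f m j) = entry z j) ->
  forall T, A T -> X T = chi z T.
Proof.
move=> cX Xz; have Dz := character_domain cX Xz.
apply: character_eq => //; first exact: chi_character.
by move=> i j; rewrite Xz chi_umodel.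
Qed.

Lemma chi_le z T : scalar_domain f z -> A T -> rnorm (chi z T) <= rnorm T.
Proof.
move=> Dz AT; apply: (character_contractive polydomain_subalgebra) => //.
exact: chi_character.
Qed.

Definition vacuum : multiword n := [ffun i => [::] : seq 'I_(n i)].

(** The eigenvector equation is applied to the vacuum, whose pairing with Gamma is [pref]. This
    nonzero factor cancels, leaving a vector with monomial coordinates. *)
Lemma chi_strict z T : scalar_domain_strict f z -> A T ->
  chi z T = ip (T (ell2_basis R vacuum)) (vvec m f z).
Proof.
move=> Dz AT.
rewrite -(chi_unique (berezin_character Dz) _ AT); last first.
  by move=> i j; rewrite berezin_umodel.
have := berezin_eigen (ell2_basis R vacuum) Dz AT.
have p0 : (pref m f z)%:C != 0 :> R[i].
  rewrite (_ : 0 = 0%:C) // (inj_eq (@complexI _)) /pref gt_eqF //.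
  apply: prodr_gt0 => i _; rewrite powR_gt0 // subr_gt0 -lte_fin fineK; first exact: Dz.
  by rewrite ge0_fin_numE ?sradius_ge0 // (lt_trans (Dz i)) ?ltry.
rewrite gamma_vecE // !ipZr conjCR mulrCA => /(mulfI p0) ->.
rewrite [ip (ell2_basis _ _) _]ipC ell2_ip_basis vvecE // /vfun big1 ?conjC1 ?mulr1 //.
by move=> i _; rewrite ffunE wentryE big_nil conjC1 mul1r /bcoef sqrtr1.
Qed.

Lemma entry_continuous i (j : 'I_(n i)) :
  continuous (fun z => entry z j : R[i]).
Proof.
rewrite (_ : (fun z => _) = (fun z => z ord0 (tagnat.Rank i j))).
  exact: coord_continuous.
by apply/funext => z; rewrite entryE.
Qed.

(** At the generators [chi] is a coordinate; equicontinuity carries continuity over to T, up to the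
    boundary. *)
Lemma chi_continuous T : A T -> {within scalar_domain f, continuous (chi^~ T)}.
Proof.
move=> AT; apply/subspace_continuousP => z Dz.
have FF : ProperFilter (within (scalar_domain f) (nbhs z)).
  by apply: within_nbhs_proper; exact: subset_closure.
have nearD (P : set 'rV[R[i]]_(\sum_i n i)) :
    (forall z', scalar_domain f z' -> P z') ->
    \forall z' \near within (scalar_domain f) (nbhs z), P z'.
  by move=> DP; apply: (filterS DP); exact: withinT.
apply: (@character_cvg _ _ FF chi _ (chi z) _ _ T AT).
- by apply: nearD => z' Dz'; exact: chi_character.
- exact: chi_character.
- move=> i j; rewrite chi_umodel //.
  apply: (@cvg_trans _ ((fun z' => entry z' j) @ within (scalar_domain f) (nbhs z))).
    by apply: near_eq_cvg; apply: nearD => z' Dz'; rewrite chi_umodel.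
  by apply: cvg_within_filter; exact: entry_continuous.
Qed.

End polydomain_characters.

(** * First-order estimates for monomials with an explicit majorant *)

Section monomials.
Variables (R : realType) (T : Type).
Implicit Types (x y l h : T -> R[i]) (s : seq T) (d : R).

(** The directional derivative at l along h of the monomial with letters s, by the Leibniz rule. *)
Fixpoint mon_deriv l h s : R[i] :=
  if s is t :: s' then h t * \prod_(u <- s') l u + l t * mon_deriv l h s' else 0.

Lemma mon_deriv_linear l a h h' s :
  mon_deriv l (fun t => a * h t + h' t) s = a * mon_deriv l h s + mon_deriv l h' s.
Proof.
by elim: s => [|t s IHs] /=; [rewrite mulr0 addr0|rewrite IHs; ring].
Qed.

(** One d pays for a point at distance d from l, the other for the increment in the product rule.
    The same 2 is the point at which [root_average] evaluates its majorant polynomial. *)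
Local Notation rho l d := (fun t => rnorm (l t) + 2 * d).

Lemma rho_prod_ge0 l d s : 0 <= d -> 0 <= \prod_(u <- s) rho l d u.
Proof.
by move=> d0; apply: prodr_ge0 => u; rewrite addr_ge0 ?rnorm_ge0 // mulr_ge0.
Qed.

Lemma mon_le l x d s : 0 <= d -> (forall t, rnorm (x t - l t) <= d) ->
  rnorm (\prod_(u <- s) x u) <= \prod_(u <- s) rho l d u.
Proof.
move=> d0 xl; rewrite rnorm_prod; apply: ler_prod => t _; rewrite rnorm_ge0 /=.
rewrite -(subrK (l t) (x t)) addrC; apply: le_trans (rnormD _ _) _.
by move: (xl t) d0; lra.
Qed.

Lemma mon_lipschitz l x y d (e : R) s : 0 <= d -> 0 <= e ->
  (forall t, rnorm (x t - l t) <= d) -> (forall t, rnorm (y t - l t) <= d) ->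
  (forall t, rnorm (x t - y t) <= e * d) ->
  rnorm (\prod_(u <- s) x u - \prod_(u <- s) y u) <= e * \prod_(u <- s) rho l d u.
Proof.
move=> d0 e0 xl yl xy; elim: s => [|t s IHs].
  by rewrite !big_nil subrr rnorm0 mulr1.
rewrite !big_cons; set X := \prod_(u <- s) x u in IHs *.
set Y := \prod_(u <- s) y u in IHs *; set P := \prod_(u <- s) _ in IHs *.
have -> : x t * X - y t * Y = (x t - y t) * X + y t * (X - Y) by ring.
apply: le_trans (rnormD _ _) _; rewrite !rnormM.
have XP : rnorm X <= P by exact: mon_le.
have yt : rnorm (y t) <= rnorm (l t) + d.
  rewrite -(subrK (l t) (y t)) addrC; apply: le_trans (rnormD _ _) _.
  by rewrite lerD2l.
have h1 : rnorm (x t - y t) * rnorm X <= (e * d) * P.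
  by apply: ler_pM; rewrite ?rnorm_ge0.
have h2 : rnorm (y t) * rnorm (X - Y) <= (rnorm (l t) + d) * (e * P).
  by apply: ler_pM; rewrite ?rnorm_ge0.
by apply: le_trans (lerD h1 h2) _; rewrite le_eqVlt; apply/orP; left; apply/eqP; ring.
Qed.

Lemma mon_deriv_le l h d (e : R) s : 0 <= d -> 0 <= e ->
  (forall t, rnorm (h t) <= e * d) ->
  rnorm (mon_deriv l h s) <= e * \prod_(u <- s) rho l d u.
Proof.
move=> d0 e0 hd; elim: s => [|t s IHs] /=.
  by rewrite rnorm0 big_nil mulr1.
rewrite big_cons; set P := \prod_(u <- s) _ in IHs *.
apply: le_trans (rnormD _ _) _; rewrite !rnormM.
have lP : rnorm (\prod_(u <- s) l u) <= P.
  by apply: mon_le => // u; rewrite subrr rnorm0.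
have P0 : 0 <= P by exact: rho_prod_ge0.
have h1 : rnorm (h t) * rnorm (\prod_(u <- s) l u) <= (e * d) * P.
  by apply: ler_pM; rewrite ?rnorm_ge0.
have h2 : rnorm (l t) * rnorm (mon_deriv l h s) <= rnorm (l t) * (e * P).
  by rewrite ler_wpM2l ?rnorm_ge0.
apply: le_trans (lerD h1 h2) _.
have h3 : 0 <= e * d * P by rewrite !mulr_ge0.
have -> : e * ((rnorm (l t) + 2 * d) * P) =
  (e * d * P + rnorm (l t) * (e * P)) + e * d * P by ring.
by rewrite lerDl.
Qed.

Lemma mon_expansion l x y d (e c : R) s : 0 <= d -> 0 <= e -> 0 <= c <= 1 ->
  (forall t, rnorm (x t - l t) <= c * d) -> (forall t, rnorm (y t - l t) <= c * d) ->
  (forall t, rnorm (x t - y t) <= e * d) ->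
  rnorm (\prod_(u <- s) x u - \prod_(u <- s) y u -
    mon_deriv l (fun t => x t - y t) s) <= e * c * \prod_(u <- s) rho l d u.
Proof.
move=> d0 e0 /andP[c0 c1] xl yl xy.
have cd : c * d <= d by rewrite ler_piMl.
have xl' t : rnorm (x t - l t) <= d by exact: le_trans (xl t) cd.
have yl' t : rnorm (y t - l t) <= d by exact: le_trans (yl t) cd.
elim: s => [|t s IHs] /=; first by rewrite !big_nil !subrr rnorm0 mulr1 mulr_ge0.
rewrite !big_cons; set D := mon_deriv _ _ _ in IHs *.
set X := \prod_(u <- s) x u in IHs *; set Y := \prod_(u <- s) y u in IHs *.
set L := \prod_(u <- s) l u; set P := \prod_(u <- s) _ in IHs *.
(* Besides the inductive remainder, both terms multiply a difference of x and y, of order e, by a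
   deviation from l, of order c. *)
have -> : x t * X - y t * Y - ((x t - y t) * L + l t * D) =
  l t * (X - Y - D) + (x t - y t) * (X - L) + (y t - l t) * (X - Y) by ring.
have ll u : rnorm (l u - l u) <= d by rewrite subrr rnorm0.
have XL : rnorm (X - L) <= c * P by exact: mon_lipschitz.
have XY : rnorm (X - Y) <= e * P by exact: mon_lipschitz.
have h1 : rnorm (l t) * rnorm (X - Y - D) <= rnorm (l t) * (e * c * P).
  by rewrite ler_wpM2l ?rnorm_ge0.
have h2 : rnorm (x t - y t) * rnorm (X - L) <= (e * d) * (c * P).
  by apply: ler_pM; rewrite ?rnorm_ge0.
have h3 : rnorm (y t - l t) * rnorm (X - Y) <= (c * d) * (e * P).
  by apply: ler_pM; rewrite ?rnorm_ge0.
apply: le_trans (rnormD _ _) _; rewrite rnormM.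
apply: le_trans (lerD (le_trans (rnormD _ _) _) (lexx _)) _; first exact: lexx.
rewrite !rnormM; apply: le_trans (lerD (lerD h1 h2) h3) _.
by rewrite le_eqVlt; apply/orP; left; apply/eqP; ring.
Qed.

End monomials.

(** * Averages over roots of unity *)

Section roots_of_unity.
Variable R : realType.

(** X^N - 1 splits and is separable, so it has N distinct roots; a group of N such roots in a field
    is cyclic. *)
Lemma complex_prim_root N : (0 < N)%N -> exists w : R[i], N.-primitive_root w.
Proof.
move=> N0; pose p : {poly R[i]} := 'X^N - 1.
have [r Dp] := closed_field_poly_normal p.
have pm : p \is monic by rewrite monicXnsubC.
rewrite (monicP pm) scale1r in Dp.
have rN : all N.-unity_root r.
  apply/allP => w wr; rewrite unity_rootE.
  have : root p w by rewrite Dp root_prod_XsubC.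
  by rewrite /p rootE !hornerE subr_eq0.
have ru : uniq r.
  rewrite -separable.separable_prod_XsubC -Dp cyclotomic.separable_Xn_sub_1 //.
  by rewrite pnatr_eq0 -lt0n.
have rs : (N <= size r)%N.
  have := congr1 (fun q : {poly R[i]} => size q) Dp.
  by rewrite size_prod_XsubC size_XnsubC // => -[->].
by have /hasP[w _ wN] := cyclic.has_prim_root N0 rN ru rs; exists w.
Qed.

Lemma unity_rnorm N (w : R[i]) : (0 < N)%N -> w ^+ N = 1 -> rnorm w = 1.
Proof.
move=> N0 wN; have := congr1 (@rnorm R _) wN.
have -> : rnorm (w ^+ N) = rnorm w ^+ N.
  by elim: N {N0 wN} => [|N IHN]; rewrite ?expr0 ?rnorm1 // !exprS rnormM IHN.
rewrite rnorm1 => /eqP; rewrite pexpr_eq1 ?rnorm_ge0 //.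
by move=> /eqP.
Qed.

Lemma prim_root_sum N (w : R[i]) p : N.-primitive_root w ->
  \sum_(j < N) (w ^+ p) ^+ j = if (N %| p)%N then N%:R else 0.
Proof.
move=> wN; case: ifPn => [Np|Np].
  have -> : w ^+ p = 1 by apply/eqP; rewrite -(prim_order_dvd wN).
  by under eq_bigr do rewrite expr1n; rewrite sumr_const card_ord.
have w1 : w ^+ p - 1 != 0 by rewrite subr_eq0 -(prim_order_dvd wN).
apply: (mulfI w1); rewrite -subrX1 mulr0 -exprM mulnC exprM (prim_expr_order wN).
by rewrite expr1n subrr.
Qed.

(* Averaging over the N-th roots of unity isolates the coefficients of index
   congruent to 1 modulo N; geometric decay of the rest gives Cauchy's estimate. *)
Lemma root_average (p : {poly R[i]}) (q : {poly R}) N (w : R[i]) :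
  (1 < N)%N -> N.-primitive_root w -> (forall j, rnorm p`_j <= q`_j) ->
  rnorm (N%:R^-1 * (\sum_(j < N) (w ^+ j) ^- 1 * p.[w ^+ j]) - p`_1) <=
  2 ^- N * q.[2].
Proof.
move=> N1 wN pq; have N0 : (0 < N)%N by exact: ltnW.
pose K := (maxn (maxn (size p) (size q)) 2).
have Kp : (size p <= K)%N by rewrite !leq_max leqnn.
have Kq : (size q <= K)%N by rewrite !leq_max leqnn orbT.
have wu : w ^+ N = 1 by exact: prim_expr_order.
have w0 : w != 0 by apply: contra_eq_neq wu => ->; rewrite expr0n gtn_eqF // eq_sym oner_eq0.
(* Inverse powers are rewritten as positive ones, so that all exponents stay natural numbers. *)
have wV j : (w ^+ j)^-1 = w ^+ (N.-1 * j).
  apply: (mulfI (expf_neq0 j w0)); rewrite mulfV ?expf_neq0 // -exprD -mulSn prednK //.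
  by rewrite exprM wu expr1n.
have NC : (N%:R : R[i]) != 0 by rewrite pnatr_eq0 -lt0n.
have -> : N%:R^-1 * (\sum_(j < N) (w ^+ j) ^- 1 * p.[w ^+ j]) =
    \sum_(c < K) (if (N %| N.-1 + c)%N then p`_c else 0).
  apply: (mulfI NC); rewrite mulrA mulfV // mul1r.
  under eq_bigr => j _.
    rewrite (horner_coef_wide _ Kp) expr1 wV big_distrr /=.
    under eq_bigr => c _ do rewrite mulrCA -exprM -exprD -[(j * c)%N]mulnC -mulnDl exprM.
    over.
  rewrite exchange_big /= big_distrr /=; apply: eq_bigr => c _.
  rewrite -big_distrr /= (prim_root_sum _ wN).
  by case: ifP; rewrite ?mulr0 // mulrC.
have K1 : (1 < K)%N by rewrite !leq_max orbT.
rewrite (bigD1 (Ordinal K1)) //= addn1 prednK // dvdnn addrAC subrr add0r.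
apply: le_trans (rnorm_sum _ _ _) _.
rewrite (horner_coef_wide _ Kq) big_distrr /= big_mkcond /=.
apply: ler_sum => c _.
have q0 : 0 <= q`_c by apply: le_trans (pq c); exact: rnorm_ge0.
have rhs0 : 0 <= 2 ^- N * (q`_c * 2 ^+ c).
  by rewrite !mulr_ge0 ?invr_ge0 ?exprn_ge0.
case: eqVneq => //= c1; case: ifPn => [Nc|_]; last by rewrite rnorm0.
apply: le_trans (pq c) _; rewrite mulrCA ler_peMr // mulrC ler_pdivlMr ?exprn_gt0 // mul1r.
rewrite ler_weXn2l ?ler1n //.
(* An index c other than 1 with N dividing N - 1 + c is at least N: c = 0 is excluded by N > 1, and
   the multiple N itself would force c = 1. *)
case: (posnP c) Nc => [->|c0].
  by rewrite addn0 => /dvdn_leq; rewrite -subn1 subn_gt0 => /(_ N1); rewrite leq_subRL ?addn1 ?ltnn // ltnW.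
move=> /dvdnP[[|[|d]]] E.
- by move: E; rewrite mul0n => /eqP; rewrite addn_eq0 => /andP[_ /eqP c00]; rewrite c00 in c0.
- move: E; rewrite mul1n => E; move: c1.
  have : (nat_of_ord c = 1)%N by apply/eqP; rewrite -(eqn_add2l N.-1) E addn1 prednK.
  by move=> c1; rewrite -val_eqE /= c1.
- move: E; rewrite !mulSn => E.
  have : (N.-1 + N <= N.-1 + c)%N by rewrite E leq_add ?leq_pred // leq_addr.
  by rewrite leq_add2l.
Qed.

Variable T : Type.
Implicit Types (l h : T -> R[i]) (s : seq T).

(** The monomial along the line l + X h is a polynomial whose coefficient of X is the derivative.
    The product of |l| + |h| X majorises it coefficientwise, and its value at 2 is at most the
    product of |l| + 2 d. *)
Lemma mon_average l h (d : R) s N (w : R[i]) :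
  (1 < N)%N -> N.-primitive_root w -> (forall t, rnorm (h t) <= d) ->
  rnorm (N%:R^-1 * (\sum_(j < N) (w ^+ j) ^- 1 * \prod_(t <- s) (l t + w ^+ j * h t))
    - mon_deriv l h s) <=
  2 ^- N * \prod_(t <- s) (rnorm (l t) + 2 * d).
Proof.
move=> N1 wN hd.
pose p := \prod_(t <- s) ((l t)%:P + h t *: 'X : {poly R[i]}).
pose q := \prod_(t <- s) ((rnorm (l t))%:P + rnorm (h t) *: 'X : {poly R}).
have cM (K : comRingType) (a b : K) (u : {poly K}) j :
    ((a%:P + b *: 'X) * u)`_j = a * u`_j + b * (if j is j'.+1 then u`_j' else 0).
  by rewrite mulrDl coefD coefCM -scalerAl coefZ coefXM; case: j.
have pq j : rnorm p`_j <= q`_j.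
  rewrite {}/p {}/q; elim: s j => [|t s IHs] j.
    by rewrite !big_nil !coef1; case: (j == _); rewrite ?rnorm1 ?rnorm0.
  rewrite !big_cons !cM; apply: le_trans (rnormD _ _) _; rewrite !rnormM.
  apply: lerD; first by rewrite ler_wpM2l ?rnorm_ge0.
  by case: j => [|j]; rewrite ?rnorm0 // ler_wpM2l ?rnorm_ge0.
have p0 : p`_0 = \prod_(t <- s) l t.
  rewrite /p; elim: (s) => [|t s' IHs]; first by rewrite !big_nil coef1.
  by rewrite !big_cons cM IHs mulr0 addr0.
have p1 : p`_1 = mon_deriv l h s.
  rewrite /p; elim: (s) => [|t s' IHs] /=; first by rewrite !big_nil coef1.
  rewrite !big_cons cM IHs addrC {IHs}; congr (h t * _ + _).
  elim: (s') => [|u s'' IHs']; first by rewrite !big_nil coef1.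
  by rewrite !big_cons cM IHs' mulr0 addr0.
have -> : \sum_(j < N) (w ^+ j) ^- 1 * \prod_(t <- s) (l t + w ^+ j * h t) =
    \sum_(j < N) (w ^+ j) ^- 1 * p.[w ^+ j].
  apply: eq_bigr => j _; congr (_ * _); rewrite horner_prod; apply: eq_bigr => t _.
  by rewrite hornerD hornerC hornerZ hornerX mulrC.
rewrite -p1; apply: le_trans (root_average N1 wN pq) _.
rewrite ler_wpM2l ?invr_ge0 ?exprn_ge0 // horner_prod; apply: ler_prod => t _.
rewrite hornerD hornerC hornerZ hornerX addr_ge0 ?mulr_ge0 ?rnorm_ge0 //=.
by rewrite lerD2l mulrC ler_wpM2l.
Qed.

End roots_of_unity.

(** * The sup norm on rows *)

Section row_norm.
Variable R : realType.

Lemma rnorm_rV_le N (x : 'rV[R[i]]_N) (c : R) : 0 <= c ->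
  (rnorm x <= c) <-> (forall j, rnorm (x ord0 j) <= c).
Proof.
move=> c0; have c0C : 0 <= c%:C :> R[i] by rewrite lecR.
have key : (`|x| <= c%:C) <-> (forall j, `|x ord0 j| <= c%:C).
  rewrite [X in X <= _]/Num.norm /= mx_normE -[c%:C]/((NngNum c0C)%:num) num_le.
  split => [/bigmax_leP[_ h] j|h].
    by have := h (ord0, j) isT; rewrite -num_le.
  apply/bigmax_leP; split => [|[i j] _]; rewrite -num_le //= ord1; exact: h.
split => [xc j|xc].
  by rewrite -lecR rnormE; apply: key.1; rewrite -rnormE lecR.
by rewrite -lecR rnormE; apply/key => j; rewrite -rnormE lecR.
Qed.

Variables (k : nat) (n : 'I_k -> nat).
Implicit Types x z : 'rV[R[i]]_(\sum_i n i).

Lemma rnorm_entry_le x (c : R) : 0 <= c ->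
  (rnorm x <= c) <-> (forall i (j : 'I_(n i)), rnorm (entry x j) <= c).
Proof.
move=> c0; rewrite (rnorm_rV_le x c0); split => [h i j|h j].
  by rewrite entryE.
have [i [j' ->]] : exists i, exists j' : 'I_(n i), j = tagnat.Rank i j'.
  by exists (tagnat.sig1 j), (tagnat.sig2 j); rewrite tagnat.sig2K.
by rewrite -entryE.
Qed.

Lemma entry_le x i (j : 'I_(n i)) : rnorm (entry x j) <= rnorm x.
Proof. by move: i j; apply/rnorm_entry_le => //; exact: rnorm_ge0. Qed.

End row_norm.

(** * Expansion of the transforms and Cauchy's estimate at an interior point *)

Section local_expansion.
Variables (R : realType) (k : nat) (n m : 'I_k -> nat).
Variable f : forall i : 'I_k, prfh R (n i).
Hypothesis m_gt0 : forall i, (0 < m i)%N.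
Implicit Types (x y z h : 'rV[R[i]]_(\sum_i n i)) (T : bop (fock R n)).
Implicit Types be : multiword n.

Local Notation A := (polydomain_algebra f m).
Local Notation letter := {i : 'I_k & 'I_(n i)}.

(** Concatenating all words of be makes each coordinate of [vvec] a single monomial, to which the
    estimates for one list of letters apply. *)
Let letters be : seq letter :=
  flatten [seq [seq Tagged (fun i => 'I_(n i)) j | j <- be i] | i <- enum 'I_k].

Let ent z (t : letter) : R[i] := entry z (tagged t).

Let letters_prod z be : \prod_(t <- letters be) ent z t = \prod_i wentry z (be i).
Proof.
rewrite /letters big_flatten big_map big_enum /=; apply: eq_bigr => i _.
by rewrite big_map.
Qed.

Let sb be : R := \prod_i Num.sqrt (bcoef (f i) (m i) (be i)).

Let sb_ge0 be : 0 <= sb be.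
Proof. by apply: prodr_ge0 => i _; exact: sqrtr_ge0. Qed.

Let vfunE z be : vfun m f z be = (\prod_(t <- letters be) ent z t)^* * (sb be)%:C.
Proof.
rewrite letters_prod /vfun big_split /= rmorph_prod; congr (_ * _).
by rewrite rmorph_prod.
Qed.

Variable z0 : 'rV[R[i]]_(\sum_i n i).
Hypothesis z0_int : interior (scalar_domain f) z0.

Let rho (d : R) : 'rV[R[i]]_(\sum_i n i) :=
  \mxrow_(i < k) \row_(j < n i) (rnorm (entry z0 j) + 2 * d)%:C.

(* A slightly larger polyradius is still strictly inside because the domain is
   circular in each coordinate. *)
Let strict_rho : exists2 d : R, 0 < d & scalar_domain_strict f (rho d).
Proof.
have /nbhs_rnormP[e e0 eD] := z0_int.
(* Each entry is to be lengthened by 4 d = e / 2 < e along its own phase [ph], where an entry 0 gets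
   phase 1. *)
pose d := e / 8; have d0 : 0 < d by rewrite divr_gt0.
exists d => //.
pose ph (c : R[i]) : R[i] := if c == 0 then 1 else c / (rnorm c)%:C.
have rC (c : R[i]) : c != 0 -> (rnorm c)%:C != 0 :> R[i].
  by rewrite (_ : 0 = 0%:C) // (inj_eq (@complexI _)) -rnorm_gt0 => /lt0r_neq0.
have ph1 c : rnorm (ph c) = 1.
  rewrite /ph; case: eqVneq => [_|c0]; first exact: rnorm1.
  by rewrite rnormM rnormV rnorm_real ger0_norm ?rnorm_ge0 // mulfV // gt_eqF ?rnorm_gt0.
have phn c : rnorm (c + (4 * d)%:C * ph c) = rnorm c + 4 * d.
  rewrite /ph; case: eqVneq => [->|c0].
    by rewrite rnorm0 !add0r mulr1 rnorm_real ger0_norm // mulr_ge0 // ltW.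
  have -> : c + (4 * d)%:C * (c / (rnorm c)%:C) =
      (c / (rnorm c)%:C) * (rnorm c + 4 * d)%:C.
    by rewrite rmorphD /=; field; exact: rC.
  have e1 : rnorm (c / (rnorm c)%:C) = 1 by have := ph1 c; rewrite /ph (negbTE c0).
  rewrite rnormM e1.
  by rewrite mul1r rnorm_real ger0_norm // addr_ge0 ?rnorm_ge0 // mulr_ge0 // ltW.
pose z1 : 'rV[R[i]]_(\sum_i n i) :=
  \mxrow_(i < k) \row_(j < n i) (entry z0 j + (4 * d)%:C * ph (entry z0 j)).
have Dz1 : scalar_domain f z1.
  apply: eD; apply: (@le_lt_trans _ _ (4 * d)); last by rewrite /d; lra.
  apply/rnorm_entry_le => [|i j]; first by rewrite mulr_ge0 // ltW.
  rewrite entryB entry_mxrow addrC addKr rnormM ph1 mulr1 rnorm_real ger0_norm //.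
  by rewrite mulr_ge0 // ltW.
pose M := rnorm z0; have M0 : 0 <= M by exact: rnorm_ge0.
(* Scaling by r < 1 makes the point strict, and r (t + 4 d) >= t + 2 d for every t <= M, so it still
   dominates [rho d]. *)
pose r := (M + 2 * d) / (M + 4 * d).
have den0 : 0 < M + 4 * d by lra.
have r01 : 0 <= r < 1.
  apply/andP; split; first by rewrite divr_ge0 //; lra.
  by rewrite ltr_pdivrMr // mul1r; lra.
have h := strict_scale Dz1 r01.
move=> i; apply: le_lt_trans (h i); apply: sradius_mono => j.
rewrite entry_mxrow entryZ entry_mxrow rnormM phn !rnorm_real.
have := entry_le z0 j; rewrite -/M => jM; have jn := rnorm_ge0 (entry z0 j).
have r0 : 0 <= r by case/andP: r01.
rewrite (ger0_norm r0) ger0_norm; last by lra.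
by rewrite /r mulrAC ler_pdivlMr //; nra.
Qed.

Let dfun h be : R[i] :=
  (mon_deriv (ent z0) (ent h) (letters be))^* * (sb be)%:C.

Let vrho_norm d be : 0 <= d -> scalar_domain_strict f (rho d) ->
  rnorm (vvec m f (rho d) be) =
  (\prod_(t <- letters be) (rnorm (ent z0 t) + 2 * d)) * sb be.
Proof.
move=> d0 Dr; rewrite vvecE // vfunE rnormM rnormC rnorm_real ger0_norm //.
congr (_ * _); rewrite rnorm_prod; apply: eq_bigr => t _.
by rewrite /ent entry_mxrow rnorm_real ger0_norm // addr_ge0 ?rnorm_ge0 ?mulr_ge0.
Qed.

(** C is the norm of the kernel vector V at the enlarged polyradius: the coordinates of V have
    modulus equal to the monomial majorant times the weight, so the monomial estimates say that
    remainders are dominated by V. The last clause is Cauchy's estimate for the derivative L. *)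
Lemma local_expansion : exists (d C : R) (L : bop (fock R n) -> 'rV[R[i]]_(\sum_i n i) -> R[i]),
  [/\ 0 < d /\ 0 <= C,
   forall x, rnorm (x - z0) <= d -> scalar_domain_strict f x,
   (forall T a h h', L T (a *: h + h') = a * L T h + L T h') /\
   (forall a S T h, L (a *: S + T) h = a * L S h + L T h),
   forall T x y (e c : R), A T -> 0 <= e -> 0 <= c <= 1 ->
     rnorm (x - z0) <= c * d -> rnorm (y - z0) <= c * d ->
     rnorm (x - y) <= e * d ->
     rnorm (chi m f x T - chi m f y T - L T (x - y)) <= C * rnorm T * (e * c) &
   forall T h (M : R), A T -> rnorm h <= d ->
     (forall x, rnorm (x - z0) <= d -> rnorm (chi m f x T) <= M) ->
     rnorm (L T h) <= M].
Proof.
have [d d0 Dr] := strict_rho; have d0' := ltW d0.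
pose V := vvec m f (rho d).
have VE be := vrho_norm be d0' Dr.
have bound h be (e : R) : 0 <= e -> rnorm h <= e * d -> rnorm (dfun h be) <= e * rnorm (V be).
  move=> e0 hd; rewrite /V VE /dfun rnormM rnormC rnorm_real ger0_norm // mulrA.
  rewrite ler_wpM2r //; apply: mon_deriv_le => // t.
  exact: le_trans (entry_le _ _) hd.
have dmem h : dfun h \in @sqsummable R (multiword n).
  have e0 : 0 <= rnorm h / d by rewrite divr_ge0 ?rnorm_ge0.
  apply: (@sqsummable_dom _ _ _ V (rnorm h / d)) => // be; apply: bound => //.
  by rewrite mulfVK // gt_eqF.
pose D h : fock R n := Ell2 (dmem h).
pose e0 : fock R n := ell2_basis R (vacuum n).
(* D is conjugate-linear in h, so L is linear in it. *)
pose L T h := ip (T e0) (D h).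
have ball x : rnorm (x - z0) <= d -> scalar_domain_strict f x.
  move=> xd i; apply: le_lt_trans (Dr i); apply: sradius_mono => j.
  rewrite entry_mxrow rnorm_real ger0_norm ?addr_ge0 ?rnorm_ge0 ?mulr_ge0 //.
  have := le_trans (entry_le (x - z0) j) xd; rewrite entryB => h.
  rewrite -(subrK (entry z0 j) (entry x j)); apply: le_trans (rnormD _ _) _.
  by move: h d0; lra.
have Te T : rnorm (T e0) <= rnorm T.
  apply: le_trans (bop_le _ _) _; rewrite ler_piMr ?rnorm_ge0 //.
  rewrite -(@ler_pXn2r _ 2) ?nnegrE ?rnorm_ge0 // expr1n.
  by rewrite -lecR -ip_rnorm ell2_ip_basis ell2_basisE eqxx.
have cball x c : 0 <= c <= 1 -> rnorm (x - z0) <= c * d -> rnorm (x - z0) <= d.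
  by move=> /andP[_ c1] h; apply: le_trans h _; rewrite ler_piMl.
exists d, (rnorm V), L; split => //.
- by split => //; exact: rnorm_ge0.
- split=> [T a h h'|a S T h]; last by rewrite /L bopD bopZ ipDl ipZl.
  rewrite /L; have -> : D (a *: h + h') = a^* *: D h + D h'.
    apply: ell2P => be; rewrite ell2D ell2Z /= /dfun.
    rewrite (_ : ent (a *: h + h') = fun t => a * ent h t + ent h' t); last first.
      by apply/funext => t; rewrite /ent entryD entryZ.
    by rewrite mon_deriv_linear rmorphD rmorphM /=; ring.
  by rewrite ipDr ipZr conjCK.
- move=> T x y e c AT e0' c01 xz yz xy.
  rewrite !chi_strict //; [|exact/ball/(cball _ _ c01)..].
  rewrite /L -!ipBr; set W : fock R n := _ - D _.
  have WV : rnorm W <= (e * c) * rnorm V.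
    have c0 : 0 <= c by case/andP: c01.
    apply: ell2_dom => [|be]; first by rewrite mulr_ge0.
    rewrite VE /W !ell2B !vvecE //; [|exact/ball/(cball _ _ c01)..].
    rewrite /= /dfun !vfunE -!mulrBl rnormM rnorm_real ger0_norm // mulrA.
    rewrite ler_wpM2r // -!rmorphB rnormC.
    rewrite (_ : ent (x - y) = fun t => ent x t - ent y t); last first.
      by apply/funext => t; rewrite /ent entryB.
    apply: mon_expansion => // t; rewrite /ent -entryB; apply: le_trans (entry_le _ _) _ => //.
  apply: le_trans (cauchy_schwarz _ _) _.
  have h1 := ler_pM (rnorm_ge0 _) (rnorm_ge0 _) (Te T) WV.
  by apply: (le_trans h1); rewrite le_eqVlt; apply/orP; left; apply/eqP; ring.
- move=> T h M AT hd xM.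
  have M0 : 0 <= M by apply: le_trans (xM z0 _); rewrite ?rnorm_ge0 // subrr rnorm0.
  have key N : (1 < N)%N -> rnorm (L T h) <= M + rnorm T * (2 ^- N * rnorm V).
    move=> N1; have N0 : (0 < N)%N by exact: ltnW.
    have [w wN] := complex_prim_root R N0.
    have w1 j : rnorm (w ^+ j) = 1.
      by apply: (unity_rnorm N0); rewrite exprAC (prim_expr_order wN) expr1n.
    pose x j := z0 + w ^+ j *: h.
    have xd j : rnorm (x j - z0) <= d by rewrite /x addrC addKr rnormZ w1 mul1r.
    pose avg := N%:R^-1 * \sum_(j < N) (w ^+ j) ^- 1 * chi m f (x j) T.
    have avgM : rnorm avg <= M.
      rewrite /avg rnormM rnormV.
      have -> : rnorm (N%:R : R[i]) = N%:R.
        by rewrite -(rmorph_nat (real_complex R)) rnorm_real ger0_norm.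
      rewrite mulrC ler_pdivrMr ?ltr0n //; apply: le_trans (rnorm_sum _ _ _) _.
      apply: (@le_trans _ _ (\sum_(j < N) M)); last first.
        by rewrite sumr_const card_ord mulr_natr.
      apply: ler_sum => j _; rewrite rnormM expr1 rnormV w1 invr1 mul1r.
      exact/xM/xd.
    (* The average as a single vector; the scalars are conjugated because they move to the second
       argument of the inner product. *)
    pose W : fock R n := N%:R^-1 *: \sum_(j < N) ((w ^+ j) ^- 1)^* *: vvec m f (x j).
    have avgE : avg = ip (T e0) W.
      rewrite /avg /W ipZr fmorphV rmorph_nat ip_sumr; congr (_ * _).
      apply: eq_bigr => j _; rewrite ipZr conjCK chi_strict //; exact/ball/xd.
    have WV : rnorm (W - D h) <= 2 ^- N * rnorm V.
      apply: ell2_dom => [|be]; first by rewrite invr_ge0 exprn_ge0.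
      rewrite VE ell2B /W ell2Z ell2_sumE /= /dfun.
      have -> : \sum_(j < N) (((w ^+ j) ^- 1)^* *: vvec m f (x j) : fock R n) be =
          (\sum_(j < N) (w ^+ j) ^- 1 *
            \prod_(t <- letters be) (ent z0 t + w ^+ j * ent h t))^* * (sb be)%:C.
        rewrite rmorph_sum big_distrl; apply: eq_bigr => j _.
        rewrite ell2Z vvecE //; last exact/ball/xd.
        rewrite vfunE rmorphM /= mulrA; congr (_ * _^* * _).
        by apply: eq_bigr => t _; rewrite /ent /x entryD entryZ.
      rewrite [N%:R^-1 * _]mulrA -mulrBl rnormM rnorm_real ger0_norm //.
      rewrite [leRHS]mulrA ler_wpM2r //.
      rewrite -[N%:R^-1]conjCK -rmorphM -rmorphB rnormC fmorphV rmorph_nat.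
      by apply: mon_average => // t; exact: le_trans (entry_le _ _) hd.
    have -> : L T h = avg - ip (T e0) (W - D h).
      by rewrite avgE -ipBr opprB addrC subrK.
    apply: le_trans (rnormB_le _ _) _; rewrite lerD //.
    apply: le_trans (cauchy_schwarz _ _) _.
    exact: ler_pM (rnorm_ge0 _) (rnorm_ge0 _) (Te T) WV.
  (* Letting N grow removes the error 2^-N |T| |V|. *)
  apply/ler_addgt0Pr => e e0'.
  pose K := rnorm T * rnorm V + 1.
  have K0 : 0 < K by rewrite ltr_wpDl // mulr_ge0 ?rnorm_ge0.
  have /cvgrPdist_lt/(_ _ (divr_gt0 e0' K0))[N _ HN] : (fun N => (2^-1 : R) ^+ N) @ \oo --> (0 : R).
    by apply: cvg_expr; rewrite ger0_norm ?invr_ge0 //; lra.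
  have := HN _ (leq_addr 2 N); rewrite /= sub0r normrN ger0_norm ?exprn_ge0 ?invr_ge0 //.
  rewrite exprVn ltr_pdivlMr // => h2.
  have N1 : (1 < N + 2)%N by rewrite addn2.
  apply: le_trans (key _ N1) _; rewrite lerD2l mulrCA.
  by apply: le_trans (ltW h2); rewrite ler_wpM2l ?invr_ge0 ?exprn_ge0 // lerDl.
Qed.

End local_expansion.

(** * The origin is an interior point *)

Section zero_interior.
Variable R : realType.

Lemma prodrM_const (T : Type) (s : seq T) (M : R) (g : T -> R) :
  \prod_(j <- s) (M * g j) = M ^+ size s * \prod_(j <- s) g j.
Proof.
elim: s => [|j s IHs]; first by rewrite !big_nil mulr1.
by rewrite !big_cons IHs [size _]/= exprS mulrACA.
Qed.

(** The finite limsup gives B with a al <= |B|^|al| for long words; S, the sum of all coefficients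
    of shorter words, handles the rest. The 1 in M makes M at most its own positive powers. *)
Lemma coef_geometric n (a : prfh R n) :
  exists2 M : R, 0 <= M & forall al, (0 < size al)%N -> a al <= M ^+ size al.
Proof.
have := coef_radius a; set u := (fun p : nat => _) => ulim.
have [N [B HB]] : exists N B, forall p, (N <= p)%N ->
    (\sum_(al : p.-tuple 'I_n) `|a al| ^+ 2) `^ (2 * p)%:R^-1 <= B.
  move: ulim; rewrite /limn_esup limf_esupE => /ereal_inf_lt[_ [V [N _ NV] <-]].
  set s := ereal_sup _ => soo; exists N, (fine s) => p Np.
  have us : (u p <= s)%E by apply: ereal_sup_ubound; exists p => //; exact: NV.
  have sf : s \is a fin_num.
    by rewrite fin_numE (lt_eqF soo) andbT; apply: contraTneq us => ->; rewrite leeNy_eq.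
  by rewrite -lee_fin fineK.
pose S := \sum_(p < N) \sum_(al : p.-tuple 'I_n) a al.
have S0 : 0 <= S by do 2 (apply: sumr_ge0 => ? _); exact: coef_ge0.
exists (1 + `|B| + S); first by rewrite !addr_ge0.
move=> al al0; have [alN|Nal] := ltnP (size al) N.
  apply: (@le_trans _ _ (1 + `|B| + S)); last first.
    by rewrite ler_eXnr // -addrA lerDl addr_ge0.
  apply: (@le_trans _ _ S); last by rewrite lerDr addr_ge0.
  rewrite /S (bigD1 (Ordinal alN)) //= (bigD1 (in_tuple al)) //= -addrA lerDl.
  by rewrite addr_ge0 // sumr_ge0 // => ? _; rewrite ?sumr_ge0 // => *; exact: coef_ge0.
have := HB _ Nal; set s := \sum_(be : _.-tuple _) _ => sB.
have s0 : 0 <= s by apply: sumr_ge0 => ? _; exact: sqr_ge0.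
have p0 : (0 < 2 * size al)%N by rewrite muln_gt0.
have h1 : s <= `|B| ^+ (2 * size al).
  have -> : s = (s `^ (2 * size al)%:R^-1) ^+ (2 * size al).
    by rewrite -powR_mulrn ?powR_ge0 // -powRrM mulVf ?powRr1 // pnatr_eq0 -lt0n.
  rewrite lerXn2r ?nnegrE ?powR_ge0 //; exact: le_trans sB (ler_norm _).
have h2 : a al ^+ 2 <= s.
  rewrite /s (bigD1 (in_tuple al)) //= ger0_norm ?coef_ge0 // lerDl.
  by apply: sumr_ge0 => *; exact: sqr_ge0.
have h3 : a al <= `|B| ^+ size al.
  rewrite -ler_sqr ?nnegrE ?coef_ge0 ?exprn_ge0 //.
  by rewrite -exprM mulnC; exact: le_trans h2 h1.
apply: le_trans h3 _; rewrite lerXn2r ?nnegrE ?addr_ge0 //.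
by rewrite addrAC lerDr addr_ge0.
Qed.

Lemma tuple_sum n (c : 'I_n -> R) p :
  \sum_(t : p.-tuple 'I_n) \prod_(j <- t) c j = (\sum_j c j) ^+ p.
Proof.
elim: p => [|p IHp].
  by rewrite expr0 (big_pred1 [tuple]) ?big_nil // => t; apply/esym/eqP; exact: tuple0.
pose h (x : 'I_n * p.-tuple 'I_n) := cons_tuple x.1 x.2.
rewrite (reindex h) /=; last first.
  exists (fun t => (thead t, behead_tuple t)) => [[u t] _|t _] /=.
    by rewrite /h /=; congr (_, _); apply/val_inj.
  by apply/val_inj; rewrite /= [in RHS](tuple_eta t).
rewrite -(pair_big xpredT xpredT (fun u (t : p.-tuple 'I_n) => \prod_(j <- (u :: t)) c j)) /=.
rewrite exprS -IHp big_distrl /=; apply: eq_bigr => u _.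
by rewrite big_distrr /=; apply: eq_bigr => t _; rewrite big_cons.
Qed.

(** Words of length p contribute at most the p-th power of the sum of c, and a geometric series of
    ratio at most 1/2 sums to at most 2. *)
Lemma sum_words_le n (c : 'I_n -> R) (J : {fset seq 'I_n}) :
  (forall j, 0 <= c j) -> \sum_j c j <= 2^-1 ->
  \sum_(w <- J | (0 < size w)%N) \prod_(j <- w) c j <= 2 * \sum_j c j.
Proof.
move=> c0; set th := \sum_j c j => th2.
have th0 : 0 <= th by exact: sumr_ge0.
have g0 (w : seq 'I_n) : 0 <= \prod_(j <- w) c j by exact: prodr_ge0.
pose K := (\max_(w <- J) size w)%N.
have JK w : w \in J -> (size w < K.+1)%N.
  by move=> wJ; rewrite ltnS; exact: (@leq_bigmax_seq _ (enum_fset J) xpredT size w wJ isT).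
have layer p : \sum_(w <- J | size w == p) \prod_(j <- w) c j <= th ^+ p.
  rewrite /th -tuple_sum; pose B := [fset val t | t : p.-tuple 'I_n]%fset.
  have -> : \sum_(t : p.-tuple 'I_n) \prod_(j <- t) c j =
      \sum_(w <- B) \prod_(j <- w) c j.
    rewrite big_imfset /=; last by move=> ? ? _ _; exact: val_inj.
    by rewrite big_enum.
  have -> : \sum_(w <- J | size w == p) \prod_(j <- w) c j =
      \sum_(w <- [fset w in J | size w == p]%fset) \prod_(j <- w) c j.
    by apply: esym; rewrite big_imfset //= big_filter.
  apply: fsum_mono => //; apply/fsubsetP => w; rewrite !inE /= => /andP[_ wp].
  by apply/imfsetP; exists (Tuple wp).
apply: (@le_trans _ _ (\sum_(p < K) th ^+ p.+1)).
  apply: (@le_trans _ _ (\sum_(p < K) \sum_(w <- J | size w == p.+1) \prod_(j <- w) c j));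
    last by apply: ler_sum => p _; exact: layer.
  under [leRHS]eq_bigr do rewrite big_mkcond.
  rewrite exchange_big /= big_mkcond /= big_seq [leRHS]big_seq; apply: ler_sum => w wJ.
  case: ifPn => w0; last by apply: sumr_ge0 => p _; case: ifP.
  have wK : ((size w).-1 < K)%N by have := JK w wJ; rewrite -{1}(prednK w0) ltnS.
  rewrite (bigD1 (Ordinal wK)) //= prednK // eqxx lerDl.
  by apply: sumr_ge0 => p _; case: ifP.
have geo : (\sum_(p < K) th ^+ p) <= 2.
  have h : (\sum_(p < K) th ^+ p) * (1 - th) <= 1.
    elim: K {JK} => [|K' IHK]; first by rewrite big_ord0 mul0r.
    rewrite big_ord_recl expr0 /= mulrDl mul1r.
    have -> : \sum_(i < K') th ^+ bump 0 i = th * \sum_(i < K') th ^+ i.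
      by rewrite big_distrr /=; apply: eq_bigr => i _; rewrite -exprS.
    by rewrite -mulrA; have := ler_wpM2l th0 IHK; lra.
  have : 0 <= \sum_(p < K) th ^+ p by apply: sumr_ge0 => p _; exact: exprn_ge0.
  by move: h th2; set s := \sum_(p < K) _; nra.
have -> : \sum_(p < K) th ^+ p.+1 = th * \sum_(p < K) th ^+ p.
  by rewrite big_distrr /=; apply: eq_bigr => i _; rewrite -exprS.
by rewrite mulrC ler_wpM2r.
Qed.

Lemma zero_interior (k : nat) (n : 'I_k -> nat) (f : forall i : 'I_k, prfh R (n i)) :
  interior (scalar_domain f) 0.
Proof.
suff : \forall z \near (0 : 'rV[R[i]]_(\sum_i n i)), forall i, (sradius f z i <= 1)%E by [].
have FF : Filter (nbhs (0 : 'rV[R[i]]_(\sum_i n i))) by exact: nbhs_filter.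
apply: (@filter_forall _ _ (fun i => [set z | (sradius f z i <= 1)%E]) _ FF) => i; have [M M0 aM] := coef_geometric (f i).
(* Chosen so that the numbers M |z_j|^2 add up to at most 1/2, as [sum_words_le] requires. *)
pose e : R := Num.sqrt (2^-1 / (1 + M * (n i)%:R)).
have K0 : 0 < 1 + M * (n i)%:R by rewrite ltr_wpDr // mulr_ge0.
have e0 : 0 < e by rewrite sqrtr_gt0 divr_gt0.
apply/nbhs_rnormP; exists e => // z; rewrite subr0 => ze.
pose c (j : 'I_(n i)) := M * rnorm (entry z j) ^+ 2.
have c0 j : 0 <= c j by rewrite mulr_ge0 ?sqr_ge0.
have c2 : \sum_j c j <= 2^-1.
  apply: (@le_trans _ _ (\sum_(j < n i) M * e ^+ 2)).
    apply: ler_sum => j _; rewrite ler_wpM2l // ler_sqr ?nnegrE ?rnorm_ge0 ?(ltW e0) //.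
    exact: le_trans (entry_le _ _) (ltW ze).
  rewrite sumr_const card_ord -mulrnAl -[M *+ _]mulr_natr sqr_sqrtr; last first.
    by rewrite divr_ge0 // ltW.
  by rewrite mulrCA ler_piMr ?invr_ge0 // ler_pdivrMr // mul1r lerDr.
apply: ge_ereal_sup => _ [F [finF F0] <-].
rewrite fsbig_finite //= sumEFin lee_fin.
apply: (@le_trans _ _ (2 * \sum_j c j)); last by move: c2; lra.
apply: le_trans (sum_words_le (fset_set F) c0 c2).
rewrite [leRHS]big_mkcond /= big_seq [leRHS]big_seq; apply: ler_sum => w.
rewrite in_fset_set // inE => /F0 /= w0; rewrite w0 rnorm_wentry.
rewrite /c prodrM_const.
by rewrite ler_wpM2r ?aM // prodr_ge0 // => j _; exact: sqr_ge0.
Qed.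

End zero_interior.

(** * Differentiability and openness from a two-point expansion *)

Section inverse_function.
Variables (R : realType) (N M : nat).
Implicit Types (x y h : 'rV[R[i]]_N).

Lemma rnorm_mulmx_le p q (B : 'M[R[i]]_(p, q)) : exists2 K : R, 0 < K &
  forall v : 'rV[R[i]]_p, rnorm (v *m B) <= K * rnorm v.
Proof.
pose K := \sum_i \sum_j rnorm (B i j).
have K0 : 0 <= K by do 2 (apply: sumr_ge0 => ? _); exact: rnorm_ge0.
exists (1 + K) => [|v]; first by rewrite ltr_wpDr.
apply/rnorm_rV_le => [|j]; first by rewrite mulr_ge0 ?rnorm_ge0 // addr_ge0.
rewrite mxE; apply: le_trans (rnorm_sum _ _ _) _.
apply: (@le_trans _ _ (K * rnorm v)); last by rewrite ler_wpM2r ?rnorm_ge0 // lerDr.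
rewrite mulrC /K big_distrr /=; apply: ler_sum => i _; rewrite rnormM.
have vi : rnorm (v ord0 i) <= rnorm v.
  by move: i; apply/rnorm_rV_le => //; exact: rnorm_ge0.
apply: ler_pM; rewrite ?rnorm_ge0 ?vi //.
by rewrite (bigD1 j) //= lerDl; apply: sumr_ge0 => ? _; exact: rnorm_ge0.
Qed.

(** Strict differentiability at x0 in quantitative form: d is the unit of length, c measures the
    distance from x0 and e the distance between the two points. *)
Definition strictly_expands (F : 'rV[R[i]]_N -> 'rV[R[i]]_M) x0
    (L : 'M[R[i]]_(N, M)) (d C : R) : Prop :=
  forall x y (e c : R), 0 <= e -> 0 <= c <= 1 ->
    rnorm (x - x0) <= c * d -> rnorm (y - x0) <= c * d -> rnorm (x - y) <= e * d ->
    rnorm (F x - F y - (x - y) *m L) <= C * (e * c).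

Variables (F : 'rV[R[i]]_N -> 'rV[R[i]]_M) (x0 : 'rV[R[i]]_N).
Variables (L : 'M[R[i]]_(N, M)) (d C : R).
Hypotheses (d_gt0 : 0 < d) (C_ge0 : 0 <= C) (FL : strictly_expands F x0 L d C).

(** With y = x0 and e = c = |h| / d the remainder is C |h|^2 / d^2. *)
Lemma expansion_differentiable : differentiable F x0.
Proof.
pose df : {linear 'rV[R[i]]_N -> 'rV[R[i]]_M} := mulmxr L.
have dfc : continuous df.
  move=> x; apply/(@cvg_rnormP R _ (nbhs x) (nbhs_filter x)) => e e0; have [K K0 HK] := rnorm_mulmx_le L.
  apply/nbhs_rnormP; exists (e / K) => [|y yx]; first by rewrite divr_gt0.
  rewrite -linearB; apply: le_lt_trans (HK _) _.
  by rewrite mulrC -ltr_pdivlMr.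
have Fo : F \o shift x0 = cst (F x0) + df +o_ (nbhs (0 : 'rV[R[i]]_N)) id.
  apply/eqaddoP => _ /gt0_complex[e e0 ->].
  pose r := Num.min d (e * d ^+ 2 / (C + 1)).
  have C1 : 0 < C + 1 by rewrite ltr_wpDl.
  have r0 : 0 < r by rewrite lt_min d_gt0 /= divr_gt0 // mulr_gt0 // exprn_gt0.
  apply/nbhs_rnormP; exists r => // h; rewrite subr0 => hr.
  have hd : rnorm h <= d by apply: ltW; apply: lt_le_trans hr _; rewrite ge_min lexx.
  have hr2 : rnorm h <= e * d ^+ 2 / (C + 1).
    by apply: ltW; apply: lt_le_trans hr _; rewrite ge_min lexx orbT.
  pose t := rnorm h / d.
  have t0 : 0 <= t by rewrite divr_ge0 ?rnorm_ge0 // ltW.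
  have t1 : t <= 1 by rewrite ler_pdivrMr // mul1r.
  have td : t * d = rnorm h by rewrite mulfVK // gt_eqF.
  have t01 : 0 <= t <= 1 by rewrite t0.
  have := @FL (h + x0) x0 t t t0 t01; rewrite addrK subrr rnorm0 td => /(_ (lexx _)).
  move=> /(_ (rnorm_ge0 _) (lexx _)) key.
  rewrite -!rnormE -rmorphM lecR.
  have -> : (F \o shift x0 - (cst (F x0) + df)) h = F (h + x0) - F x0 - h *m L.
    by rewrite !fctE opprD addrA.
  apply: le_trans key _; rewrite /t.
  have -> : C * (rnorm h / d * (rnorm h / d)) = C * rnorm h / d ^+ 2 * rnorm h.
    by field; rewrite gt_eqF.
  rewrite ler_wpM2r ?rnorm_ge0 // ler_pdivrMr ?exprn_gt0 //.
  move: hr2; rewrite ler_pdivlMr // => hr2; apply: le_trans hr2.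
  by rewrite mulrC ler_wpM2l ?rnorm_ge0 // lerDl.
have dE : 'd F x0 = df :> (_ -> _) by exact: diff_unique.
by apply/diff_locallyP; rewrite dE.
Qed.

Lemma rV_cauchy_cvg p (u : nat -> 'rV[R[i]]_p) (K : R) : 0 <= K ->
  (forall s t, (s <= t)%N -> rnorm (u t - u s) <= K / 2 ^+ s) ->
  exists l, forall s, rnorm (l - u s) <= K / 2 ^+ s.
Proof.
move=> K0 uc.
have small e : 0 < e -> exists s, K / 2 ^+ s < e.
  move=> e0; have K1 : 0 < K + 1 by rewrite ltr_wpDl.
  have /cvgrPdist_lt/(_ _ (divr_gt0 e0 K1))[s _ Hs] : (fun s => (2^-1 : R) ^+ s) @ \oo --> (0 : R).
    by apply: cvg_expr; rewrite ger0_norm ?invr_ge0 //; lra.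
  exists s; have := Hs s (leqnn s); rewrite /= sub0r normrN ger0_norm ?exprn_ge0 ?invr_ge0 //.
  rewrite exprVn ltr_pdivlMr // mulrC => h; apply: le_lt_trans h.
  by rewrite ler_wpM2r ?invr_ge0 ?exprn_ge0 // lerDl.
have ent s t j : (s <= t)%N -> rnorm (u t ord0 j - u s ord0 j) <= K / 2 ^+ s.
  move=> st; have := uc s t st.
  have Ks : 0 <= K / 2 ^+ s by rewrite divr_ge0 ?exprn_ge0.
  by move=> /(rnorm_rV_le _ Ks).1 /(_ j); rewrite !mxE.
have /boolp.choice[l Hl] : forall j, exists l : R[i], (fun s => u s ord0 j) @ \oo --> l.
  move=> j; apply: complex_cauchy_cvg => e e0.
  have [s Hs] := small (e / 2) (divr_gt0 e0 (ltr0Sn _ 1)).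
  exists [set u t ord0 j | t in [set t | (s <= t)%N]].
    by exists s => // t /= st; exists t.
  move=> _ _ [t st <-] [t' st' <-].
  have -> : u t ord0 j - u t' ord0 j =
    (u t ord0 j - u s ord0 j) - (u t' ord0 j - u s ord0 j) by ring.
  apply: le_lt_trans (rnormB_le _ _) _.
  by have := ent s t j st; have := ent s t' j st'; lra.
exists (\row_j l j) => s; have Ks : 0 <= K / 2 ^+ s by rewrite divr_ge0 ?exprn_ge0.
apply/(rnorm_rV_le _ Ks) => j; rewrite !mxE.
apply/ler_addgt0Pr => e e0.
have [t _ Ht] := (cvg_rnormP _ _ _).1 (Hl j) _ e0.
have := Ht _ (leq_maxl t s); set t' := maxn t s => lt'.
have -> : l j - u s ord0 j = (u t' ord0 j - u s ord0 j) - (u t' ord0 j - l j) by ring.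
apply: le_trans (rnormB_le _ _) _; apply: lerD; last exact: ltW.
exact/ent/leq_maxr.
Qed.

(* Newton iteration with the fixed right inverse B of the derivative. *)
Lemma expansion_open (B : 'M[R[i]]_(M, N)) : B *m L = 1%:M ->
  nbhs (F x0) [set F x | x in [set x | rnorm (x - x0) <= d]].
Proof.
move=> BL; have [K K0 HK] := rnorm_mulmx_le B.
have [K' K'0 HK'] := rnorm_mulmx_le L.
(* Makes C c K / d at most 1/2, the contraction factor of the iteration. *)
pose c := Num.min 1 (d / (2 * K * (C + 1))).
have C1 : 0 < C + 1 by rewrite ltr_wpDl.
have den0 : 0 < 2 * K * (C + 1) by rewrite !mulr_gt0.
have c0 : 0 < c by rewrite lt_min ltr01 divr_gt0.
have c1 : c <= 1 by rewrite ge_min lexx.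
have c01 : 0 <= c <= 1 by rewrite ltW.
have cK : C * c / d * K <= 2^-1.
  have : c <= d / (2 * K * (C + 1)) by rewrite ge_min lexx orbT.
  rewrite ler_pdivlMr // => h.
  rewrite mulrAC ler_pdivrMr //.
  have : c * (2 * K * C) <= d.
    apply: le_trans h; rewrite ler_wpM2l ?(ltW c0) // ler_wpM2l ?lerDl // mulr_ge0 //.
    exact: ltW.
  rewrite (_ : c * (2 * K * C) = 2 * (C * c * K)); last by ring.
  by lra.
have cd : c * d <= d by rewrite ler_piMl // ltW.
apply/nbhs_rnormP; exists (c * d / (2 * K)).
  by rewrite divr_gt0 // mulr_gt0.
move=> y yF; pose r0 := rnorm (y - F x0).
have r00 : 0 <= r0 by exact: rnorm_ge0.
have r0c : 2 * K * r0 <= c * d.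
  by rewrite mulrC -ler_pdivlMr ?mulr_gt0 // ltW.
pose step x := x + (y - F x) *m B.
pose u := fix u s := if s is s'.+1 then step (u s') else x0.
(* The residual halves at each step, so the displacements are dominated by a geometric series of sum
   2 K r0, which does not leave the ball of radius c d. *)
have stepP s : rnorm (y - F (u s)) <= r0 / 2 ^+ s /\
    rnorm (u s - x0) <= 2 * K * r0 * (1 - 2 ^- s).
  elim: s => [|s [IH1 IH2]].
    by rewrite expr0 divr1 subrr rnorm0 invr1 subrr mulr0.
  set e_ := y - F (u s) in IH1; have us1 : u s.+1 - u s = e_ *m B.
    by rewrite /= /step addrC addKr.
  have us : rnorm (u s.+1 - u s) <= K * (r0 / 2 ^+ s).
    by rewrite us1; apply: le_trans (HK _) _; rewrite ler_wpM2l // ltW.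
  have p2 : 2 ^- s.+1 = 2 ^- s / 2 :> R by rewrite exprS invfM mulrC.
  have IH2' : rnorm (u s.+1 - x0) <= 2 * K * r0 * (1 - 2 ^- s.+1).
    rewrite -(subrKA (u s)); apply: le_trans (rnormD _ _) _.
    by move: (lerD us IH2); rewrite p2; set v := 2 ^- s; lra.
  split => //.
  have q0 : 0 <= 2 * K * r0 by rewrite !mulr_ge0 // ltW.
  have inball t : rnorm (u t - x0) <= 2 * K * r0 * (1 - 2 ^- t) ->
      rnorm (u t - x0) <= c * d.
    move=> h; apply: le_trans h _; apply: le_trans r0c.
    by rewrite ler_piMr // gerBl invr_ge0 exprn_ge0.
  pose e := rnorm (u s.+1 - u s) / d.
  have e0 : 0 <= e by rewrite divr_ge0 ?rnorm_ge0 // ltW.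
  have ed : rnorm (u s.+1 - u s) <= e * d by rewrite mulfVK // gt_eqF.
  have := FL e0 c01 (inball _ IH2') (inball _ IH2) ed.
  (* As B L = 1, the linear part predicted for the step is exactly the residual; only the remainder
     of the expansion survives. *)
  rewrite us1 -mulmxA BL mulmx1 => key.
  have -> : y - F (u s.+1) = - (F (u s.+1) - F (u s) - e_).
    by rewrite /e_ opprB opprB; set a := F (u s.+1); set b := F (u s); rewrite addrA subrK.
  rewrite rnormN; apply: le_trans key _; rewrite p2.
  apply: (@le_trans _ _ (C * c / d * (K * (r0 / 2 ^+ s)))).
    have -> : C * (e * c) = C * c / d * rnorm (u s.+1 - u s) by rewrite /e; ring.
    by rewrite ler_wpM2l // divr_ge0 ?(ltW d_gt0) // mulr_ge0 // ltW.
  rewrite mulrA.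
  have := ler_wpM2r (_ : 0 <= r0 / 2 ^+ s) cK.
  rewrite divr_ge0 ?exprn_ge0 // => /(_ isT) h; apply: le_trans h _.
  by rewrite le_eqVlt; apply/orP; left; apply/eqP; rewrite [RHS]mulrA mulrC.
have uc s t : (s <= t)%N -> rnorm (u t - u s) <= 2 * K * r0 / 2 ^+ s.
  move=> st; suff : rnorm (u t - u s) <= 2 * K * r0 * (2 ^- s - 2 ^- t).
    move=> h; apply: le_trans h _; rewrite ler_wpM2l ?mulr_ge0 ?(ltW K0) //.
    by rewrite gerBl invr_ge0 exprn_ge0.
  rewrite -(subnKC st); elim: (t - s)%N => [|j IHj].
    by rewrite addn0 !subrr rnorm0 mulr0.
  rewrite addnS -(subrKA (u (s + j))%N); apply: le_trans (rnormD _ _) _.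
  have us1 : u (s + j).+1 - u (s + j)%N = (y - F (u (s + j)%N)) *m B.
    by rewrite /= /step addrC addKr.
  have h1 : rnorm (u (s + j).+1 - u (s + j)%N) <= K * (r0 / 2 ^+ (s + j)).
    rewrite us1; apply: le_trans (HK _) _; rewrite ler_wpM2l ?(ltW K0) //.
    by case: (stepP (s + j)%N).
  have p2 : 2 ^- (s + j).+1 = 2 ^- (s + j) / 2 :> R by rewrite exprS invfM mulrC.
  move: (lerD h1 IHj); rewrite p2; set v := 2 ^- (s + j); set v' := 2 ^- s.
  by lra.
have q0 : 0 <= 2 * K * r0 by rewrite !mulr_ge0 // ltW.
have [x Hx] := rV_cauchy_cvg q0 uc.
have xc : rnorm (x - x0) <= c * d.
  by have := Hx 0%N; rewrite expr0 divr1 => h; exact: le_trans h r0c.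
exists x; first exact: le_trans xc cd.
apply/eqP; rewrite -subr_eq0; apply/eqP/rnorm_le0 => e e0.
(* A Lipschitz constant of F on the ball, by which F (u s) passes to the limit. *)
pose Q := C * c / d + K'.
have Q0 : 0 <= Q by rewrite addr_ge0 ?(ltW K'0) // divr_ge0 ?(ltW d_gt0) // mulr_ge0 // ltW.
pose Z := Q * (2 * K * r0) + r0 + 1.
have Z0 : 0 < Z by rewrite ltr_wpDl // addr_ge0 // mulr_ge0.
have /cvgrPdist_lt/(_ _ (divr_gt0 e0 Z0))[s _ Hs] : (fun s => (2^-1 : R) ^+ s) @ \oo --> (0 : R).
  by apply: cvg_expr; rewrite ger0_norm ?invr_ge0 //; lra.
have := Hs s (leqnn s); rewrite /= sub0r normrN ger0_norm ?exprn_ge0 ?invr_ge0 //.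
rewrite exprVn ltr_pdivlMr // => hs.
have [h1 h2] := stepP s.
have uin : rnorm (u s - x0) <= c * d.
  apply: le_trans h2 _; apply: le_trans r0c.
  by rewrite ler_piMr // gerBl invr_ge0 exprn_ge0.
pose t := rnorm (x - u s) / d.
have t0 : 0 <= t by rewrite divr_ge0 ?rnorm_ge0 // ltW.
have td : rnorm (x - u s) <= t * d by rewrite mulfVK // gt_eqF.
have h3 := FL t0 c01 xc uin td.
have h4 : rnorm (F x - F (u s)) <= Q * rnorm (x - u s).
  rewrite -(subrK ((x - u s) *m L) (F x - F (u s))).
  apply: le_trans (rnormD _ _) _; rewrite /Q mulrDl lerD //.
  by apply: le_trans h3 _; rewrite le_eqVlt /t; apply/orP; left; apply/eqP; ring.
have -> : F x - y = (F x - F (u s)) - (y - F (u s)).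
  by rewrite opprB addrA subrK.
apply: le_trans (rnormB_le _ _) _; apply: le_trans (lerD h4 h1) _.
apply: le_trans (lerD (ler_wpM2l Q0 (Hx s)) (lexx _)) _.
apply: le_trans (ltW hs); rewrite /Z.
have : 0 <= 2 ^- s :> R by rewrite invr_ge0 exprn_ge0.
by set v := 2 ^- s; lra.
Qed.

End inverse_function.

(** * The map phi induced by [Psi]; the assumptions are phrased so as to fit its inverse as well *)

Section transport.
Variables (R : realType) (k k' : nat) (n m : 'I_k -> nat) (l d : 'I_k' -> nat).
Variables (f : forall i : 'I_k, prfh R (n i)) (g : forall i : 'I_k', prfh R (l i)).
Hypotheses (m_gt0 : forall i, (0 < m i)%N) (d_gt0 : forall i, (0 < d i)%N).
Variable Psi : bop (fock R n) -> bop (fock R l).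

Local Notation Af := (polydomain_algebra f m).
Local Notation Ag := (polydomain_algebra g d).

Hypothesis PsiA : forall T, Af T -> Ag (Psi T).
Hypothesis Psi_surj : forall T', Ag T' -> exists2 T, Af T & Psi T = T'.
Hypothesis Psi_lin : forall a S T, Af S -> Af T -> Psi (a *: S + T) = a *: Psi S + Psi T.
Hypothesis Psi_mul : forall S T, Af S -> Af T -> Psi (S * T) = Psi S * Psi T.
Hypothesis Psi1 : Psi 1 = 1.

Local Notation phi := (berezin_limit f m g d Psi).

Lemma phi_entry la i (j : 'I_(n i)) : entry (phi la) j = chi d g la (Psi (umodel f m j)).
Proof. by rewrite /berezin_limit entry_mxrow chiE. Qed.

(* Stated separately because rewriting with phi_entry twice makes unification
   compare the two arguments up to unfolding. *)
Lemma phi_entryB la mu i (j : 'I_(n i)) : entry (phi la) j - entry (phi mu) j =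
  chi d g la (Psi (umodel f m j)) - chi d g mu (Psi (umodel f m j)).
Proof. by congr (_ - _); exact: phi_entry. Qed.

Lemma chi_Psi_character la : scalar_domain g la ->
  character Af (fun T => chi d g la (Psi T)).
Proof.
move=> Dla; have [X1 Xl XM] := chi_character d_gt0 Dla; split => [|a S T AS AT|S T AS AT].
- by rewrite Psi1.
- by rewrite Psi_lin // Xl //; exact: PsiA.
- by rewrite Psi_mul // XM //; exact: PsiA.
Qed.

Lemma phi_domain la : scalar_domain g la -> scalar_domain f (phi la).
Proof.
move=> Dla; apply: (character_domain m_gt0 (chi_Psi_character Dla)) => i j.
by rewrite phi_entry.
Qed.

(** Both sides are characters in T and agree at the generators by construction of phi. *)
Lemma chi_phi la T : scalar_domain g la -> Af T ->
  chi m f (phi la) T = chi d g la (Psi T).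
Proof.
move=> Dla AT; apply: esym; apply: (chi_unique m_gt0 (chi_Psi_character Dla) _ AT) => i j.
by rewrite phi_entry.
Qed.

Lemma phi_continuous : {within scalar_domain g, continuous phi}.
Proof.
apply/subspace_continuousP => z Dz.
have FF : ProperFilter (within (scalar_domain g) (nbhs z)).
  by apply: within_nbhs_proper; exact: subset_closure.
apply/cvg_rnormP => e e0; have e20 : 0 < e / 2 by rewrite divr_gt0.
have : \forall z' \near within (scalar_domain g) (nbhs z), forall i (j : 'I_(n i)),
    rnorm (entry (phi z') j - entry (phi z) j) < e / 2.
  apply: filter_forall => i; apply: filter_forall => j.
  have AW : Ag (Psi (umodel f m j)) by apply: PsiA; exact: polydomain_gen.
  have h : chi d g z' (Psi (umodel f m j)) @[z' --> within (scalar_domain g) (nbhs z)]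
      --> chi d g z (Psi (umodel f m j)).
    exact: (proj1 (subspace_continuousP _ _) (chi_continuous d_gt0 AW) z Dz).
  apply: filterS ((cvg_rnormP _ _ _).1 h _ e20) => z' h'.
  by rewrite (phi_entryB z' z j); exact: h'.
apply: filterS => z' h; apply: (@le_lt_trans _ _ (e / 2)); last by lra.
apply/rnorm_entry_le => [|i j]; first exact: ltW.
by rewrite entryB ltW.
Qed.

Section interior_point.
Variable z : 'rV[R[i]]_(\sum_i l i).
Hypothesis z_int : interior (scalar_domain g) z.

(** The entries of phi are the transforms of the operators [Psi (umodel f m j)], so their
    derivatives assemble into a matrix. Row vectors multiply it from the left, hence [row_free] is
    injectivity of the derivative. *)
Lemma phi_expansion : exists (L : 'M[R[i]]_(\sum_i l i, \sum_i n i)) (dl C : R),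
  [/\ 0 < dl, 0 <= C, forall x, rnorm (x - z) <= dl -> scalar_domain g x,
      strictly_expands phi z L dl C & row_free L].
Proof.
have [dl [C [L [[dl0 C0] ball [Llin LlinT] Lexp Lcauchy]]]] := local_expansion d_gt0 z_int.
pose Lphi h : 'rV[R[i]]_(\sum_i n i) :=
  \mxrow_(i < k) \row_(j < n i) L (Psi (umodel f m j)) h.
have Lphi_entry h i (j : 'I_(n i)) : entry (Lphi h) j = L (Psi (umodel f m j)) h.
  by rewrite /Lphi entry_mxrow.
have Lphi_lin a h h' : Lphi (a *: h + h') = a *: Lphi h + Lphi h'.
  by apply: entryP => i j; rewrite entryD entryZ !Lphi_entry Llin.
pose M : 'M[R[i]]_(\sum_i l i, \sum_i n i) := \matrix_i Lphi (delta_mx 0 i).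
have L0 T : L T 0 = 0.
  have := Llin T 1 0 0; rewrite scaler0 addr0 mul1r => /eqP.
  by rewrite -subr_eq0 opprD addNKr oppr_eq0 => /eqP.
have Lphi0 : Lphi 0 = 0.
  by apply: entryP => i j; rewrite Lphi_entry L0 entryE mxE.
have LphiM h : h *m M = Lphi h.
  rewrite mulmx_sum_row [in RHS](row_sum_delta h).
  elim: (index_enum 'I_(\sum_i l i)) => [|i r IHr]; first by rewrite !big_nil Lphi0.
  by rewrite !big_cons Lphi_lin IHr rowK.
have LZ T a h : L T (a *: h) = a * L T h.
  by have := Llin T a h 0; rewrite addr0 L0 addr0.
have Dball x : rnorm (x - z) <= dl -> scalar_domain g x.
  by move=> /ball; exact: strict_domainW.
have Dz : scalar_domain g z by apply: Dball; rewrite subrr rnorm0 ltW.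
have AgW i (j : 'I_(l i)) : Ag (umodel g d j) by exact: polydomain_gen.
have AfW i (j : 'I_(n i)) : Af (umodel f m j) by exact: polydomain_gen.
(* Uniqueness of the derivative along a line: a number c that describes the increment up to O(t^2)
   equals L T h. *)
have Luniq T h c (K : R) : Ag T -> 0 <= K -> rnorm h <= dl ->
    (forall t : R, 0 < t <= 1 ->
      rnorm (chi d g (z + t%:C *: h) T - chi d g z T - t%:C * c) <= K * (t * t)) ->
    L T h = c.
  move=> AT K0 hd hK; apply/eqP; rewrite -subr_eq0; apply/eqP/rnorm_le0 => e e0.
  pose Q := K + C * rnorm T.
  have Q0 : 0 <= Q by rewrite addr_ge0 // mulr_ge0 ?rnorm_ge0.
  pose t := Num.min 1 (e / (Q + 1)).
  have t0 : 0 < t by rewrite lt_min ltr01 divr_gt0 // ltr_wpDl.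
  have t1 : t <= 1 by rewrite ge_min lexx.
  have te : t * (Q + 1) <= e.
    by rewrite -ler_pdivlMr ?ltr_wpDl // ge_min lexx orbT.
  have th : rnorm (z + t%:C *: h - z) <= t * dl.
    by rewrite addrC addKr rnormZ rnorm_real (gtr0_norm t0) ler_wpM2l // ltW.
  have t01 : 0 <= t <= 1 by rewrite ltW.
  have h1 : rnorm (chi d g (z + t%:C *: h) T - chi d g z T - t%:C * L T h) <=
      C * rnorm T * (t * t).
    have := @Lexp T (z + t%:C *: h) z t t AT (ltW t0) t01 th.
    rewrite subrr rnorm0 => /(_ (mulr_ge0 (ltW t0) (ltW dl0)) th).
    by rewrite [z + _ - z]addrC addKr LZ.
  have := hK t; rewrite t0 t1 => /(_ isT) h2.
  have h3 : t * rnorm (L T h - c) <= Q * (t * t).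
    have -> : t * rnorm (L T h - c) = rnorm (t%:C * (L T h - c)).
      by rewrite rnormM rnorm_real gtr0_norm.
    have -> : t%:C * (L T h - c) =
        (chi d g (z + t%:C *: h) T - chi d g z T - t%:C * c) -
        (chi d g (z + t%:C *: h) T - chi d g z T - t%:C * L T h) by ring.
    apply: le_trans (rnormB_le _ _) _; apply: le_trans (lerD h2 h1) _.
    by rewrite /Q mulrDl.
  have h4 : rnorm (L T h - c) <= Q * t.
    by rewrite -(ler_pM2l t0) mulrCA.
  by apply: le_trans h4 _; apply: le_trans te; rewrite mulrC ler_wpM2l ?(ltW t0) // lerDl.
have Lline T h (t : R) : Ag T -> rnorm h <= dl -> 0 < t <= 1 ->
    rnorm (chi d g (z + t%:C *: h) T - chi d g z T - t%:C * L T h) <= C * rnorm T * (t * t).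
  move=> AT hd /andP[t0 t1].
  have th : rnorm (z + t%:C *: h - z) <= t * dl.
    by rewrite addrC addKr rnormZ rnorm_real (gtr0_norm t0) ler_wpM2l // ltW.
  have t01 : 0 <= t <= 1 by rewrite ltW.
  have := @Lexp T (z + t%:C *: h) z t t AT (ltW t0) t01 th.
  rewrite subrr rnorm0 => /(_ (mulr_ge0 (ltW t0) (ltW dl0)) th).
  by rewrite [z + _ - z]addrC addKr LZ.
have line_dom h (t : R) : rnorm h <= dl -> 0 < t <= 1 -> scalar_domain g (z + t%:C *: h).
  move=> hd /andP[t0 t1]; apply: Dball; rewrite addrC addKr rnormZ rnorm_real.
  rewrite (gtr0_norm t0); apply: le_trans hd.
  by rewrite ler_piMl ?rnorm_ge0.
(* The operators whose transform has vanishing derivative along h form a closed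
   algebra; closedness is Cauchy's estimate. *)
have kernel h : rnorm h <= dl -> Lphi h = 0 -> forall T, Af T -> L (Psi T) h = 0.
  move=> hd h0.
  have sub S T : Af S -> Af T -> L (Psi (S - T)) h = L (Psi S) h - L (Psi T) h.
    move=> AS AT; have -> : S - T = -1 *: T + S by rewrite scaleN1r addrC.
    by rewrite Psi_lin // LlinT mulN1r addrC.
  apply: (polydomain_ind (f := f) (m := m)) => [T AT HT||a S T AS AT HS HT|S T AS AT HS HT|i j].
  - apply: rnorm_le0 => e e0; have [S [AS HS /ltW ST]] := HT e e0.
    have AST : Af (S - T) by apply: (subalgB (polydomain_subalgebra m f)).
    rewrite -rnormN -[- _]add0r -{1}HS -sub //.
    (* On the ball the transform of Psi (S - T) at x is the character at phi x applied to S - T, so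
       the norm of S - T bounds it. *)
    apply: Lcauchy => //; first exact: PsiA.
    move=> x xd; rewrite -chi_phi //; last exact: Dball.
    apply: le_trans ST; apply: chi_le => //.
    exact/phi_domain/Dball.
  - have A1 : Ag 1 by case: (polydomain_subalgebra d g).
    rewrite Psi1; apply: (@Luniq _ h 0 0) => // t t01.
    have [X1 _ _] := chi_character d_gt0 (line_dom h t hd t01).
    have [Y1 _ _] := chi_character d_gt0 Dz.
    by rewrite X1 Y1 subrr sub0r mulr0 oppr0 rnorm0 mul0r.
  - by rewrite Psi_lin // LlinT HS HT mulr0 addr0.
  - have AS' := PsiA AS; have AT' := PsiA AT.
    have AST : Ag (Psi S * Psi T).
      by case: (polydomain_subalgebra d g) => _ _ _; apply.
    rewrite Psi_mul //.
    (* Product rule: each transform changes by O(t^2) along h, and the factor multiplying that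
       change is bounded by its operator norm. *)
    apply: (@Luniq _ h 0 (C * rnorm (Psi S) * rnorm (Psi T) + rnorm (Psi S) * (C * rnorm (Psi T)))) => //.
      by rewrite addr_ge0 ?mulr_ge0 ?rnorm_ge0.
    move=> t t01; have Dt := line_dom h t hd t01.
    have [_ _ XM] := chi_character d_gt0 Dt; have [_ _ YM] := chi_character d_gt0 Dz.
    rewrite XM // YM // mulr0 subr0.
    have := Lline _ _ _ AS' hd t01; rewrite HS mulr0 subr0.
    have := Lline _ _ _ AT' hd t01; rewrite HT mulr0 subr0.
    have := chi_le d_gt0 Dt AT'; have := chi_le d_gt0 Dz AS'.
    set s0 := chi d g z (Psi S); set u0 := chi d g z (Psi T).
    set s1 := chi _ _ _ (Psi S); set u1 := chi _ _ _ (Psi T).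
    move=> s0S u1T uu ss.
    have -> : s1 * u1 - s0 * u0 = (s1 - s0) * u1 + s0 * (u1 - u0) by ring.
    apply: le_trans (rnormD _ _) _; rewrite !rnormM mulrDl.
    apply: lerD.
      rewrite mulrAC; exact: ler_pM (rnorm_ge0 _) (rnorm_ge0 _) ss u1T.
    rewrite -mulrA; exact: ler_pM (rnorm_ge0 _) (rnorm_ge0 _) s0S uu.
  - by rewrite -Lphi_entry h0 entryE mxE.
have Lcoord h i (j : 'I_(l i)) : rnorm h <= dl -> L (umodel g d j) h = entry h j.
  move=> hd; apply: (@Luniq _ h _ 0) => // t t01.
  rewrite !chi_umodel //; last exact: line_dom.
  by rewrite entryD entryZ [_ + _ - entry z j]addrC addKr subrr rnorm0 mul0r.
have Linj (h : 'rV[R[i]]_(\sum_i l i)) : h *m M = 0 -> h = 0.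
  rewrite LphiM => h0; apply/eqP; apply: contraT => hn.
  have hp : 0 < rnorm h by rewrite rnorm_gt0.
  (* The vector is rescaled into the ball, where [kernel] applies. The coordinates of g are
     transforms of operators Psi T, so their derivatives, the entries of the rescaled h, vanish. *)
  pose a := dl / rnorm h; have a0 : 0 < a by rewrite divr_gt0.
  have ahd : rnorm (a%:C *: h) <= dl.
    by rewrite rnormZ rnorm_real gtr0_norm // mulfVK // gt_eqF.
  have ah0 : Lphi (a%:C *: h) = 0.
    by have := Lphi_lin a%:C h 0; rewrite addr0 Lphi0 addr0 h0 scaler0.
  have : a%:C *: h = 0.
    apply: entryP => i j; rewrite -Lcoord //; have [T AT TW] := Psi_surj (AgW i j).
    by rewrite -TW (kernel _ ahd ah0) // entryE mxE.
  move=> /eqP; rewrite scaler_eq0 (negbTE hn) orbF (_ : 0 = 0%:C) //.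
  by rewrite (inj_eq (@complexI _)) gt_eqF.
(* Summing all operator norms gives one constant valid for every entry. *)
pose W := \sum_i \sum_(j < n i) rnorm (Psi (umodel f m j)).
have W0 : 0 <= W by do 2 (apply: sumr_ge0 => ? _); exact: rnorm_ge0.
exists M, dl, (C * W); split => //; first by rewrite mulr_ge0.
  move=> x y e c e0 c01 xz yz xy.
  have c0 : 0 <= c by case/andP: c01.
  apply/rnorm_entry_le => [|i j]; first by rewrite !mulr_ge0.
  rewrite entryB entryB phi_entryB LphiM Lphi_entry.
  have AW := PsiA (AfW i j).
  apply: le_trans (Lexp _ _ _ _ _ AW e0 c01 xz yz xy) _.
  rewrite ler_wpM2r ?mulr_ge0 // ler_wpM2l //.
  rewrite /W (bigD1 i) //= (bigD1 j) //= -addrA lerDl.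
  by rewrite addr_ge0 // sumr_ge0 // => ? _; rewrite ?sumr_ge0 // => *; exact: rnorm_ge0.
apply: inj_row_free => v; exact: Linj.
Qed.

Lemma phi_differentiable : differentiable phi z.
Proof.
have [L [dl [C [dl0 C0 _ FL _]]]] := phi_expansion.
exact: (expansion_differentiable dl0 C0 FL).
Qed.

Lemma dim_le : (\sum_i l i <= \sum_i n i)%N.
Proof.
have [L [_ [_ [_ _ _ _ /eqP <-]]]] := phi_expansion.
exact: rank_leq_col.
Qed.

(** In equal dimensions the injective derivative is invertible, so the image of a ball contained in
    the domain is a neighbourhood of phi z inside the other domain. *)
Lemma phi_interior : (\sum_i n i <= \sum_i l i)%N ->
  interior (scalar_domain f) (phi z).
Proof.
move=> nl; have [L [dl [C [dl0 C0 Dball FL Lfree]]]] := phi_expansion.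
have Lfull : row_full L.
  by rewrite /row_full (eqP Lfree) eqn_leq nl dim_le.
have BL := mulVpmx Lfull.
apply: filterS (expansion_open dl0 C0 FL BL) => _ [x xd <-].
exact/phi_domain/Dball.
Qed.

End interior_point.

End transport.

(** * The map of [Psi] and the map of its inverse combined *)

Theorem theorem4p1 (R : realType)
  (k k' : nat) (n m : 'I_k -> nat) (l d : 'I_k' -> nat)
  (f : forall i, prfh R (n i)) (g : forall i, prfh R (l i))
  (k_gt0 : (0 < k)%N) (k'_gt0 : (0 < k')%N)
  (n_gt0 : forall i, (0 < n i)%N) (l_gt0 : forall i, (0 < l i)%N)
  (m_gt0 : forall i, (0 < m i)%N) (d_gt0 : forall i, (0 < d i)%N)
  (f_closed : forall H : hilbertType R, closed (polydomain f m (H := H)))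
  (g_closed : forall H : hilbertType R, closed (polydomain g d (H := H)))
  (Psi : bop (fock R n) -> bop (fock R l))
  (Psi_iso : unital_cc_isomorphism
    (polydomain_algebra f m) (polydomain_algebra g d) Psi) :
  let Df := scalar_domain f in
  let Dg := scalar_domain g in
  let phi := berezin_limit f m g d Psi in
  [/\ forall la, Dg la ->
        (forall r : R, 0 <= r < 1 -> scalar_domain_strict g (r%:C *: la)) /\
        (forall i (j : 'I_(n i)),
          cvg (berezin g d (r%:C *: la) (Psi (umodel f m j))
            @[r --> (1:R)^'-])),
      homeomorphism_onto Dg Df phi,
      biholomorphic_onto (interior Dg) (interior Df) phi &
      (\sum_i n i = \sum_i l i)%N].
Proof.
have [[PsiA Psi_inj Psi_surj] Psi_lin Psi_mul Psi1 _] := Psi_iso.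
set Af := polydomain_algebra f m in PsiA Psi_inj Psi_surj Psi_lin Psi_mul.
set Ag := polydomain_algebra g d in PsiA Psi_surj.
have {}PsiA T : Af T -> Ag (Psi T) by move=> AT; apply: PsiA.
have Psi_onto T' : Ag T' -> exists2 T, Af T & Psi T = T'.
  by move=> /Psi_surj[T AT TT']; exists T.
have {}Psi_inj S T : Af S -> Af T -> Psi S = Psi T -> S = T.
  by move=> AS AT; apply: Psi_inj; rewrite inE.
(* A chosen preimage inside the algebra, and 0 where there is none; on [Ag] it is the two-sided
   inverse. *)
pose Psi' T' := xget 0 [set T | Af T /\ Psi T = T'].
have Psi'P T' : Ag T' -> Af (Psi' T') /\ Psi (Psi' T') = T'.
  move=> /Psi_onto[T AT TT'].
  by apply: (@xgetPex _ 0 [set T | Af T /\ Psi T = T']); exists T.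
have Psi'A T' : Ag T' -> Af (Psi' T') by move=> /Psi'P[].
have PsiK' T' : Ag T' -> Psi (Psi' T') = T' by move=> /Psi'P[].
have Psi'K T : Af T -> Psi' (Psi T) = T.
  by move=> AT; have [AT' e] := Psi'P _ (PsiA _ AT); exact: Psi_inj.
have [_ Af1 Afl AfM] := polydomain_subalgebra m f.
have [_ Ag1 Agl AgM] := polydomain_subalgebra d g.
have Psi'_onto T : Af T -> exists2 T', Ag T' & Psi' T' = T.
  by move=> AT; exists (Psi T); [exact: PsiA|exact: Psi'K].
have Psi'_lin a S T : Ag S -> Ag T -> Psi' (a *: S + T) = a *: Psi' S + Psi' T.
  move=> AS AT; have AS' := Psi'A _ AS; have AT' := Psi'A _ AT.
  by rewrite -{1}(PsiK' S) // -{1}(PsiK' T) // -Psi_lin // Psi'K //; exact: Afl.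
have Psi'_mul S T : Ag S -> Ag T -> Psi' (S * T) = Psi' S * Psi' T.
  move=> AS AT; have AS' := Psi'A _ AS; have AT' := Psi'A _ AT.
  by rewrite -{1}(PsiK' S) // -{1}(PsiK' T) // -Psi_mul // Psi'K //; exact: AfM.
have Psi'1 : Psi' 1 = 1 by rewrite -{1}Psi1 Psi'K.
move=> Df Dg phi; pose phi' := berezin_limit g d f m Psi'.
have phiD la : Dg la -> Df (phi la) by exact: phi_domain.
have phi'D mu : Df mu -> Dg (phi' mu) by exact: phi_domain.
have phiK la : Dg la -> phi' (phi la) = la.
  move=> Dla; apply: entryP => i j.
  have AW : Ag (umodel g d j) by exact: polydomain_gen.
  rewrite phi_entry (chi_phi m_gt0 d_gt0) //; last exact: Psi'A.
  by rewrite PsiK' // chi_umodel.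
have phi'K mu : Df mu -> phi (phi' mu) = mu.
  move=> Dmu; apply: entryP => i j.
  have AW : Af (umodel f m j) by exact: polydomain_gen.
  rewrite phi_entry (chi_phi d_gt0 m_gt0) //; last exact: PsiA.
  by rewrite Psi'K // chi_umodel.
have ln : (\sum_i l i <= \sum_i n i)%N.
  exact: (dim_le m_gt0 d_gt0 PsiA Psi_onto Psi_lin Psi_mul Psi1 (zero_interior g)).
have nl : (\sum_i n i <= \sum_i l i)%N.
  exact: (dim_le d_gt0 m_gt0 Psi'A Psi'_onto Psi'_lin Psi'_mul Psi'1 (zero_interior f)).
have phiI la : interior Dg la -> interior Df (phi la).
  by move=> Ila; exact: (phi_interior m_gt0 d_gt0 PsiA Psi_onto Psi_lin Psi_mul Psi1 Ila).
have phi'I mu : interior Df mu -> interior Dg (phi' mu).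
  by move=> Imu; exact: (phi_interior d_gt0 m_gt0 Psi'A Psi'_onto Psi'_lin Psi'_mul Psi'1 Imu).
have IDg la : interior Dg la -> Dg la by exact: interior_subset.
have IDf mu : interior Df mu -> Df mu by exact: interior_subset.
split.
- move=> la Dla; split => [r r01|i j]; first exact: strict_scale.
  by apply: chi_is_cvg => //; apply: PsiA; exact: polydomain_gen.
- split.
    split => [la Dla|la la'|mu Dmu]; first exact: phiD.
      move=> /set_mem Dla /set_mem Dla' e.
      exact: etrans (esym (phiK la Dla)) (etrans (congr1 phi' e) (phiK la' Dla')).
    by exists (phi' mu); [exact: phi'D|exact: phi'K].
  exists phi'; split => [la||].
  + by move=> /set_mem; exact: phiK.
  + exact: (phi_continuous d_gt0 PsiA).
  + exact: (phi_continuous m_gt0 Psi'A).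
- split.
    split => [la Dla|la la'|mu Dmu]; first exact: phiI.
      move=> /set_mem/IDg Dla /set_mem/IDg Dla' e.
      exact: etrans (esym (phiK la Dla)) (etrans (congr1 phi' e) (phiK la' Dla')).
    by exists (phi' mu); [exact: phi'I|exact/phi'K/IDf].
  exists phi'; split => [la|la Ila|mu Imu].
  + by move=> /set_mem/IDg; exact: phiK.
  + exact: (phi_differentiable m_gt0 d_gt0 PsiA Psi_onto Psi_lin Psi_mul Psi1 Ila).
  + exact: (phi_differentiable d_gt0 m_gt0 Psi'A Psi'_onto Psi'_lin Psi'_mul Psi'1 Imu).
- by apply/eqP; rewrite eqn_leq nl ln.
Qed.
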